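(* Let $\widetilde X=X_1\times X_2$ be a product of two spaces of homogeneous type, and let $\mathcal D_1,\mathcal D_2$ be systems of dyadic cubes with distinguished center points on $X_1,X_2$. If $f\in H^1_{\mathcal D_1,\mathcal D_2}(\widetilde X)\cap L^2(\widetilde X)$, then $$f=\sum_k\lambda_ka_k,$$ where each $a_k$ is a dyadic atom of $H^1_{\mathcal D_1,\mathcal D_2}(\widetilde X)$, and $\sum_k|\lambda_k|\le C\|f\|_{H^1_{\mathcal D_1,\mathcal D_2}(\widetilde X)}$. Conversely, suppose $f:=\sum_k\lambda_ka_k$ where each $a_k$ is a dyadic atom of $H^1_{\mathcal D_1,\mathcal D_2}(\widetilde X)$, and $\sum_k|\lambda_k|\le C<\infty$. Then $f\in H^1_{\mathcal D_1,\mathcal D_2}(\widetilde X)$ and $\|f\|_{H^1_{\mathcal D_1,\mathcal D_2}(\widetilde X)}\le C\sum_k|\lambda_k|$.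
   Context: **Constants.** $C$ denotes positive constants, not necessarily the same at each occurrence; in the two norm inequalities it is independent of $f$. **Spaces of homogeneous type.** A quasi-metric on $X$ is a map $\rho:X\times X\to[0,\infty)$ which is symmetric, vanishes exactly on the diagonal, and satisfies $\rho(x,y)\le A_0[\rho(x,z)+\rho(z,y)]$, $A_0\ge1$. Balls: $B(x,r)=\{y:\rho(x,y)<r\}$. A space of homogeneous type $(X,\rho,\mu)$ is a set with a quasi-metric and a nonzero Borel measure $\mu$ (balls being measurable) with $\mu(B(x,2r))\le C_\mu\mu(B(x,r))<\infty$ for all $x,r$. A set is open if with each point it contains a ball centred there. $\widetilde X$ carries the product quasi-metric (product topology) and the product measure $\mu=\mu_1\times\mu_2$. **Dyadic cubes.** A system of dyadic cubes with parameters $\delta\in(0,1)$, $0<c_1\le C_1<\infty$ is a countable family $\mathscr D=\bigcup_{k\in\mathbb Z}\mathscr D_k$, $\mathscr D_k=\{Q^k_\alpha\}$, of Borel sets (a cube is understood together with its generation $k$) with: $X=\bigcup_\alpha Q^k_\alpha$ (disjoint) for each $k$; if $\ell\ge k$ then $Q^\ell_\beta\subseteq Q^k_\alpha$ or $Q^k_\alpha\cap Q^\ell_\beta=\emptyset$; for each $(k,\alpha)$ and $\ell\le k$ there is a unique $\beta$ with $Q^k_\alpha\subseteq Q^\ell_\beta$; each $Q^k_\alpha$ is the union of the cubes of $\mathscr D_{k+1}$ it contains (children), whose number is between $1$ and a fixed constant; there are center points $x^k_\alpha\in Q^k_\alpha$ with $B(x^k_\alpha,c_1\delta^k)\subseteq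 Q^k_\alpha\subseteq B(x^k_\alpha,C_1\delta^k)=:B(Q^k_\alpha)$; and if $\ell\ge k$, $Q^\ell_\beta\subseteq Q^k_\alpha$ then $B(Q^\ell_\beta)\subseteq B(Q^k_\alpha)$. Distinguished center point: a point $x_0$ which at every generation $k$ is the center point of some cube in $\mathscr D_k$. A dyadic rectangle is $R=Q_1\times Q_2$ with $Q_i\in\mathcal D_i$. **Haar functions.** For $Q\in\mathscr D$ with children $Q_1,\dots,Q_{M_Q}$ indexed so that $\sum_{j=u}^{M_Q}\mu(Q_j)\ge[1-(u-1)M_Q^{-1}]\mu(Q)$ for all $u$ (e.g. by increasing measure), put $E_u=\bigcup_{j\ge u}Q_j$ and, for $u=1,\dots,M_Q-1$, $$h_Q^u=\frac{\mu(E_{u+1})^{1/2}}{\mu(Q_u)^{1/2}\mu(E_u)^{1/2}}1_{Q_u}-\frac{\mu(Q_u)^{1/2}}{\mu(E_u)^{1/2}\mu(E_{u+1})^{1/2}}1_{E_{u+1}}.$$ **Dyadic product Hardy space.** With $\widetilde\chi_{Q_i}=\chi_{Q_i}\mu_i(Q_i)^{-1/2}$ and $\langle f,g\rangle=\int fg\,d\mu$, $$S_{d,d}(f)(x_1,x_2)=\Big\{\sum_{Q_1\in\mathcal D_1}\sum_{Q_2\in\mathcal D_2}\sum_{u_1=1}^{M_{Q_1}-1}\sum_{u_2=1}^{M_{Q_2}-1}\big|\langle f,h_{Q_1}^{u_1}h_{Q_2}^{u_2}\rangle\,\widetilde\chi_{Q_1}(x_1)\widetilde\chi_{Q_2}(x_2)\big|^2\Big\}^{1/2},$$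 $H^1_{\mathcal D_1,\mathcal D_2}(\widetilde X)=\{f\in L^1(\widetilde X):S_{d,d}(f)\in L^1(\widetilde X)\}$, and $\|f\|_{H^1_{\mathcal D_1,\mathcal D_2}(\widetilde X)}=\|S_{d,d}(f)\|_{L^1(\widetilde X)}$. **Dyadic atoms.** For an open set $\Omega\subset\widetilde X$ of finite measure, $m(\Omega)$ is the collection of maximal dyadic rectangles $R\in\mathcal D_1\times\mathcal D_2$ contained in $\Omega$. A function $a(x_1,x_2)$ on $\widetilde X$ is a dyadic atom of $H^1_{\mathcal D_1,\mathcal D_2}(\widetilde X)$ if: (1) $\operatorname{supp}a\subset\Omega$ for some open set $\Omega$ of finite measure; (2) $\|a\|_{L^2}\le\mu(\Omega)^{-1/2}$; (3) $a$ can be decomposed into rectangle atoms $a_R$ associated to dyadic rectangles $R\in\mathcal D_1\times\mathcal D_2$ such that (i) $\operatorname{supp}a_R\subset R$; (ii) $\int_{X_1}a_R(x_1,x_2)\,d\mu_1(x_1)=0$ for a.e. $x_2\in X_2$ and $\int_{X_2}a_R(x_1,x_2)\,d\mu_2(x_2)=0$ for a.e. $x_1\in X_1$; (iii) $a=\sum_{R\in m(\Omega)}a_R$ and $\sum_{R\in m(\Omega)}\|a_R\|_{L^2(\widetilde X)}^2\le\mu(\Omega)^{-1}$.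
   Formalization: If X_1 or X_2 has finite measure, f = sum lambda_k a_k fails (f = 1⊗g has S(f) = 0), so f itself is recovered only when both measures are infinite; otherwise the series converges in L^1 to some g with ||f - g||_{H^1} = 0. *)

(* Defs.v *)
From HB Require Import structures.
From mathcomp Require Import all_boot all_order all_algebra.
From mathcomp Require Import all_classical all_reals all_analysis.
Set Implicit Arguments.
Unset Strict Implicit.
Unset Printing Implicit Defensive.
Import Order.TTheory GRing.Theory Num.Theory.
Import numFieldNormedType.Exports.
Local Open Scope classical_set_scope.
Local Open Scope ring_scope.

Section QuasiMetric.
Context {R : realType} {X : Type}.
Implicit Types (rho : X -> X -> R) (U : set X).

Record quasi_metric rho : Prop := QuasiMetric {
  qm_ge0 : forall x y, 0 <= rho x y;
  qm_sym : forall x y, rho x y = rho y x;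
  qm_eq0 : forall x y, rho x y = 0 <-> x = y;
  qm_triangle : exists2 A0 : R, 1 <= A0 &
    forall x y z, rho x y <= A0 * (rho x z + rho z y) }.

Definition qball rho (x : X) (r : R) : set X := [set y | rho x y < r].

(* Quasi-metric balls themselves need not be open in this sense. *)
Definition qopen rho : set (set X) :=
  [set U | forall x, U x -> exists2 r : R, 0 < r & qball rho x r `<=` U].

End QuasiMetric.

(* Its balls are the products of balls of equal radius, so it induces the
   product topology. *)
Definition prod_qm {R : realType} {X1 X2 : Type} (rho1 : X1 -> X1 -> R)
    (rho2 : X2 -> X2 -> R) (x y : X1 * X2) : R :=
  Num.max (rho1 x.1 y.1) (rho2 x.2 y.2).

Record homogeneous_type {R : realType} {d : measure_display}
    {X : measurableType d} (rho : X -> X -> R)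
    (mu : {measure set X -> \bar R}) : Prop := HomogeneousType {
  ht_quasi_metric : quasi_metric rho;
  ht_borel : @measurable d X = <<s qopen rho >>;
  ht_measurable_ball : forall x r, measurable (qball rho x r);
  ht_nonzero : mu setT != 0%E;
  ht_ball_fin : forall x (r : R), 0 < r -> (mu (qball rho x r) < +oo)%E;
  ht_doubling : exists Cmu : R, forall x (r : R), 0 < r ->
    (mu (qball rho x (2 * r)) <= Cmu%:E * mu (qball rho x r))%E }.

(* A system of dyadic cubes is given by its generations [D k]; the cubes of one
   generation are nonempty and disjoint, so no further index is needed.  A cube
   together with its generation is a pair [(k, Q)] with [D k Q], and [ctr k Q]
   is its center point. *)
Section DyadicCubes.
Context {R : realType} {d : measure_display} {X : measurableType d}.
Implicit Types (D : int -> set (set X)) (ctr : int -> set X -> X) (k l : int)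
  (Q : set X).

Definition cubes D : set (int * set X) := [set q | D q.1 q.2].

Definition children D k Q : set (set X) :=
  [set P | D (k + 1) P /\ P `<=` Q].

Definition cube_ball (rho : X -> X -> R) (delta C1 : R) ctr k Q : set X :=
  qball rho (ctr k Q) (C1 * delta ^ k).

Record dyadic_system (rho : X -> X -> R) (delta c1 C1 : R) D ctr : Prop :=
  DyadicSystem {
  ds_delta : 0 < delta < 1;
  ds_radii : 0 < c1 <= C1;
  ds_countable : forall k, countable (D k);
  ds_measurable : forall k Q, D k Q -> measurable Q;
  ds_cover : forall k, \bigcup_(Q in D k) Q = setT;
  ds_disjoint : forall k, trivIset (D k) id;
  ds_nested : forall (k l : int) P Q, k <= l -> D k Q -> D l P ->
    P `<=` Q \/ Q `&` P = set0;
  ds_ancestor : forall (k l : int) Q, l <= k -> D k Q ->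
    exists! P, D l P /\ Q `<=` P;
  ds_children_cover : forall k Q, D k Q -> Q = \bigcup_(P in children D k Q) P;
  ds_children_card : exists N : nat, forall k Q, D k Q ->
    exists2 n : nat, (0 < n <= N)%N & (children D k Q #= `I_n)%card;
  ds_center : forall k Q, D k Q -> Q (ctr k Q);
  ds_inner_ball : forall k Q, D k Q ->
    qball rho (ctr k Q) (c1 * delta ^ k) `<=` Q;
  ds_outer_ball : forall k Q, D k Q -> Q `<=` cube_ball rho delta C1 ctr k Q;
  ds_ball_mono : forall (k l : int) P Q, k <= l -> D k Q -> D l P -> P `<=` Q ->
    cube_ball rho delta C1 ctr l P `<=` cube_ball rho delta C1 ctr k Q }.

Definition distinguished_center D ctr : Prop :=
  exists x0 : X, forall k, exists2 Q, D k Q & ctr k Q = x0.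

(* [ord k Q] lists the children of [Q] in the order used to define its Haar
   functions.  Lists are indexed from 0: with [v = u - 1], [drop v (ord k Q)]
   is the list of the children $Q_u, \dots, Q_{M_Q}$. *)
Definition haar_order (mu : {measure set X -> \bar R}) D
    (ord : int -> set X -> seq (set X)) : Prop :=
  forall k Q, D k Q ->
    [/\ uniq (ord k Q), [set` ord k Q] = children D k Q &
     forall v : nat, (v < size (ord k Q))%N ->
       ((1 - v%:R / (size (ord k Q))%:R)%:E * mu Q
         <= \sum_(P <- drop v (ord k Q)) mu P)%E].

Definition tail_union (s : seq (set X)) (v : nat) : set X :=
  \bigcup_(P in [set` drop v s]) P.

Definition sqrt_meas (mu : {measure set X -> \bar R}) (A : set X) : R :=
  Num.sqrt (fine (mu A)).

(* The Haar function $h_Q^{v+1}$ of a cube with ordered list of children [s];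
   it is used for [v < (size s).-1]. *)
Definition haar (mu : {measure set X -> \bar R}) (s : seq (set X)) (v : nat)
    (x : X) : R :=
  let m := sqrt_meas mu in
  let Qv := nth set0 s v in
  let Ev := tail_union s v in
  let Ev1 := tail_union s v.+1 in
  m Ev1 / (m Qv * m Ev) * \1_Qv x - m Qv / (m Ev * m Ev1) * \1_Ev1 x.

Definition normalized_indic (mu : {measure set X -> \bar R}) (Q : set X)
    (x : X) : R :=
  \1_Q x / sqrt_meas mu Q.

End DyadicCubes.

Section ProductHardy.
Context {R : realType} {d1 d2 : measure_display}.
Context {X1 : measurableType d1} {X2 : measurableType d2}.
Variables (rho1 : X1 -> X1 -> R) (rho2 : X2 -> X2 -> R).
(* Sigma-finiteness, needed to form the product measure, is automatic on a
   space of homogeneous type: the space is a countable union of balls. *)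
Variables (mu1 : {sigma_finite_measure set X1 -> \bar R}).
Variables (mu2 : {sigma_finite_measure set X2 -> \bar R}).
Variables (D1 : int -> set (set X1)) (D2 : int -> set (set X2)).
Variables (ord1 : int -> set X1 -> seq (set X1)).
Variables (ord2 : int -> set X2 -> seq (set X2)).
Implicit Types (f a : X1 * X2 -> R) (Omega : set (X1 * X2)).

Local Notation mu := (mu1 \x mu2)%E.
Local Notation rect := ((int * set X1) * (int * set X2))%type.

Definition rects : set rect := cubes D1 `*` cubes D2.

Definition rect_set (r : rect) : set (X1 * X2) := r.1.2 `*` r.2.2.

Definition haar_coef f (r : rect) (v1 v2 : nat) : R :=
  \int[mu]_x (f x * (haar mu1 (ord1 r.1.1 r.1.2) v1 x.1
                     * haar mu2 (ord2 r.2.1 r.2.2) v2 x.2)).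

Definition square_fun f (x : X1 * X2) : \bar R :=
  ((\esum_(r in rects)
      \sum_(v1 < (size (ord1 r.1.1 r.1.2)).-1)
      \sum_(v2 < (size (ord2 r.2.1 r.2.2)).-1)
        (`|haar_coef f r v1 v2
           * normalized_indic mu1 r.1.2 x.1
           * normalized_indic mu2 r.2.2 x.2| ^+ 2)%:E) `^ 2^-1)%E.

Definition hardy : set (X1 * X2 -> R) :=
  [set f | f \in Lfun mu 1 /\ mu.-integrable setT (square_fun f)].

Definition hardy_norm f : \bar R := ('N[mu]_1[square_fun f])%E.

(* Rectangles keep track of generations; maximality is with respect to inclusion of the underlying sets. *)
Definition max_rects Omega : set rect :=
  [set r | [/\ rects r, rect_set r `<=` Omega &
     forall r', rects r' -> rect_set r' `<=` Omega ->
       rect_set r `<=` rect_set r' -> rect_set r' = rect_set r]].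

(* Unordered (unconditional) summation in L^2. *)
Definition L2_sum (I : set rect) (b : rect -> X1 * X2 -> R) a : Prop :=
  forall e : R, 0 < e ->
    exists F0 : set rect, [/\ finite_set F0, F0 `<=` I &
      forall F : set rect, finite_set F -> F0 `<=` F -> F `<=` I ->
        ('N[mu]_2%:E[(fun x => (a x - \sum_(r \in F) b r x)%:E)] <= e%:E)%E].

Definition supported_in (A : set (X1 * X2)) a : Prop :=
  {ae mu, forall x, ~ A x -> a x = 0}.

Record rect_atom (r : rect) a : Prop := RectAtom {
  ra_L2 : a \in Lfun mu 2%:E;
  ra_supp : supported_in (rect_set r) a;
  ra_cancel1 : {ae mu2, forall x2, (\int[mu1]_x1 (a (x1, x2))%:E = 0)%E};
  ra_cancel2 : {ae mu1, forall x1, (\int[mu2]_x2 (a (x1, x2))%:E = 0)%E} }.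

Definition dyadic_atom a : Prop :=
  exists Omega : set (X1 * X2),
    [/\ [/\ qopen (prod_qm rho1 rho2) Omega, measurable Omega &
            (mu Omega < +oo)%E],
        supported_in Omega a,
        a \in Lfun mu 2%:E /\
        ('N[mu]_2%:E[EFin \o a] <= (mu Omega `^ 2^-1)^-1)%E &
        exists b : rect -> X1 * X2 -> R,
          [/\ forall r, max_rects Omega r -> rect_atom r (b r),
              L2_sum (max_rects Omega) b a &
              (\esum_(r in max_rects Omega) ('N[mu]_2%:E[EFin \o b r] ^+ 2)
                <= (mu Omega)^-1)%E]].

Definition L1_series (lambda : nat -> R) (a : nat -> X1 * X2 -> R) f : Prop :=
  f \in Lfun mu 1 /\
  ((fun n : nat => 'N[mu]_1[(fun x =>
      (f x - \sum_(k < n) lambda k * a k x)%:E)])%E @ \oo --> 0%E).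

End ProductHardy.

(* Main.v *)
Require Import Defs.
From HB Require Import structures.
From mathcomp Require Import all_boot all_order all_algebra finmap.
From mathcomp Require Import all_classical all_reals all_analysis.
From mathcomp Require Import measurable_realfun ring lra.
Set Implicit Arguments.
Unset Strict Implicit.
Unset Printing Implicit Defensive.
Import Order.TTheory GRing.Theory Num.Theory.
Import numFieldNormedType.Exports.
Local Open Scope classical_set_scope.
Local Open Scope ring_scope.

(** An atom needs an open set, while neither cubes nor quasi-metric balls are open in general; the
    hulls repair this. They are monotone in the cube, so that the covering argument may discard
    every cube that meets a coarser selected one. The two one-variable coverings take the place of
    an L^2 bound for the strong maximal function and ask only that a rectangle be filled to a half.
    Finite blocks avoid any L^2 convergence of Haar series: a finite Haar sum has explicit
    coefficients and an explicit L^2 norm, and its decomposition over maximal rectangles regroups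
    finitely many terms. The price is the index j, whose geometric decay costs a factor 2. Comparing
    f with g through coefficients alone explains the two forms of the conclusion. If X_1 has finite
    measure, an integrable function of x_2 only has all its coefficients zero, hence Hardy norm
    zero, and no series with sum |lambda_k| <= C 0 represents it unless it vanishes. So equality
    with f is asserted when both measures are infinite, and equality up to Hardy norm zero in
    general. *)

Lemma int_le_ex (k l : int) : k <= l -> exists n : nat, l = k + n%:Z.
Proof.
by move=> kl; exists `|l - k|%N; rewrite gez0_abs ?subr_ge0// addrCA subrr addr0.
Qed.

(* Decomposition.  Let S f be the square function and Omega_k = {S f > 2^k}.  A
   dyadic rectangle has level k if k is the last index for which Omega_k fills at
   least half of it.  Replacing the sides of the rectangles of level k by slightly
   larger open sets gives an open set E_k, and a covering argument in each
   variable, slice by slice, yields mu(E_k) <= C mu(Omega_k).  Integrating (S f)^2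
   off Omega_(k+1) bounds the squared Haar coefficients of level k by
   C 4^k mu(E_k).  Each level is cut into finite blocks j whose energy is at most
   4^(-j) times that bound, so that only finite Haar sums occur; each block is
   lambda_(k,j) times an atom supported in E_k, with
   lambda_(k,j) = 2^(-j) 2^(k+2) mu(E_k), and sum_k 2^k mu(Omega_k) <= 2 |S f|_1.
   The sum g of the series has the Haar coefficients of f, hence S(f - g) = 0.  If
   both spaces have infinite measure, the averages of f - g over dyadic cubes equal
   those over arbitrarily large ancestors, so that f = g almost everywhere.

   Synthesis.  The Haar coefficients of an atom vanish outside the rectangles
   contained in its open set Omega, so S a lives on Omega; Bessel's inequality and
   Cauchy-Schwarz on Omega give |S a|_1 <= 1, and Minkowski's inequality allows one
   to sum. *)

(** * Quasi-metric balls and dyadic cubes *)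

Section HomogeneousType.
Context {R : realType} {d : measure_display} {X : measurableType d}.
Variables (rho : X -> X -> R) (mu : {measure set X -> \bar R}).
Hypothesis hX : homogeneous_type rho mu.

Lemma qball_mono x r s : r <= s -> qball rho x r `<=` qball rho x s.
Proof. by move=> rs y /lt_le_trans; exact. Qed.

Lemma qopen_measurable U : qopen rho U -> measurable U.
Proof. by move=> oU; rewrite (ht_borel hX); exact: sub_sigma_algebra. Qed.

Lemma qball_iter_doubling : exists2 C : R, 0 < C & forall x (r : R) n, 0 < r ->
  (mu (qball rho x (2 ^+ n * r)) <= (C ^+ n)%:E * mu (qball rho x r))%E.
Proof.
have [C hC] := ht_doubling hX.
(* [ht_doubling] says nothing about the sign of its constant; the maximum with 1 is positive and
   only weakens the bound. *)
exists (Num.max 1 C); first by rewrite lt_max ltr01.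
move=> x r n r0; elim: n => [|n IH]; first by rewrite expr0 mul1r mul1e.
rewrite exprS -mulrA; apply: le_trans (hC _ _ _) _.
  by rewrite mulr_gt0 ?exprn_gt0.
have C0 : (0 <= (Num.max 1 C)%:E)%E by rewrite lee_fin le_max ler01.
rewrite exprS EFinM -muleA; apply: (@le_trans _ _ ((Num.max 1 C)%:E * mu (qball rho x (2 ^+ n * r)))%E).
  by apply: lee_wpmul2r => //; rewrite lee_fin le_max lexx orbT.
exact: lee_wpmul2l.
Qed.

Lemma qball_dilation (a : R) : exists2 C : R, 0 < C & forall x (r : R), 0 < r ->
  (mu (qball rho x (a * r)) <= C%:E * mu (qball rho x r))%E.
Proof.
have [C C0 hC] := qball_iter_doubling.
pose n := Num.truncn `|a|.
have an : a <= 2 ^+ n.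
  rewrite (le_trans (ler_norm a))//; rewrite -natrX.
  by rewrite (le_trans (ltW (truncnS_gt _)))// ler_nat ltn_expl.
exists (C ^+ n); first exact: exprn_gt0.
move=> x r r0; apply: le_trans (hC _ _ _ r0).
apply: le_measure; rewrite ?inE; [exact: ht_measurable_ball hX _ _..|].
by apply: qball_mono; rewrite ler_pM2r.
Qed.

(** A null ball would, by doubling, have null dilates; these exhaust the space, against
    [ht_nonzero]. *)
Lemma qball_gt0 x r : 0 < r -> (0 < mu (qball rho x r))%E.
Proof.
move=> r0; rewrite lt0e measure_ge0 andbT; apply/eqP => mu0.
have [C C0 hC] := qball_iter_doubling.
have /eqP := ht_nonzero hX; apply.
have -> : [set: X] = \bigcup_n qball rho x (2 ^+ n * r).
  apply/esym/seteqP; split=> // y _.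
  pose n := Num.truncn (rho x y / r).
  exists n.+1 => //; rewrite /qball/= -ltr_pdivrMr//.
  apply: (lt_le_trans (truncnS_gt _)).
  by rewrite -natrX ler_nat ltnW// ltn_expl.
apply/eqP; rewrite eq_le measure_ge0 andbT.
have mb n : measurable (qball rho x (2 ^+ n * r)) by exact: ht_measurable_ball hX _ _.
apply: le_trans (measure_sigma_subadditive mu mb _ (@subset_refl _ _)) _.
  exact: bigcup_measurable.
rewrite eseries0// => n _ _; apply/eqP; rewrite eq_le measure_ge0 andbT.
by rewrite (le_trans (hC _ _ _ r0))// mu0 mule0.
Qed.

End HomogeneousType.

Section OpenHull.
Context {R : realType} {d : measure_display} {X : measurableType d}.
Variables (rho : X -> X -> R) (mu : {measure set X -> \bar R}).
Hypothesis hX : homogeneous_type rho mu.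

(** Stage [n + 1] adds a ball of radius [q ^+ n * r] around each point of stage [n], so every point
    of the union owns a ball inside the union: this makes [hull] open although single balls need not
    be. The radii shrink geometrically to keep the hull near [A]. *)
Fixpoint hull_iter (q : R) (A : set X) (r : R) (n : nat) : set X :=
  if n is n'.+1 then
    \bigcup_(y in hull_iter q A r n') qball rho y (q ^+ n' * r)
  else A.

Definition hull q A r := \bigcup_n hull_iter q A r n.

Lemma sub_hull q A r : A `<=` hull q A r.
Proof. by move=> x Ax; exists 0%N. Qed.

Lemma qopen_hull q A r : 0 < q -> 0 < r -> qopen rho (hull q A r).
Proof.
move=> q0 r0 x [n _ nx]; exists (q ^+ n * r); first by rewrite mulr_gt0 ?exprn_gt0.
by move=> y xy; exists n.+1 => //; exists x.
Qed.

Lemma hull_mono q A B r s : 0 < q -> A `<=` B -> r <= s -> hull q A r `<=` hull q B s.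
Proof.
move=> q0 AB rs; suff H n : hull_iter q A r n `<=` hull_iter q B s n.
  by move=> x [n _ /H nx]; exists n.
elim: n => //= n IH x [y /IH By yx]; exists y => //.
apply: qball_mono yx; by rewrite ler_pM2l ?exprn_gt0.
Qed.

(** Unrolls the iteration at its first step instead of its last, so that in [hull_near] each use of
    the quasi-triangle inequality puts the factor [A0] on a remainder already scaled by [q]. Peeling
    off the last step would let these factors accumulate. *)
Lemma hull_iterS q A r n z : hull_iter q A r n.+1 z ->
  exists2 y, A y & hull_iter q (qball rho y r) (q * r) n z.
Proof.
elim: n z => [|n IH] z.
  by move=> /= [y Ay]; rewrite expr0 mul1r; exists y.
move=> [w /IH[y Ay yw] wz]; exists y => //; exists w => //.
by move: wz; rewrite /qball/= mulrA -exprSr.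
Qed.

(** The ratio [q = (2 * A0)^-1] closes the induction: from [rho y w < r] and, inductively,
    [rho w z <= 2 * A0 * (q * r) = r], the quasi-triangle inequality gives [A0 * (r + r)]. *)
Lemma hull_near (A0 : R) A r : 1 <= A0 -> 0 < r ->
  (forall x y z, rho x y <= A0 * (rho x z + rho z y)) ->
  hull (2 * A0)^-1 A r `<=` [set z | exists2 y, A y & rho y z <= 2 * A0 * r].
Proof.
move=> A1 r0 tri z [n _].
have A0p : 0 < A0 by rewrite (lt_le_trans ltr01).
set q := (2 * A0)^-1.
have rho0 x : rho x x = 0 by exact/(qm_eq0 (ht_quasi_metric hX)).
elim: n A r r0 z => [|n IH] A r r0 z.
  by move=> Az; exists z => //; rewrite rho0 !mulr_ge0// ltW.
move=> /hull_iterS[y Ay] /IH[]; first by rewrite mulr_gt0// invr_gt0 mulr_gt0.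
move=> w yw wz; exists y => //; apply: le_trans (tri _ _ w) _.
rewrite [2 * A0]mulrC -!mulrA ler_pM2l// mulr_natl mulr2n lerD//; first exact: ltW.
by move: wz; rewrite /q mulrA mulfV ?mul1r// mulf_neq0 ?gt_eqF.
Qed.

End OpenHull.

Section DyadicCubes.
Context {R : realType} {d : measure_display} {X : measurableType d}.
Variables (rho : X -> X -> R) (mu : {measure set X -> \bar R}).
Hypothesis hX : homogeneous_type rho mu.
Variables (delta c1 C1 : R) (D : int -> set (set X)) (ctr : int -> set X -> X).
Hypothesis hD : dyadic_system rho delta c1 C1 D ctr.
Implicit Types (k l : int) (P Q : set X).

Let delta_gt0 : 0 < delta. Proof. by case/andP: (ds_delta hD). Qed.
Let c1_gt0 : 0 < c1. Proof. by case/andP: (ds_radii hD). Qed.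
Let C1_gt0 : 0 < C1. Proof. by case/andP: (ds_radii hD) => /lt_le_trans; exact. Qed.
Let deltaX_gt0 k : 0 < delta ^ k. Proof. exact: exprz_gt0. Qed.

Lemma ler_deltaX k l : k <= l -> delta ^ l <= delta ^ k.
Proof.
move=> /int_le_ex[n ->].
rewrite exprzDr ?unitfE ?gt_eqF// ler_piMr//; first exact: ltW.
by apply: exprn_ile1; [exact: ltW|case/andP: (ds_delta hD) => _ /ltW].
Qed.

Lemma cube_measurable k Q : D k Q -> measurable Q.
Proof. exact: ds_measurable hD _ _. Qed.

Lemma cube_gt0 k Q : D k Q -> (0 < mu Q)%E.
Proof.
move=> DQ; apply: (@lt_le_trans _ _ (mu (qball rho (ctr k Q) (c1 * delta ^ k)))).
  by apply: (qball_gt0 hX); rewrite mulr_gt0.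
apply: le_measure; rewrite ?inE; [exact: ht_measurable_ball hX _ _|exact: cube_measurable DQ|].
exact: ds_inner_ball hD _ _ DQ.
Qed.

Lemma cube_lty k Q : D k Q -> (mu Q < +oo)%E.
Proof.
move=> DQ; apply: (@le_lt_trans _ _ (mu (qball rho (ctr k Q) (C1 * delta ^ k)))).
  apply: le_measure; rewrite ?inE; [exact: cube_measurable DQ|exact: ht_measurable_ball hX _ _|].
  exact: ds_outer_ball hD _ _ DQ.
by apply: (ht_ball_fin hX); rewrite mulr_gt0.
Qed.

Lemma cube_fin_num k Q : D k Q -> mu Q \is a fin_num.
Proof. by move=> DQ; rewrite ge0_fin_numE// (cube_lty DQ). Qed.

Lemma cube_fine_gt0 k Q : D k Q -> 0 < fine (mu Q).
Proof. by move=> DQ; rewrite fine_gt0// (cube_gt0 DQ) (cube_lty DQ). Qed.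

Lemma cube_nonempty k Q : D k Q -> exists x, Q x.
Proof. by move=> DQ; exists (ctr k Q); exact: ds_center hD _ _ DQ. Qed.

Lemma cube_ex k x : exists2 Q, D k Q & Q x.
Proof. by have : [set: X] x by []; rewrite -(ds_cover hD k) => -[Q DQ Qx]; exists Q. Qed.

Lemma cube_eq k P Q x : D k P -> D k Q -> P x -> Q x -> P = Q.
Proof. by move=> DP DQ Px Qx; apply: (ds_disjoint hD DP DQ); exists x. Qed.

Lemma cube_sub k l P Q x : k <= l -> D k Q -> D l P -> P x -> Q x -> P `<=` Q.
Proof.
move=> kl DQ DP Px Qx; case: (ds_nested hD kl DQ DP) => // QP0.
by have : (Q `&` P) x by []; rewrite QP0.
Qed.

Lemma cubes_countable : countable (cubes D).
Proof.
have -> : cubes D = \bigcup_(k in [set: int]) (pair k @` D k).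
  apply/seteqP; split=> [[k Q] DQ|_ [k _ [Q DQ <-]]//]; by exists k => //; exists Q.
apply: bigcup_countable => // k _; apply: sub_countable (ds_countable hD k).
exact: card_image_le.
Qed.

(* The hull depends on the generation because one set may be a cube of several
   generations, with different radii. *)
Lemma cube_hull : exists H : int -> set X -> set X, exists2 C : R, 0 < C &
  [/\ forall k Q, D k Q -> qopen rho (H k Q),
      forall k Q, D k Q -> Q `<=` H k Q,
      forall k l P Q, k <= l -> D k Q -> D l P -> P `<=` Q -> H l P `<=` H k Q &
      forall k Q, D k Q -> (mu (H k Q) <= C%:E * mu Q)%E].
Proof.
have [A0 A01 tri] := qm_triangle (ht_quasi_metric hX).
have A0p : 0 < A0 by rewrite (lt_le_trans ltr01).
have q0 : 0 < (2 * A0)^-1 by rewrite invr_gt0 mulr_gt0.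
pose H k Q := hull rho (2 * A0)^-1 (cube_ball rho delta C1 ctr k Q) (delta ^ k).
(* A point of the hull is within [2 * A0 * delta ^ k] of the outer ball, hence within
   [A0 * (C1 + 2 * A0) * delta ^ k] of the center; [a] expresses twice this in units of the inner
   radius. *)
pose a := 2 * A0 * (C1 + 2 * A0) / c1.
have [C C0 hC] := qball_dilation hX a.
exists H, C => //; split.
- by move=> k Q DQ; exact: qopen_hull.
- move=> k Q DQ; apply: subset_trans (ds_outer_ball hD DQ) _; exact: sub_hull.
- move=> k l P Q kl DQ DP PQ; apply: hull_mono => //.
    exact: (ds_ball_mono hD kl DQ DP).
  exact: ler_deltaX.
- move=> k Q DQ.
  pose r := c1 * delta ^ k; have r0 : 0 < r by rewrite mulr_gt0.
  apply: (@le_trans _ _ (mu (qball rho (ctr k Q) (a * r)))).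
    apply: le_measure; rewrite ?inE.
    - by apply: (qopen_measurable hX); exact: qopen_hull.
    - exact: ht_measurable_ball hX _ _.
    move=> z /(hull_near hX A01 (deltaX_gt0 k) tri)[y]; rewrite /cube_ball/qball/= => Qy yz.
    apply: (le_lt_trans (tri _ _ y)).
    rewrite /a /r [X in _ < X](_ : _ = 2 * (A0 * ((C1 + 2 * A0) * delta ^ k))); last by field; rewrite gt_eqF.
    apply: (@lt_le_trans _ _ (A0 * ((C1 + 2 * A0) * delta ^ k))); last first.
      by rewrite ler_peMl ?ler1n// !mulr_ge0// ?addr_ge0// ?mulr_ge0// ltW.
    by rewrite ltr_pM2l// mulrDl ltr_leD.
  apply: le_trans (hC _ _ r0) _; apply: lee_wpmul2l; first by rewrite lee_fin ltW.
  apply: le_measure; rewrite ?inE; [exact: ht_measurable_ball hX _ _|exact: cube_measurable DQ|].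
  exact: (ds_inner_ball hD DQ).
Qed.

(** The center of the child and any point of [Q] both lie within [C1 * delta ^ k] of the center of
    [Q], so [Q] lies in a dilate of the inner ball of the child, by a factor that depends only on
    the parameters. Doubling does the rest. *)
Lemma cube_le_child : exists2 C : R, 0 < C & forall k P Q, D k Q -> children D k Q P ->
  (mu Q <= C%:E * mu P)%E.
Proof.
have [A0 A01 tri] := qm_triangle (ht_quasi_metric hX).
have A0p : 0 < A0 by rewrite (lt_le_trans ltr01).
pose a := 2 * A0 * C1 / (c1 * delta).
have [C C0 hC] := qball_dilation hX a.
exists C => // k P Q DQ [DP PQ].
pose r := c1 * delta ^ (k + 1); have r0 : 0 < r by rewrite mulr_gt0.
apply: (@le_trans _ _ (mu (qball rho (ctr (k + 1) P) (a * r)))).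
  apply: le_measure; rewrite ?inE.
  - exact: cube_measurable DQ.
  - exact: ht_measurable_ball hX _ _.
  move=> z Qz; rewrite /qball /=.
  apply: (le_lt_trans (tri _ _ (ctr k Q))).
  have := ds_outer_ball hD DQ Qz; rewrite /cube_ball/qball/= => h1.
  have := ds_outer_ball hD DQ (PQ _ (ds_center hD DP)); rewrite /cube_ball/qball/= => h2.
  rewrite (qm_sym (ht_quasi_metric hX)) in h2.
  rewrite /a /r exprzDr ?unitfE ?gt_eqF// expr1z.
  rewrite [X in _ < X](_ : _ = A0 * (C1 * delta ^ k + C1 * delta ^ k)); last by field; rewrite !gt_eqF.
  by rewrite ltr_pM2l// ltrD.
apply: le_trans (hC _ _ r0) _; apply: lee_wpmul2l; first by rewrite lee_fin ltW.
apply: le_measure; rewrite ?inE; [exact: ht_measurable_ball hX _ _|exact: cube_measurable DP|].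
exact: (ds_inner_ball hD DP).
Qed.

(** Descending from [Q] towards [P], the first cube that changes as a set has a sibling disjoint
    from it, hence from [P], and [cube_le_child] bounds the sibling from below. Chains of distinct
    cubes thus gain a fixed proportion of mass at each step. *)
Lemma cube_strict_growth : exists2 C : R, 0 < C & forall k l P Q,
  D k Q -> D l P -> P `<=` Q -> P <> Q ->
  fine (mu P) + fine (mu P) / C <= fine (mu Q).
Proof.
have [C C0 hC] := cube_le_child; exists C => // k l P Q DQ DP PQ neq.
have [n ln] : exists n : nat, l = k + n%:Z.
  apply: int_le_ex; rewrite leNgt; apply/negP => /ltW lk; apply: neq; apply/seteqP; split => //.
  have [x Px] := cube_nonempty DP.
  exact: (cube_sub lk DP DQ (PQ _ Px) Px).
have [x Px] := cube_nonempty DP.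
elim: n k DQ ln => [|n IH] k DQ ln.
  by case: neq; rewrite ln addr0 in DP; exact: (cube_eq DP DQ Px (PQ _ Px)).
have : Q x by exact: PQ.
rewrite {1}(ds_children_cover hD DQ) => -[P1 [DP1 P1Q] P1x].
have lk : l = k + 1 + n%:Z by rewrite ln -addrA -intS.
have PP1 : P `<=` P1.
  by apply: (cube_sub _ DP1 DP Px P1x); rewrite lk lerDl.
(* A cube with a single child equals it as a set; the descent then goes on from the same set, one
   generation later. *)
have [eP1|nP1] := pselect (P1 = Q).
  by apply: IH lk; rewrite -eP1.
have [y Qy nP1y] : exists2 y, Q y & ~ P1 y.
  apply: contra_notP nP1 => h; apply/seteqP; split=> // y Qy.
  by apply: contra_notP h => nP1y; exists y.
have := Qy; rewrite {1}(ds_children_cover hD DQ) => -[P2 [DP2 P2Q] P2y].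
have P12 : P1 `&` P2 = set0.
  rewrite -subset0 => z [P1z P2z]; apply: nP1y.
  by rewrite (cube_eq DP1 DP2 P1z P2z).
have h1 : (mu P1 + mu P2 <= mu Q)%E.
  rewrite -measureU//; [|exact: cube_measurable DP1|exact: cube_measurable DP2].
  apply: le_measure; rewrite ?inE; last by rewrite subUset.
    by apply: measurableU; [exact: cube_measurable DP1|exact: cube_measurable DP2].
  exact: cube_measurable DQ.
have h2 : (mu P <= mu P1)%E.
  by apply: le_measure; rewrite ?inE//; [exact: cube_measurable DP|exact: cube_measurable DP1].
have h3 : (mu P1 <= mu Q)%E.
  by apply: le_measure; rewrite ?inE//; [exact: cube_measurable DP1|exact: cube_measurable DQ].
have h4 := hC _ _ _ DQ (conj DP2 P2Q).
move: h1 h2 h3 h4.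
rewrite -[mu P]fineK ?(cube_fin_num DP)// -[mu P1]fineK ?(cube_fin_num DP1)//.
rewrite -[mu P2]fineK ?(cube_fin_num DP2)// -[mu Q]fineK ?(cube_fin_num DQ)//.
rewrite -EFinD -EFinM !lee_fin /= => h1 h2 h3 h4.
apply: le_trans h1; apply: lerD => //.
rewrite ler_pdivrMr// mulrC; apply: le_trans h4; exact: le_trans h3.
Qed.

(** No chain is followed: a cube above [Q] whose mass nearly attains the supremum is already
    maximal, because a strictly larger one satisfying [p] would exceed the supremum. *)
Lemma cube_maximal (p : set X -> Prop) (M : R) k Q :
  (forall l P, D l P -> p P -> fine (mu P) <= M) -> D k Q -> p Q ->
  exists l P, [/\ D l P, Q `<=` P, p P &
    forall j P', D j P' -> p P' -> P `<=` P' -> P' = P].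
Proof.
move=> hM DQ pQ; have [C C0 hC] := cube_strict_growth.
pose S := [set fine (mu q.2) | q in [set q | [/\ cubes D q, Q `<=` q.2 & p q.2]]].
have hS : has_sup S.
  split; first by exists (fine (mu Q)); exists (k, Q) => //; split.
  by exists M => _ [[l P]/= [DP _ pP] <-]; exact: hM DP pP.
(* The tolerance [mu Q / C] does not exceed the gain [mu P / C] of [cube_strict_growth], for [P]
   contains [Q]. *)
have e0 : 0 < fine (mu Q) / C by rewrite divr_gt0// (cube_fine_gt0 DQ).
have [_ [[l P]/= [DP QP pP] <-] hP] := sup_adherent e0 hS.
exists l, P; split => // j P' DP' pP' PP'; apply: contrapT => neq.
have := hC _ _ _ _ DP' DP PP' (fun e => neq (esym e)).
apply/negP; rewrite -ltNge.
have hle : fine (mu P') <= sup S.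
  apply: ub_le_sup; first exact: hS.2.
  by exists (j, P') => //=; split => //; exact: subset_trans PP'.
apply: le_lt_trans hle _.
have QPm : fine (mu Q) <= fine (mu P).
  apply: fine_le; [exact: cube_fin_num DQ|exact: cube_fin_num DP|].
  by apply: le_measure; rewrite ?inE//; [exact: cube_measurable DQ|exact: cube_measurable DP].
rewrite -ltrBlDr; apply: le_lt_trans hP; rewrite lerD2l lerN2.
by rewrite ler_pM2r// invr_gt0.
Qed.

End DyadicCubes.

(** * A covering argument for families of dyadic cubes *)

Lemma finite_sublevel_inj (T : Type) (A : set T) (f : T -> nat) n :
  {in A &, injective f} -> finite_set (A `&` [set x | (f x <= n)%N]).
Proof.
move=> fI; have : finite_set (f @` (A `&` [set x | (f x <= n)%N])).
  by apply: (@sub_finite_set _ _ `I_n.+1) => // _ [x [_ /= xn] <-].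
rewrite (eq_finite_set (inj_card_eq _))// => x y.
by rewrite !inE => -[Ax _] [Ay _]; apply: fI; rewrite inE.
Qed.

Lemma seq_argmin (T : eqType) d' (O : orderType d') (f : T -> O) (s : seq T) :
  s != [::] -> exists2 x, x \in s & forall y, y \in s -> (f x <= f y)%O.
Proof.
elim: s => // a s IH _; have [->|/IH[x xs hx]] := eqVneq s [::].
  by exists a; rewrite ?mem_head// => y; rewrite inE => /eqP ->.
have [ax|xa] := leP (f a) (f x).
  exists a; first exact: mem_head.
  by move=> y; rewrite inE => /predU1P[->//|/hx]; exact: le_trans.
exists x; first by rewrite inE xs orbT.
by move=> y; rewrite inE => /predU1P[->|/hx//]; exact: ltW.
Qed.

Section Covering.
Context {R : realType} {d : measure_display} {X : measurableType d}.
Variables (rho : X -> X -> R) (mu : {measure set X -> \bar R}).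
Hypothesis hX : homogeneous_type rho mu.
Variables (delta c1 C1 : R) (D : int -> set (set X)) (ctr : int -> set X -> X).
Hypothesis hD : dyadic_system rho delta c1 C1 D ctr.
Variables (H : int -> set X -> set X) (C : R).
Hypothesis C0 : 0 < C.
Hypothesis Hm : forall k Q, D k Q -> measurable (H k Q).
Hypothesis Hmono : forall k l P Q, k <= l -> D k Q -> D l P -> P `<=` Q ->
  H l P `<=` H k Q.
Hypothesis HC : forall k Q, D k Q -> (mu (H k Q) <= C%:E * mu Q)%E.

(** Greedy selection of a coarsest cube [q0]. A cube meeting [q0] lies in it and, by [Hmono], has
    its hull inside that of [q0]; the others are disjoint from [q0], so the shares of [E] add up.
    The hull of a selected cube costs at most [C] times its mass, hence [C / c] times its share of
    [E]. *)
Lemma covering_seq (E : set X) (c : R) (s : seq (int * set X)) :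
  measurable E -> 0 < c ->
  (forall q, q \in s -> D q.1 q.2 /\ (c%:E * mu q.2 <= mu (E `&` q.2))%E) ->
  (mu (\bigcup_(q in [set` s]) H q.1 q.2)
    <= (C / c)%:E * mu (E `&` \bigcup_(q in [set` s]) q.2))%E.
Proof.
move=> mE c0; have [n] := ubnP (size s); elim: n s => // n IH s sn hs.
have [->|s0] := eqVneq s [::].
  by rewrite set_nil !bigcup_set0 setI0 !measure0 mule0.
have [q0 q0s hq0] := @seq_argmin _ _ _ (fun q : int * set X => q.1) s s0.
have [Dq0 Eq0] := hs _ q0s.
pose s' := [seq q <- s | q.2 `&` q0.2 == set0].
have s's q : q \in s' -> q \in s by rewrite mem_filter => /andP[].
have s'n : (size s' < n)%N.
  rewrite -ltnS; apply: leq_trans sn; rewrite ltnS size_filter -(count_predC (fun q => q.2 `&` q0.2 == set0) s).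
  rewrite -addn1 leq_add2l -has_count; apply/hasP; exists q0 => //=.
  rewrite setIid; apply/eqP => q00.
  by have [x] := cube_nonempty hD Dq0; rewrite q00.
have {}IH := IH s' s'n (fun q qs => hs q (s's q qs)).

have Dm q : q \in s -> measurable q.2 by move=> /hs[/(cube_measurable hD)].
have mH (t : seq (int * set X)) : {subset t <= s} -> measurable (\bigcup_(q in [set` t]) H q.1 q.2).
  move=> ts; apply: fin_bigcup_measurable; first exact: finite_seq.
  by move=> q /= /ts /hs[/Hm].
have mQ (t : seq (int * set X)) : {subset t <= s} -> measurable (\bigcup_(q in [set` t]) q.2).
  move=> ts; apply: fin_bigcup_measurable; first exact: finite_seq.
  by move=> q /= /ts /Dm.
have cov : \bigcup_(q in [set` s]) H q.1 q.2 `<=`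
    H q0.1 q0.2 `|` \bigcup_(q in [set` s']) H q.1 q.2.
  move=> x [q /= qs Hqx]; have [qq0|qq0] := eqVneq (q.2 `&` q0.2) set0.
    by right; exists q => //=; rewrite mem_filter qq0 eqxx.
  left; apply: Hmono Hqx => //; [exact: hq0|by have [] := hs _ qs|].
  have /set0P[y [qy q0y]] := qq0.
  by apply: (cube_sub hD (hq0 _ qs) Dq0 _ qy q0y); have [] := hs _ qs.
apply: (@le_trans _ _ (mu (H q0.1 q0.2) + mu (\bigcup_(q in [set` s']) H q.1 q.2))%E).
  apply: le_trans (measureU2 _ _ _); last 2 first.
  - exact: Hm.
  - exact: mH.
  apply: le_measure; rewrite ?inE//; first exact: mH.
  by apply: measurableU; [exact: Hm|exact: mH].
apply: (@le_trans _ _ ((C / c)%:E * (mu (E `&` q0.2) + mu (E `&` \bigcup_(q in [set` s']) q.2)))%E).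
  rewrite ge0_muleDr//; apply: leeD => //.
  apply: le_trans (HC Dq0) _.
  rewrite EFinM -muleA; apply: lee_wpmul2l; first by rewrite lee_fin ltW.
  rewrite muleC lee_pdivlMr// muleC; exact: Eq0.
apply: lee_wpmul2l; first by rewrite lee_fin divr_ge0// ltW.
rewrite -measureU//.
- apply: le_measure; rewrite ?inE//.
  + by apply: measurableU; apply: measurableI => //; [exact: Dm|exact: mQ].
  + by apply: measurableI => //; exact: mQ.
  rewrite -setIUr; apply: setIS; rewrite subUset; split.
    by move=> x q0x; exists q0.
  by apply: bigcup_sub => q /= /s's qs x qx; exists q.
- by apply: measurableI => //; exact: Dm.
- by apply: measurableI => //; exact: mQ.
- rewrite -subset0 => x [[_ q0x] [_ [q /= qs' qx]]].
  move: qs'; rewrite mem_filter => /andP[/eqP + _]; rewrite -subset0 => h.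
  by apply: (h x); split.
Qed.

(** The bound of [covering_seq] does not depend on the number of cubes, so it passes to a countable
    family by continuity from below. *)
Lemma covering (F : set (int * set X)) (E : set X) (c : R) :
  measurable E -> 0 < c ->
  (forall q, F q -> D q.1 q.2 /\ (c%:E * mu q.2 <= mu (E `&` q.2))%E) ->
  (mu (\bigcup_(q in F) H q.1 q.2) <= (C / c)%:E * mu E)%E.
Proof.
move=> mE c0 hF.
have cF : countable F by apply: sub_countable (cubes_countable hD); apply: subset_card_le => q /hF[].
have [f fI] := elimT (countable_injP _) cF.
pose Fn n := F `&` [set x | (f x <= n)%N].
have -> : \bigcup_(q in F) H q.1 q.2 = \bigcup_n \bigcup_(q in Fn n) H q.1 q.2.
  apply/seteqP; split=> [x [q Fq Hqx]|x [n _ [q [Fq _] Hqx]]].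
    by exists (f q) => //; exists q => //; split => /=.
  by exists q.
have mn n : measurable (\bigcup_(q in Fn n) H q.1 q.2).
  apply: fin_bigcup_measurable; first exact: finite_sublevel_inj.
  by move=> q [/hF[/Hm]].
have nd : nondecreasing_seq (fun n => \bigcup_(q in Fn n) H q.1 q.2).
  move=> m n mn'; apply/subsetPset; apply: bigcup_subset => q [Fq fq]; split => //.
  exact: leq_trans mn'.
have mU : measurable (\bigcup_n \bigcup_(q in Fn n) H q.1 q.2) by exact: bigcup_measurable.
have cv := @nondecreasing_cvg_mu _ _ _ mu _ mn mU nd.
rewrite -(cvg_lim _ cv)//; apply: lime_le; first by apply/cvg_ex; eexists; exact: cv.
apply: nearW => n /=.
have [s sF] := (finite_seqP _).1 (finite_sublevel_inj n fI).
rewrite /Fn sF; apply: le_trans (covering_seq mE c0 _) _.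
  by move=> q qs; apply: hF; have : [set` s] q by []; rewrite -sF => -[].
apply: lee_wpmul2l; first by rewrite lee_fin divr_ge0// ltW.
apply: le_measure; rewrite ?inE//; apply: measurableI => //.
apply: fin_bigcup_measurable; first exact: finite_seq.
move=> q qs; have : Fn n q by rewrite /Fn sF.
by move=> [/hF[/(cube_measurable hD)]].
Qed.

End Covering.

Lemma integrable_indic_fin {R : realType} {d} {T : measurableType d}
    (mu : {measure set T -> \bar R}) (A : set T) :
  measurable A -> (mu A < +oo)%E -> mu.-integrable setT (fun x => (\1_A x : R)%:E).
Proof.
move=> mA fA; apply/integrableP; split; first exact/measurable_EFinP/measurable_indic.
by under eq_integral do rewrite gee0_abs ?lee_fin//; rewrite integral_indic// setIT.
Qed.

(** * Haar functions of one variable *)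

Section HaarFunctions.
Context {R : realType} {d : measure_display} {X : measurableType d}.
Variables (rho : X -> X -> R) (mu : {measure set X -> \bar R}).
Hypothesis hX : homogeneous_type rho mu.
Variables (delta c1 C1 : R) (D : int -> set (set X)) (ctr : int -> set X -> X).
Hypothesis hD : dyadic_system rho delta c1 C1 D ctr.
Variable ord : int -> set X -> seq (set X).
Hypothesis hord : haar_order mu D ord.
Implicit Types (k l : int) (P Q : set X) (v : nat).

Lemma haar_order_child k Q v : D k Q -> (v < size (ord k Q))%N ->
  children D k Q (nth set0 (ord k Q) v).
Proof.
move=> DQ vn; have [_ <- _] := hord DQ; exact: mem_nth.
Qed.

Lemma tail_union0 k Q : D k Q -> tail_union (ord k Q) 0 = Q.
Proof.
move=> DQ; have [_ sQ _] := hord DQ.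
by rewrite /tail_union drop0 sQ -(ds_children_cover hD DQ).
Qed.

Lemma tail_unionS (s : seq (set X)) v : (v < size s)%N ->
  tail_union s v = nth set0 s v `|` tail_union s v.+1.
Proof.
move=> vn; rewrite /tail_union (drop_nth set0 vn); apply/seteqP; split=> x.
  by move=> [P /=]; rewrite inE => /predU1P[->|Ps] Px; [left|right; exists P].
by move=> [Px|[P /= Ps Px]]; [exists (nth set0 s v)|exists P] => //=; rewrite inE ?eqxx ?Ps ?orbT.
Qed.

Lemma tail_union_size (s : seq (set X)) : tail_union s (size s) = set0.
Proof. by rewrite /tail_union drop_size set_nil bigcup_set0. Qed.

Lemma tail_union_sub (s : seq (set X)) u v : (u <= v)%N ->
  tail_union s v `<=` tail_union s u.
Proof.
move=> uv x [P /= Ps Px]; exists P => //=.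
by move: Ps; rewrite -{1}(subnK uv) -drop_drop => /mem_drop.
Qed.

Lemma tail_union_mem k Q v P : D k Q -> [set` drop v (ord k Q)] P -> children D k Q P.
Proof. by move=> DQ /= /mem_drop; have [_ <- _] := hord DQ. Qed.

Lemma tail_union_disjoint k Q v : D k Q -> (v < size (ord k Q))%N ->
  nth set0 (ord k Q) v `&` tail_union (ord k Q) v.+1 = set0.
Proof.
move=> DQ vn; rewrite -subset0 => x [Px [P' Ps P'x]].
have [uQ _ _] := hord DQ.
have [DP _] := haar_order_child DQ vn; have [DP' _] := tail_union_mem DQ Ps.
have PP' := cube_eq hD DP' DP P'x Px.
move: (drop_uniq v uQ); rewrite (drop_nth set0 vn) /= -PP'.
by move: Ps => /= ->.
Qed.

Lemma tail_union_measurable k Q v : D k Q -> measurable (tail_union (ord k Q) v).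
Proof.
move=> DQ; apply: fin_bigcup_measurable; first exact: finite_seq.
by move=> P /(tail_union_mem DQ)[/(cube_measurable hD)].
Qed.

Lemma tail_union_subQ k Q v : D k Q -> tail_union (ord k Q) v `<=` Q.
Proof. by move=> DQ x [P /(tail_union_mem DQ)[_ PQ] Px]; exact: PQ. Qed.

Lemma tail_union_cst k l Q P v x y : k < l -> D k Q -> D l P -> P x -> P y ->
  tail_union (ord k Q) v x -> tail_union (ord k Q) v y.
Proof.
move=> kl DQ DP Px Py [P' Ps P'x]; exists P' => //.
have [DP' _] := tail_union_mem DQ Ps.
have kl1 : k + 1 <= l by rewrite lezD1.
exact: (cube_sub hD kl1 DP' DP Px P'x).
Qed.

Lemma child_cst k l Q P v x y : k < l -> D k Q -> D l P -> P x -> P y ->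
  (v < size (ord k Q))%N ->
  nth set0 (ord k Q) v x -> nth set0 (ord k Q) v y.
Proof.
move=> kl DQ DP Px Py vn Qx.
have [DP' _] := haar_order_child DQ vn.
have kl1 : k + 1 <= l by rewrite lezD1.
exact: (cube_sub hD kl1 DP' DP Px Qx).
Qed.

Let m (A : set X) : R := fine (mu A).

Lemma tail_fin_num k Q v : D k Q -> mu (tail_union (ord k Q) v) \is a fin_num.
Proof.
move=> DQ; rewrite ge0_fin_numE//; apply: le_lt_trans (cube_lty hX hD DQ).
apply: le_measure; rewrite ?inE; [exact: tail_union_measurable|exact: (cube_measurable hD DQ)|].
exact: tail_union_subQ.
Qed.

Lemma tail_massS k Q v : D k Q -> (v < size (ord k Q))%N ->
  m (tail_union (ord k Q) v) = m (nth set0 (ord k Q) v) + m (tail_union (ord k Q) v.+1).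
Proof.
move=> DQ vn; have [DP _] := haar_order_child DQ vn.
rewrite {1}/m tail_unionS// measureU//.
- by rewrite fineD ?(cube_fin_num hX hD DP)// tail_fin_num.
- exact: (cube_measurable hD DP).
- exact: tail_union_measurable.
- exact: tail_union_disjoint.
Qed.

Lemma tail_mass_gt0 k Q v : D k Q -> (v < size (ord k Q))%N ->
  0 < m (tail_union (ord k Q) v).
Proof.
move=> DQ vn; rewrite tail_massS//; apply: ltr_pwDl; last exact: fine_ge0.
by have [DP _] := haar_order_child DQ vn; exact: (cube_fine_gt0 hX hD DP).
Qed.

Lemma child_mass_gt0 k Q v : D k Q -> (v < size (ord k Q))%N ->
  0 < m (nth set0 (ord k Q) v).
Proof.
by move=> DQ vn; have [DP _] := haar_order_child DQ vn; exact: (cube_fine_gt0 hX hD DP).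
Qed.

Lemma haar_size k Q v : (v < (size (ord k Q)).-1)%N ->
  (v < size (ord k Q))%N /\ (v.+1 < size (ord k Q))%N.
Proof. by case: (size (ord k Q)) => //= n vn; split => //; exact: ltnW. Qed.

Lemma haar_measurable k Q v : D k Q -> (v < (size (ord k Q)).-1)%N ->
  measurable_fun setT (haar mu (ord k Q) v).
Proof.
move=> DQ /haar_size[vn _]; have [DP _] := haar_order_child DQ vn.
rewrite /haar; apply: measurable_funB; apply: measurable_funM => //.
  by apply: measurable_indic; exact: (cube_measurable hD DP).
by apply: measurable_indic; exact: tail_union_measurable.
Qed.

Lemma haar_out k Q v x : D k Q -> (v < (size (ord k Q)).-1)%N -> ~ Q x ->
  haar mu (ord k Q) v x = 0.
Proof.
move=> DQ /haar_size[vn _] nQx; have [_ PQ] := haar_order_child DQ vn.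
rewrite /haar !indicE !memNset ?mulr0 ?subr0//.
  by move=> /(tail_union_subQ DQ).
by move=> Px; apply: nQx; exact: PQ.
Qed.

Lemma haar_tail_out k Q v x : D k Q -> (v < (size (ord k Q)).-1)%N ->
  ~ tail_union (ord k Q) v x -> haar mu (ord k Q) v x = 0.
Proof.
move=> DQ /haar_size[vn _]; rewrite tail_unionS// => /not_orP[nx ny].
by rewrite /haar !indicE !memNset ?mulr0 ?subr0.
Qed.

Lemma haar_tail_cst k Q v x : D k Q -> (v < (size (ord k Q)).-1)%N ->
  tail_union (ord k Q) v.+1 x -> haar mu (ord k Q) v x =
  - (sqrt_meas mu (nth set0 (ord k Q) v) /
    (sqrt_meas mu (tail_union (ord k Q) v) * sqrt_meas mu (tail_union (ord k Q) v.+1))).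
Proof.
move=> DQ /haar_size[vn _] tx.
have nx : ~ nth set0 (ord k Q) v x.
  by move=> Px; have := tail_union_disjoint DQ vn; rewrite -subset0 => /(_ x); apply.
by rewrite /haar !indicE (memNset nx) (mem_set tx) mulr0 mulr1 sub0r.
Qed.

Lemma haar_bounded k Q v : exists M : R, forall x, `|haar mu (ord k Q) v x| <= M.
Proof.
rewrite /haar; set a := _ / _; set b := _ / _.
exists (`|a| + `|b|) => x; apply: le_trans (ler_normB _ _) _.
by apply: lerD; rewrite normrM ler_piMr// indicE; case: (_ \in _) => /=; rewrite ?normr1 ?normr0.
Qed.

(** The Haar function is constant on each child, a cube of generation [k + 1], and zero off [Q]; a
    cube of generation beyond [k] lies in one child or misses all of them. *)
Lemma haar_cst k l Q P v x y : k < l -> D k Q -> D l P -> (v < (size (ord k Q)).-1)%N ->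
  P x -> P y -> haar mu (ord k Q) v x = haar mu (ord k Q) v y.
Proof.
move=> kl DQ DP vn Px Py; rewrite /haar !indicE.
have -> : (x \in nth set0 (ord k Q) v) = (y \in nth set0 (ord k Q) v).
  have [vn' _] := haar_size vn.
  by apply/idP/idP; rewrite !inE; exact: (child_cst kl DQ DP).
suff -> : (x \in tail_union (ord k Q) v.+1) = (y \in tail_union (ord k Q) v.+1) by [].
by apply/idP/idP; rewrite !inE; exact: (tail_union_cst kl DQ DP).
Qed.

(** A cube [P] that does not contain [Q] is either of a later generation, and then the Haar function
    is constant on it, or disjoint from [Q]. Paired with a function whose integral over [P]
    vanishes, this gives zero, as used in [rect_atom_coef]. *)
Lemma haar_cst_or k l Q P v : D k Q -> D l P -> (v < (size (ord k Q)).-1)%N ->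
  ~ Q `<=` P -> exists c : R, forall x, P x -> haar mu (ord k Q) v x = c.
Proof.
move=> DQ DP vn nQP; have [kl|lk] := ltP k l.
  have [z Pz] := cube_nonempty hD DP.
  by exists (haar mu (ord k Q) v z) => x Px; exact: (haar_cst kl DQ DP vn Px Pz).
exists 0 => x Px; apply: (haar_out DQ vn) => Qx; apply: nQP.
exact: (cube_sub hD lk DP DQ Qx Px).
Qed.

Lemma integral_indic2 (A B : set X) (a b : R) : measurable A -> measurable B ->
  mu A \is a fin_num -> mu B \is a fin_num ->
  (\int[mu]_x (a * \1_A x + b * \1_B x)%:E = (a * m A + b * m B)%:E)%E.
Proof.
move=> mA mB fA fB.
have iA : mu.-integrable setT (fun x => (\1_A x : R)%:E).
  by apply: integrable_indic_fin => //; rewrite -ge0_fin_numE.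
have iB : mu.-integrable setT (fun x => (\1_B x : R)%:E).
  by apply: integrable_indic_fin => //; rewrite -ge0_fin_numE.
under eq_integral do rewrite EFinD !EFinM.
rewrite integralD//; [|exact: integrableZl..].
rewrite !integralZl// !integral_indic// !setIT.
by rewrite EFinD !EFinM /m !fineK.
Qed.

Lemma sqrt_meas_tail_gt0 k Q v : D k Q -> (v < size (ord k Q))%N ->
  0 < sqrt_meas mu (tail_union (ord k Q) v).
Proof. by move=> DQ vn; rewrite sqrtr_gt0 tail_mass_gt0. Qed.

Lemma sqrt_meas_child_gt0 k Q v : D k Q -> (v < size (ord k Q))%N ->
  0 < sqrt_meas mu (nth set0 (ord k Q) v).
Proof. by move=> DQ vn; rewrite sqrtr_gt0 child_mass_gt0. Qed.

Lemma sqrt_meas_sqr (A : set X) : sqrt_meas mu A ^+ 2 = m A.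
Proof. by rewrite sqr_sqrtr// fine_ge0. Qed.

Lemma haar_integral k Q v : D k Q -> (v < (size (ord k Q)).-1)%N ->
  (\int[mu]_x (haar mu (ord k Q) v x)%:E = 0)%E.
Proof.
move=> DQ vn; have [vn0 vn1] := haar_size vn.
have [DP _] := haar_order_child DQ vn0.
rewrite /haar; under eq_integral do rewrite -mulNr.
rewrite integral_indic2//.
- have p0 := sqrt_meas_child_gt0 DQ vn0.
  have e0 := sqrt_meas_tail_gt0 DQ vn0.
  have e1 := sqrt_meas_tail_gt0 DQ vn1.
  congr EFin; rewrite -!sqrt_meas_sqr; field.
  by rewrite !gt_eqF.
- exact: (cube_measurable hD DP).
- exact: tail_union_measurable.
- exact: (cube_fin_num hX hD DP).
- exact: tail_fin_num.
Qed.

Lemma haar_sqr_integral k Q v : D k Q -> (v < (size (ord k Q)).-1)%N ->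
  (\int[mu]_x (haar mu (ord k Q) v x * haar mu (ord k Q) v x)%:E = 1)%E.
Proof.
move=> DQ vn; have [vn0 vn1] := haar_size vn.
have [DP _] := haar_order_child DQ vn0.
pose p := sqrt_meas mu (nth set0 (ord k Q) v).
pose e := sqrt_meas mu (tail_union (ord k Q) v).
pose e' := sqrt_meas mu (tail_union (ord k Q) v.+1).
rewrite (eq_integral (fun x => ((e' / (p * e)) ^+ 2 * \1_(nth set0 (ord k Q) v) x +
  (p / (e * e')) ^+ 2 * \1_(tail_union (ord k Q) v.+1) x)%:E)); last first.
  move=> x _; congr EFin; rewrite /haar -/p -/e -/e' !indicE.
  have [Px|nPx] := pselect (nth set0 (ord k Q) v x).
    have nt : ~ tail_union (ord k Q) v.+1 x.
      by move=> tx; have := tail_union_disjoint DQ vn0; rewrite -subset0 => /(_ x); apply.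
    by rewrite (mem_set Px) (memNset nt) /= !mulr0 !mulr1 subr0 addr0 expr2.
  rewrite (memNset nPx) /=.
  by case: (_ \in _) => /=; rewrite !mulr0 ?mulr1 ?add0r ?sub0r ?mulrNN ?expr2// mul0r.
rewrite integral_indic2//.
- have p0 : 0 < p := sqrt_meas_child_gt0 DQ vn0.
  have e0 : 0 < e := sqrt_meas_tail_gt0 DQ vn0.
  have e1 : 0 < e' := sqrt_meas_tail_gt0 DQ vn1.
  have ee : e ^+ 2 = p ^+ 2 + e' ^+ 2.
    by rewrite /e /p /e' !sqrt_meas_sqr tail_massS.
  congr EFin; rewrite -!sqrt_meas_sqr -/p -/e'.
  transitivity ((p ^+ 2 + e' ^+ 2) / e ^+ 2); first by field; rewrite !gt_eqF.
  by rewrite -ee divff// gt_eqF// exprn_gt0.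
- exact: (cube_measurable hD DP).
- exact: tail_union_measurable.
- exact: (cube_fin_num hX hD DP).
- exact: tail_fin_num.
Qed.

(** The hypothesis orders the pair so that the first function is constant where the second lives: a
    later generation, a different cube of the same generation (product zero), or a later index on
    the same cube, supported in a tail inside [tail_union (ord k Q) v.+1]. *)
Lemma haar_mul k l P Q u v : D k Q -> D l P ->
  (v < (size (ord k Q)).-1)%N -> (u < (size (ord l P)).-1)%N ->
  k < l \/ k = l /\ (Q <> P \/ (Q = P /\ (v < u)%N)) ->
  exists c : R, forall x, haar mu (ord k Q) v x * haar mu (ord l P) u x =
    c * haar mu (ord l P) u x.
Proof.
move=> DQ DP vn un [kl|[kl]].
  have [z Pz] := cube_nonempty hD DP.
  exists (haar mu (ord k Q) v z) => x; have [Px|nPx] := pselect (P x).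
    by rewrite (haar_cst kl DQ DP vn Px Pz).
  by rewrite (haar_out DP un nPx) !mulr0.
case: l / kl DP un => DP un [neq|[QP]].
  exists 0 => x; rewrite mul0r; have [Px|nPx] := pselect (P x); last first.
    by rewrite (haar_out DP un nPx) mulr0.
  rewrite (haar_out DQ vn) ?mul0r// => Qx; apply: neq.
  exact: (cube_eq hD DQ DP Qx Px).
case: P / QP DP un => DP un vu; eexists => x.
have [Px|nPx] := pselect (tail_union (ord k Q) u x); last first.
  by rewrite (haar_tail_out DP un nPx) !mulr0.
congr (_ * _); apply: (haar_tail_cst DQ vn).
exact: (tail_union_sub vu Px).
Qed.

Lemma haar_integrable k Q v : D k Q -> (v < (size (ord k Q)).-1)%N ->
  mu.-integrable setT (EFin \o haar mu (ord k Q) v).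
Proof.
move=> DQ /haar_size[vn _]; have [DP _] := haar_order_child DQ vn.
rewrite (_ : EFin \o _ = (fun x => (haar mu (ord k Q) v x)%:E))//.
rewrite /haar; set a := _ / _; set b := _ / _.
under eq_fun do rewrite EFinB !EFinM.
apply: integrableB => //; apply: integrableZl => //; apply: integrable_indic_fin => //.
- exact: (cube_measurable hD DP).
- exact: (cube_lty hX hD DP).
- exact: tail_union_measurable.
- by rewrite -ge0_fin_numE// tail_fin_num.
Qed.

(** By symmetry the pair can be put in the order of [haar_mul]; the product is then a multiple of
    the finer function, which has integral zero. *)
Lemma haar_ortho k l P Q u v : D k Q -> D l P ->
  (v < (size (ord k Q)).-1)%N -> (u < (size (ord l P)).-1)%N ->
  (k, Q, v) <> (l, P, u) ->
  (\int[mu]_x (haar mu (ord k Q) v x * haar mu (ord l P) u x)%:E = 0)%E.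
Proof.
wlog H : k l P Q u v / k < l \/ k = l /\ (Q <> P \/ (Q = P /\ (v < u)%N)).
  move=> W DQ DP vn un neq.
  have [kl|lk|kl] := ltgtP k l; first by apply: W => //; left.
    under eq_integral do rewrite mulrC.
    by apply: W => //; [left|move=> e; apply: neq; rewrite e].
  have [QP|QP] := pselect (Q = P); last by apply: W => //; right; split => //; left.
  have [vu|uv|vu] := ltngtP v u.
  - by apply: W => //; right; split => //; right.
  - under eq_integral do rewrite mulrC.
    apply: W => //; last by move=> e; apply: neq; rewrite e.
    by right; split => //; right.
  - by case: neq; rewrite kl QP vu.
move=> DQ DP vn un _; have [c hc] := haar_mul DQ DP vn un H.
under eq_integral do rewrite hc EFinM.
by rewrite integralZl ?haar_integral ?mule0//; exact: haar_integrable.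
Qed.

(* Applied to [L A] = \int phi 1_A with phi orthogonal to the Haar functions of
   [Q]: the averages of phi over [Q] and over its children agree. *)
Lemma haar_annihilator k Q (L : set X -> R) : D k Q ->
  (forall A B, measurable A -> measurable B -> A `&` B = set0 ->
    A `|` B `<=` Q -> L (A `|` B) = L A + L B) ->
  (forall v, (v < (size (ord k Q)).-1)%N ->
     let s := ord k Q in
     sqrt_meas mu (tail_union s v.+1) / (sqrt_meas mu (nth set0 s v) * sqrt_meas mu (tail_union s v))
       * L (nth set0 s v) =
     sqrt_meas mu (nth set0 s v) / (sqrt_meas mu (tail_union s v) * sqrt_meas mu (tail_union s v.+1))
       * L (tail_union s v.+1)) ->
  forall P, children D k Q P -> L P * fine (mu Q) = L Q * fine (mu P).
Proof.
move=> DQ LD Lh.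
set s := ord k Q in Lh *.
have LS v : (v < size s)%N -> L (tail_union s v) = L (nth set0 s v) + L (tail_union s v.+1).
  move=> vn; have [DP _] := haar_order_child DQ vn.
  rewrite tail_unionS// LD//; [exact: (cube_measurable hD DP)|exact: tail_union_measurable|exact: tail_union_disjoint|].
  by rewrite -tail_unionS//; exact: tail_union_subQ.
(* Freed of square roots, orthogonality says that the mean of [L] over the child [v] equals its mean
   over the tail after it. *)
have key v : (v.+1 < size s)%N ->
    m (tail_union s v.+1) * L (nth set0 s v) = m (nth set0 s v) * L (tail_union s v.+1).
  move=> vn1; have vn0 : (v < size s)%N by exact: ltnW.
  have vn : (v < (size s).-1)%N by rewrite -ltnS prednK// (leq_trans _ vn1).
  have /= := Lh v vn.
  have p0 := sqrt_meas_child_gt0 DQ vn0.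
  have e0 := sqrt_meas_tail_gt0 DQ vn0.
  have e1 := sqrt_meas_tail_gt0 DQ vn1.
  rewrite -/s in p0 e0 e1 *; rewrite -!sqrt_meas_sqr.
  move: p0 e0 e1; set p := sqrt_meas _ _; set e := sqrt_meas _ _; set e' := sqrt_meas _ _.
  move=> p0 e0 e1 h; set a := L _ in h *; set b := L _ in h *.
  have := congr1 (fun z => z * (p * e * e')) h.
  rewrite [LHS](_ : _ = e' ^+ 2 * a); last by field; rewrite !gt_eqF.
  rewrite [RHS](_ : _ = p ^+ 2 * b)//; by field; rewrite !gt_eqF.
(* Hence all tails have the mean of the first one, which is [Q]. *)
have tl v : (v < size s)%N -> L (tail_union s v) * m Q = L Q * m (tail_union s v).
  elim: v => [|v IH] vn; first by rewrite tail_union0.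
  have vn0 : (v < size s)%N by exact: ltnW.
  have h := IH vn0; rewrite LS// tail_massS// -/s in h.
  have k1 := key _ vn.
  have p0 : 0 < m (nth set0 s v) := child_mass_gt0 DQ vn0.
  have e0 : 0 < m (tail_union s v) := tail_mass_gt0 DQ vn0.
  have e1 := tail_massS DQ vn0.
  apply: (mulfI (lt0r_neq0 e0)).
  rewrite -/s in e1; rewrite e1.
  move: k1 h; move: (m (nth _ _ _)) (m (tail_union s v.+1)) (L (nth _ _ _)) (L (tail_union s v.+1)) => a b c e k1 h.
  transitivity ((a * e + b * e) * m Q); first by ring.
  rewrite -k1; transitivity (b * ((c + e) * m Q)); first by ring.
  by rewrite h; ring.
move=> P; have [_ <- _] := hord DQ => /= /(nthP set0)[v vn <-].
rewrite -/s in vn *; have [vn1|vn1] := ltnP v.+1 (size s).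
  have k1 := key _ vn1; have t1 := tl _ vn1.
  have e1 : 0 < m (tail_union s v.+1) := tail_mass_gt0 DQ vn1.
  apply: (mulfI (lt0r_neq0 e1)); rewrite mulrA k1 -mulrA -/(m Q) t1 /m; ring.
(* The last child has no Haar function of its own: it is the last tail. *)
have : v.+1 = size s by apply/eqP; rewrite eqn_leq vn.
move=> vs; have := tl _ vn; rewrite tail_unionS// vs tail_union_size setU0.
by [].
Qed.

End HaarFunctions.

(** Stated for an arbitrary family [M] so as to serve both measurable sets and a generated
    sigma-algebra. *)
Lemma countable_bigcup_closed (T I : Type) (M : set (set T)) (A : set I) (F : I -> set T) :
  M set0 -> (forall E : nat -> set T, (forall n, M (E n)) -> M (\bigcup_n E n)) ->
  countable A -> (forall i, A i -> M (F i)) -> M (\bigcup_(i in A) F i).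
Proof.
move=> M0 MU /countable_injP[f fI] MF.
have -> : \bigcup_(i in A) F i = \bigcup_n \bigcup_(i in A `&` f @^-1` [set n]) F i.
  apply/seteqP; split=> [x [i Ai Fx]|x [n _ [i [Ai _] Fx]]]; last by exists i.
  by exists (f i) => //; exists i.
apply: MU => n; have [->|/set0P[i [Ai /= fi]]] := eqVneq (A `&` f @^-1` [set n]) set0.
  by rewrite bigcup_set0.
suff -> : A `&` f @^-1` [set n] = [set i] by rewrite bigcup_set1; exact: MF.
apply/seteqP; split=> [j [Aj /= fj]|_ ->//]; apply: fI; rewrite ?inE//.
by rewrite fi fj.
Qed.

Lemma countable_bigcup_measurable d (T : measurableType d) (I : Type) (A : set I)
  (F : I -> set T) : countable A -> (forall i, A i -> measurable (F i)) ->
  measurable (\bigcup_(i in A) F i).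
Proof.
apply: countable_bigcup_closed => // E; exact: bigcupT_measurable.
Qed.

(** * Cubes and rectangles as generators of the measurable sets *)

Section GeneratedByCubes.
Context {R : realType} {d : measure_display} {X : measurableType d}.
Variables (rho : X -> X -> R) (mu : {measure set X -> \bar R}).
Hypothesis hX : homogeneous_type rho mu.
Variables (delta c1 C1 : R) (D : int -> set (set X)) (ctr : int -> set X -> X).
Hypothesis hD : dyadic_system rho delta c1 C1 D ctr.
Implicit Types (k l : int) (P Q : set X).

(** The empty set makes the family stable under intersection, as the pi-system argument requires. *)
Definition cube_sets : set (set X) := [set Q | Q = set0 \/ exists k, D k Q].

Lemma cube_sets_setI : setI_closed cube_sets.
Proof.
move=> P Q [->|[k DP]] [->|[l DQ]]; rewrite ?setI0 ?set0I; [by left..|].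
have [->|/set0P[x [Px Qx]]] := eqVneq (P `&` Q) set0; first by left.
right; have [kl|/ltW lk] := leP k l.
  by exists l; rewrite setIidr//; exact: (cube_sub hD kl DP DQ Qx Px).
by exists k; rewrite setIidl//; exact: (cube_sub hD lk DQ DP Px Qx).
Qed.

Lemma delta_small (e : R) : 0 < e -> exists n : nat, delta ^+ n < e.
Proof.
move=> e0; have /andP[d0 d1] := ds_delta hD.
have : `|delta| < 1 by rewrite gtr0_norm.
move=> /cvg_expr /cvgrPdist_lt /(_ _ e0) [N _ /(_ N (leqnn N))] /=.
by rewrite sub0r normrN gtr0_norm ?exprn_gt0//; exists N.
Qed.

(** Cubes of generation [n] have diameter at most [2 * A0 * C1 * delta ^+ n], so a fine enough cube
    around a point of [U] stays in [U]. As there are countably many cubes, open sets lie in the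
    sigma-algebra they generate. *)
Lemma qopen_bigcup_cubes U : qopen rho U ->
  U = \bigcup_(q in cubes D `&` [set q | q.2 `<=` U]) q.2.
Proof.
have [A0 A01 tri] := qm_triangle (ht_quasi_metric hX).
have A0p : 0 < A0 by rewrite (lt_le_trans ltr01).
have /andP[c10 cC1] := ds_radii hD; have C10 := lt_le_trans c10 cC1.
move=> oU; apply/seteqP; split=> [x Ux|x [q [_ /= qU]]]; last exact: qU.
have [r r0 xrU] := oU x Ux.
have [n nr] := delta_small (divr_gt0 r0 (mulr_gt0 (mulr_gt0 (ltr0n R 2) A0p) C10)).
have [Q DQ Qx] := cube_ex hD n%:Z x.
exists (n%:Z, Q) => //; split => //= y Qy; apply: xrU; rewrite /qball/=.
apply: (le_lt_trans (tri _ _ (ctr n Q))).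
have := ds_outer_ball hD DQ Qy; have := ds_outer_ball hD DQ Qx.
rewrite /cube_ball/qball/= (qm_sym (ht_quasi_metric hX)) => h1 h2.
move: nr; rewrite ltr_pdivlMr ?mulr_gt0// => nr.
apply: le_lt_trans nr; move: h1 h2; rewrite -[delta ^ n]/(delta ^+ n).
move: (delta ^+ n) => t h1 h2.
rewrite [leRHS](_ : _ = A0 * (C1 * t + C1 * t)); last by ring.
by rewrite ler_pM2l// lerD// ltW.
Qed.

Lemma cube_sets_generate : @measurable d X = <<s cube_sets >>.
Proof.
apply/seteqP; split.
  rewrite (ht_borel hX); apply: smallest_sub; first exact: smallest_sigma_algebra.
  move=> U oU; rewrite (qopen_bigcup_cubes oU).
  apply: (@countable_bigcup_closed _ _ <<s cube_sets >>).
  - exact: sigma_algebra0.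
  - by move=> E; exact: sigma_algebra_bigcup.
  - by apply: sub_countable (cubes_countable hD); apply: subset_card_le => q [].
  - by move=> [k Q] [DQ _]; apply: sub_sigma_algebra; right; exists k.
apply: smallest_sub; first exact: sigma_algebra_measurable.
by move=> Q [->|[k DQ]]; [exact: measurable0|exact: (cube_measurable hD DQ)].
Qed.

(** The cubes around the distinguished center contain the balls of radius [c1 * delta ^ j] about it,
    which exhaust the space as [j] tends to minus infinity. Without such a point the ancestors of a
    cube might exhaust only a part of the space, as the standard dyadic intervals do on the line. *)
Lemma cube_absorb (x : X) k Q : D k Q ->
  distinguished_center D ctr -> mu setT = +oo%E ->
  forall M : R, exists l P, [/\ l <= k, D l P, Q `<=` P & M <= fine (mu P)].
Proof.
move=> DQ [x0 hx0] muoo M.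
have /andP[c10 cC1] := ds_radii hD; have /andP[d0 d1] := ds_delta hD.
have /choice[Z hZ] : forall j, exists Z, D j Z /\ Z x0.
  move=> j; have [Z DZ cZ] := hx0 j.
  by exists Z; split => //; rewrite -cZ; exact: (ds_center hD DZ).
have Zball j : qball rho x0 (c1 * delta ^ j) `<=` Z j.
  have [Q' DQ' cQ'] := hx0 j; have [DZ Zx0] := hZ j.
  have Q'x0 : Q' x0 by rewrite -cQ'; exact: (ds_center hD DQ').
  rewrite (cube_eq hD DZ DQ' Zx0 Q'x0) -cQ'; exact: (ds_inner_ball hD DQ').
pose F n := Z (- n%:Z).
have Fnd : nondecreasing_seq F.
  move=> m n mn; apply/subsetPset; have [DZm Zm] := hZ (- m%:Z); have [DZn Zn] := hZ (- n%:Z).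
  by apply: (cube_sub hD _ DZn DZm Zm Zn); rewrite lerN2.
have FT : \bigcup_n F n = setT.
  apply/seteqP; split => // y _.
  have y0 : 0 < rho x0 y + 1 by rewrite ltr_wpDl// (qm_ge0 (ht_quasi_metric hX)).
  have [n hn] := delta_small (divr_gt0 c10 y0).
  exists n => //; apply: Zball; rewrite /qball/=.
  rewrite -exprnN ltr_pdivlMr ?exprn_gt0//.
  move: hn; rewrite ltr_pdivlMr// mulrC; apply: le_lt_trans.
  by rewrite ler_pM2r ?exprn_gt0// lerDl.
have Fm n : measurable (F n) by have [DZ _] := hZ (- n%:Z); exact: (cube_measurable hD DZ).
have [n0 hn0] : exists n, (M%:E <= mu (F n))%E.
  apply: contrapT => /forallNP hM.
  have cv := @nondecreasing_cvg_mu _ _ _ mu _ Fm (bigcupT_measurable _ Fm) Fnd.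
  have : (mu (\bigcup_n F n) <= M%:E)%E.
    rewrite -(cvg_lim _ cv)//; apply: lime_le; first by apply/cvg_ex; eexists; exact: cv.
    by apply: nearW => n /=; apply/ltW; rewrite ltNge; apply/negP; exact: hM.
  by rewrite FT muoo leye_eq.
have [y Qy] := cube_nonempty hD DQ.
have : [set: X] y by []. rewrite -FT => -[n1 _ n1y].
(* One index for three demands: mass at least [M], meeting [Q], and generation at most [k], so that
   nestedness puts [Q] inside [F n]. *)
pose n := (n0 + n1 + `|k|)%N.
have nk : (- n%:Z <= k)%R.
  rewrite lerNl (le_trans (ler_norm _))// normrN -abszE lez_nat.
  exact: leq_addl.
have le1 : F n0 `<=` F n by apply/subsetPset/Fnd; rewrite /n -addnA leq_addr.
have le2 : F n1 `<=` F n by apply/subsetPset/Fnd; rewrite /n addnAC leq_addl.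
have [DZ _] := hZ (- n%:Z).
exists (- n%:Z), (F n); split => //.
  exact: (cube_sub hD nk DZ DQ Qy (le2 _ n1y)).
rewrite -lee_fin fineK ?(cube_fin_num hX hD DZ)//; apply: le_trans hn0 _.
by apply: le_measure; rewrite ?inE.
Qed.

End GeneratedByCubes.

(** Dynkin's theorem for the class of sets over which the integral vanishes; complements need the
    integral over the whole space, which the countable partition [F] into generators supplies. This
    takes the place of a differentiation theorem. *)
Lemma ae0_generator d (T : measurableType d) (R : realType) (mu : {measure set T -> \bar R})
  (G : set (set T)) (F : nat -> set T) (f : T -> R) :
  @measurable d T = <<s G >> -> setI_closed G -> (forall n, G (F n)) ->
  trivIset setT F -> \bigcup_n F n = setT ->
  mu.-integrable setT (EFin \o f) ->
  (forall A, G A -> (\int[mu]_(x in A) (f x)%:E = 0)%E) ->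
  ae_eq mu setT (EFin \o f) (cst 0%E).
Proof.
move=> mG GI GF tF FT fi fG.
have GM A : G A -> measurable A by rewrite mG; exact: sub_sigma_algebra.
have iS A : measurable A -> mu.-integrable A (EFin \o f).
  by move=> mA; apply: integrableS fi.
have U (E : nat -> set T) : (forall n, measurable (E n)) -> trivIset setT E ->
    (forall n, (\int[mu]_(x in E n) (f x)%:E = 0)%E) ->
    (\int[mu]_(x in \bigcup_n E n) (f x)%:E = 0)%E.
  move=> mE tE E0; rewrite (integral_bigcup tE mE); last exact/iS/bigcupT_measurable.
  by apply: eseries0 => n _ _; exact: E0.
have T0 : (\int[mu]_(x in setT) (f x)%:E = 0)%E.
  by rewrite -FT; apply: U => // n; [exact: GM|exact: fG].
have all0 A : measurable A -> (\int[mu]_(x in A) (f x)%:E = 0)%E.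
  move=> mA; move: (mA); rewrite {1}mG; move: A {mA}.
  apply: (@dynkin_induction _ _ G (fun A => \int[mu]_(x in A) (f x)%:E = 0)%E) => //.
  move=> S mS S0; have := @integral_setU _ _ _ mu S (~` S) (EFin \o f) mS (measurableC mS).
  rewrite setUCr S0 T0 add0e => <-//; first exact: (measurable_int _ fi).
  by apply/disj_setPS; rewrite setICr.
by apply: integral_ae_eq => // E _ mE; rewrite all0// integral0.
Qed.

Section ProductCubes.
Context {R : realType} {d1 d2 : measure_display}.
Context {X1 : measurableType d1} {X2 : measurableType d2}.
Variables (rho1 : X1 -> X1 -> R) (rho2 : X2 -> X2 -> R).
Variables (mu1 : {sigma_finite_measure set X1 -> \bar R}).
Variables (mu2 : {sigma_finite_measure set X2 -> \bar R}).
Hypotheses (hX1 : homogeneous_type rho1 mu1) (hX2 : homogeneous_type rho2 mu2).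
Variables (delta1 c1 C1 delta2 c2 C2 : R).
Variables (D1 : int -> set (set X1)) (ctr1 : int -> set X1 -> X1).
Variables (D2 : int -> set (set X2)) (ctr2 : int -> set X2 -> X2).
Hypotheses (hD1 : dyadic_system rho1 delta1 c1 C1 D1 ctr1)
  (hD2 : dyadic_system rho2 delta2 c2 C2 D2 ctr2).

Local Notation rect := ((int * set X1) * (int * set X2))%type.

Definition rect_sets : set (set (X1 * X2)) :=
  [set A `*` B | A in cube_sets D1 & B in cube_sets D2].

Lemma rect_sets_setI : setI_closed rect_sets.
Proof.
move=> _ _ [A1 hA1 [B1 hB1 <-]] [A2 hA2 [B2 hB2 <-]].
exists (A1 `&` A2); first exact: (cube_sets_setI hD1).
by exists (B1 `&` B2); [exact: (cube_sets_setI hD2)|rewrite setXI].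
Qed.

(** For each variable, the sets whose cylinder is in the generated sigma-algebra form a
    sigma-algebra containing the cubes: the free factor is split into cubes of generation 0, which
    makes the cylinder over a cube a countable union of rectangles. *)
Lemma rect_sets_generate : @measurable _ (X1 * X2)%type = <<s rect_sets >>.
Proof.
have cyl1 A : measurable A -> <<s rect_sets >> (A `*` setT).
  rewrite (cube_sets_generate hX1 hD1).
  have := @smallest_sub _ (@sigma_algebra X1 setT) (cube_sets D1) [set A | <<s rect_sets >> (A `*` setT)].
  apply; last first.
    move=> Q hQ /=.
    have -> : Q `*` [set: X2] = \bigcup_(P in D2 0) (Q `*` P).
      by rewrite -setX_bigcupr (ds_cover hD2).
    apply: (@countable_bigcup_closed _ _ <<s rect_sets >>).
    - exact: sigma_algebra0.
    - by move=> E; exact: sigma_algebra_bigcup.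
    - exact: ds_countable hD2 0.
    - by move=> P DP; apply: sub_sigma_algebra; exists Q => //; exists P => //; right; exists 0.
  split => /=.
  - by rewrite set0X; exact: sigma_algebra0.
  - move=> A' hA'; rewrite setTD.
    have -> : (~` A') `*` [set: X2] = ~` (A' `*` setT).
      by apply/seteqP; split=> [[x y] /= [h _] [/h]|[x y] /= h]//; split => // h'; apply: h.
    exact: sigma_algebraC.
  - move=> F hF; rewrite setX_bigcupl; exact: sigma_algebra_bigcup.
have cyl2 B : measurable B -> <<s rect_sets >> (setT `*` B).
  rewrite (cube_sets_generate hX2 hD2).
  have := @smallest_sub _ (@sigma_algebra X2 setT) (cube_sets D2) [set B | <<s rect_sets >> (setT `*` B)].
  apply; last first.
    move=> Q hQ /=.
    have -> : [set: X1] `*` Q = \bigcup_(P in D1 0) (P `*` Q).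
      by rewrite -setX_bigcupl (ds_cover hD1).
    apply: (@countable_bigcup_closed _ _ <<s rect_sets >>).
    - exact: sigma_algebra0.
    - by move=> E; exact: sigma_algebra_bigcup.
    - exact: ds_countable hD1 0.
    - by move=> P DP; apply: sub_sigma_algebra; exists P; [right; exists 0|exists Q].
  split => /=.
  - by rewrite setX0; exact: sigma_algebra0.
  - move=> A' hA'; rewrite setTD.
    have -> : [set: X1] `*` (~` A') = ~` (setT `*` A').
      by apply/seteqP; split=> [[x y] /= [_ h] [_ /h]|[x y] /= h]//; split => // h'; apply: h.
    exact: sigma_algebraC.
  - move=> F hF; rewrite setX_bigcupr; exact: sigma_algebra_bigcup.
apply/seteqP; split; last first.
  apply: smallest_sub; first exact: sigma_algebra_measurable.
  have m1 A : cube_sets D1 A -> measurable A.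
    by rewrite (cube_sets_generate hX1 hD1); exact: sub_sigma_algebra.
  have m2 A : cube_sets D2 A -> measurable A.
    by rewrite (cube_sets_generate hX2 hD2); exact: sub_sigma_algebra.
  by move=> _ [A /m1 mA [B /m2 mB <-]]; exact: measurableX.
rewrite /measurable/=; apply: smallest_sub; first exact: smallest_sigma_algebra.
move=> _ [[A mA <-]|[B mB <-]].
  by rewrite setTI; have -> : fst @^-1` A = A `*` [set: X2]; [rewrite setXT|exact: cyl1].
by rewrite setTI; have -> : snd @^-1` B = [set: X1] `*` B; [rewrite setTX|exact: cyl2].
Qed.

Lemma rects_countable : countable (rects D1 D2).
Proof.
apply: countableX; [exact: (cubes_countable hD1)|exact: (cubes_countable hD2)].
Qed.

Lemma rect_set_measurable (r : rect) : rects D1 D2 r -> measurable (rect_set r).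
Proof.
by move=> [h1 h2]; apply: measurableX; [exact: (cube_measurable hD1 h1)|exact: (cube_measurable hD2 h2)].
Qed.

Lemma rect_sets_cover : exists F : nat -> set (X1 * X2),
  [/\ forall n, rect_sets (F n), trivIset setT F & \bigcup_n F n = setT].
Proof.
pose A := D1 0 `*` D2 0.
have /countable_injP[f fI] : countable A.
  by apply: countableX; [exact: ds_countable hD1 0|exact: ds_countable hD2 0].
pose F n := \bigcup_(p in A `&` f @^-1` [set n]) (p.1 `*` p.2).
exists F; split.
- move=> n; rewrite /F; have [->|/set0P[i [Ai /= fi]]] := eqVneq (A `&` f @^-1` [set n]) set0.
    by rewrite bigcup_set0; exists set0; [left|exists set0; [left|rewrite setX0]].
  have -> : A `&` f @^-1` [set n] = [set i].
    apply/seteqP; split=> [j [Aj /= fj]|_ ->//]; apply: fI; rewrite ?inE//.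
    by rewrite fi fj.
  case: Ai => A1 A2.
  by rewrite bigcup_set1; exists i.1; [right; exists 0|exists i.2 => //; right; exists 0].
- apply/trivIsetP => m n _ _ mn; rewrite -subset0 => -[x y] [[p [[p1 p2] /= fp] [/= px py]] [q [[q1 q2] /= fq] [/= qx qy]]].
  move: mn; rewrite -fp -fq.
  have e1 := cube_eq hD1 p1 q1 px qx; have e2 := cube_eq hD2 p2 q2 py qy.
  by case: p q e1 e2 {p1 p2 fp px py q1 q2 fq qx qy} => a b [a' b'] /= -> ->; rewrite eqxx.
- apply/seteqP; split => // -[x y] _.
  have [P DP Px] := cube_ex hD1 0 x; have [Q DQ Qy] := cube_ex hD2 0 y.
  by exists (f (P, Q)) => //; exists (P, Q).
Qed.

Lemma ae0_rects (f : X1 * X2 -> R) :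
  (mu1 \x mu2)%E.-integrable setT (EFin \o f) ->
  (forall r, rects D1 D2 r -> (\int[(mu1 \x mu2)%E]_(x in rect_set r) (f x)%:E = 0)%E) ->
  ae_eq (mu1 \x mu2)%E setT (EFin \o f) (cst 0%E).
Proof.
move=> fi f0; have [F [GF tF FT]] := rect_sets_cover.
apply: (ae0_generator rect_sets_generate rect_sets_setI GF tF FT fi).
move=> _ [A hA [B hB <-]].
case: hA => [->|[k DA]]; first by rewrite set0X integral_set0.
case: hB => [->|[l DB]]; first by rewrite setX0 integral_set0.
exact: (f0 ((k, A), (l, B))).
Qed.

End ProductCubes.

(** * Integrability, product integrals and countable sums *)

Section Integrals.
Context {R : realType} {d : measure_display} {T : measurableType d}.
Variable mu : {measure set T -> \bar R}.
Implicit Types (f g h : T -> R).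

Local Notation intg f := (mu.-integrable setT (EFin \o f)).

Lemma integrable_mul_bounded f h (M : R) : intg f -> measurable_fun setT h ->
  (forall x, `|h x| <= M) -> intg (fun x => f x * h x).
Proof.
move=> fi mh hM; have mf : measurable_fun setT f by apply/measurable_EFinP; exact: measurable_int fi.
apply: (@le_integrable _ _ _ mu setT _ _ (fun x => (M%:E * `|(f x)%:E|)%E)) => //.
- by apply/measurable_EFinP; exact: measurable_funM.
- move=> x _; rewrite /= lee_fin !normrM normr_id mulrC.
  by rewrite ler_wpM2r// (le_trans (hM x)) ?ler_norm.
- by apply: integrableZl => //; exact: integrable_abse.
Qed.

Lemma Rintegral_sum (I : Type) (s : seq I) (P : pred I) (F : I -> T -> R) :
  (forall i, P i -> intg (F i)) ->
  intg (fun x => \sum_(i <- s | P i) F i x) /\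
  \int[mu]_x (\sum_(i <- s | P i) F i x) = \sum_(i <- s | P i) \int[mu]_x F i x.
Proof.
move=> iF; elim: s => [|i s [IH1 IH2]].
  rewrite big_nil; under eq_Rintegral do rewrite big_nil.
  split; last by rewrite Rintegral_cst// mul0r.
  by rewrite (_ : EFin \o _ = cst 0%E); [exact: integrable0|apply/funext => x /=; rewrite big_nil].
rewrite big_cons; under eq_Rintegral do rewrite big_cons.
case: ifPn => Pi.
  split; last by rewrite RintegralD// ?IH2//; exact: iF.
  rewrite (_ : EFin \o _ = (EFin \o F i) \+ (EFin \o fun x => \sum_(i <- s | P i) F i x)%R)%E.
    by apply: integrableD => //; exact: iF.
  by apply/funext => x /=; rewrite big_cons Pi EFinD.
split => //.
by rewrite (_ : EFin \o _ = EFin \o fun x => \sum_(i <- s | P i) F i x)//; apply/funext => x /=; rewrite big_cons (negbTE Pi).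
Qed.

Lemma poweR2 (x : \bar R) : (0 <= x -> x `^ 2 = x ^+ 2)%E.
Proof.
case: x => [r r0|_|//]; last by rewrite poweRyr// expe2 mulyy.
by rewrite poweR_EFin powR_mulrn// EFin_expe.
Qed.

Lemma Lnorm2_sqr f : ('N[mu]_2%:E[EFin \o f] ^+ 2 = \int[mu]_x (f x ^+ 2)%:E)%E.
Proof.
rewrite -poweR2; last exact: Lnorm_ge0.
rewrite poweR_Lnorm//; apply: eq_integral => x _.
by rewrite /= powR_mulrn ?normr_ge0// real_normK ?num_real.
Qed.

Lemma Lfun2P f : measurable_fun setT f -> (\int[mu]_x (f x ^+ 2)%:E < +oo)%E ->
  f \in Lfun mu 2%:E.
Proof.
move=> mf foo; rewrite inE; apply/andP; split; rewrite inE//=.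
rewrite /finite_norm ltey; apply/eqP => fy; move: foo; rewrite -Lnorm2_sqr fy.
by rewrite expe2 mulyy ltxx.
Qed.

Lemma Lfun_measurable f p : f \in Lfun mu p -> measurable_fun setT f.
Proof. by rewrite inE => /andP[]; rewrite inE. Qed.

Lemma Lfun2_mul_integrable f g : f \in Lfun mu 2%:E -> g \in Lfun mu 2%:E ->
  intg (fun x => f x * g x).
Proof. by move=> f2 g2; apply/Lfun1_integrable; exact: Lfun2_mul_Lfun1. Qed.

Lemma Lfun2B_sum f (I : Type) (s : seq I) (P : pred I) (F : I -> T -> R) :
  f \in Lfun mu 2%:E -> (forall i, P i -> F i \in Lfun mu 2%:E) ->
  (fun x => f x - \sum_(i <- s | P i) F i x) \in Lfun mu 2%:E.
Proof.
move=> + F2; have p1 : (1 <= 2%:E :> \bar R)%E by rewrite lee_fin ler1n.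
elim: s f => [|i s IH] f f2.
  by rewrite (_ : (fun x => _) = f)//; apply/funext => x; rewrite big_nil subr0.
case: (boolP (P i)) => Pi.
  rewrite (_ : (fun x => _) = (fun x => f x - F i x - \sum_(i <- s | P i) F i x)); last first.
    by apply/funext => x; rewrite big_cons Pi opprD addrA.
  apply: IH; have [_ addc] := Lfun_addr_closed mu p1.
  apply: (addc f (fun x => - F i x)) => //.
  by have := @Lfun_oppr_closed _ _ _ mu 2%:E (F i); apply; exact: F2.
rewrite (_ : (fun x => _) = (fun x => f x - \sum_(i <- s | P i) F i x)); first exact: IH.
by apply/funext => x; rewrite big_cons (negbTE Pi).
Qed.

(** Cauchy-Schwarz against the indicator of [A], which is square integrable since [A] has finite
    measure. *)
Lemma Lfun2_supp_integrable f (A : set T) : f \in Lfun mu 2%:E ->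
  measurable A -> (mu A < +oo)%E -> {ae mu, forall x, ~ A x -> f x = 0} -> intg f.
Proof.
move=> f2 mA Aoo f0; have mf := Lfun_measurable f2.
have A2 : (\1_A : T -> R) \in Lfun mu 2%:E.
  apply: Lfun2P; first exact: measurable_indic.
  rewrite (eq_integral (fun x => (\1_A x)%:E)); first by rewrite integral_indic// setIT.
  by move=> x _; rewrite indicE; case: (_ \in _); rewrite ?expr1n ?expr0n.
have := Lfun2_mul_integrable f2 A2.
move/integrableP => [_ h]; apply/integrableP; split; first exact/measurable_EFinP.
rewrite (ae_eq_integral (fun x => `|(f x * \1_A x)%:E|)%E)//.
- by apply: measurableT_comp => //; exact/measurable_EFinP.
- apply: measurableT_comp => //; apply/measurable_EFinP/measurable_funM => //.
apply: filterS f0 => x f0 _ /=; have [Ax|nAx] := pselect (A x).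
  by rewrite indicE mem_set// mulr1.
by rewrite f0// mul0r.
Qed.

End Integrals.

Section ProductIntegral.
Context {R : realType} {d1 d2 : measure_display}.
Context {X1 : measurableType d1} {X2 : measurableType d2}.
Variables (mu1 : {sigma_finite_measure set X1 -> \bar R}).
Variables (mu2 : {sigma_finite_measure set X2 -> \bar R}).
Local Notation mu := (mu1 \x mu2)%E.

Lemma product_integral (g : X1 -> R) (h : X2 -> R) :
  mu1.-integrable setT (EFin \o g) -> mu2.-integrable setT (EFin \o h) ->
  mu.-integrable setT (fun x => (g x.1 * h x.2)%:E) /\
  (\int[mu]_x (g x.1 * h x.2)%:E = (\int[mu1]_x (g x)%:E) * (\int[mu2]_x (h x)%:E))%E.
Proof.
move=> gi hi.
have mg : measurable_fun setT g by apply/measurable_EFinP; exact: measurable_int gi.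
have mh : measurable_fun setT h by apply/measurable_EFinP; exact: measurable_int hi.
have mgh : measurable_fun setT (fun x : X1 * X2 => (g x.1 * h x.2)%:E).
  apply/measurable_EFinP; apply: measurable_funM.
    by apply: (measurableT_comp mg); exact: measurable_fst.
  by apply: (measurableT_comp mh); exact: measurable_snd.
have ghi : mu.-integrable setT (fun x => (g x.1 * h x.2)%:E).
  apply/integrable12ltyP => //=.
  under eq_integral => x _.
    under eq_integral => y _ do rewrite normrM EFinM.
    rewrite ge0_integralZl//; last by apply/measurable_EFinP; exact: measurableT_comp.
    over.
  rewrite /= ge0_integralZr//; last 2 first.
  - by apply/measurable_EFinP; exact: measurableT_comp.
  - exact: integral_ge0.
  have /integrableP[_ h1] := gi; have /integrableP[_ h2] := hi.
  by apply: lte_mul_pinfty => //; [exact: integral_ge0|rewrite ge0_fin_numE//; exact: integral_ge0].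
split => //; rewrite -integral12_prod_meas1//.
transitivity (\int[mu1]_x ((g x)%:E * \int[mu2]_y (h y)%:E))%E.
  by apply: eq_integral => x _; rewrite /fubini_F /=; under eq_integral do rewrite EFinM; rewrite integralZl.
have hf : (\int[mu2]_y (h y)%:E)%E \is a fin_num by exact: integrable_fin_num.
by rewrite -(fineK hf) integralZr.
Qed.

End ProductIntegral.

Section CountableSums.
Context {R : realType}.

(** One enumeration for all nonnegative families at once: [g] and [P] are fixed before [a], so that
    a sum depending on a point becomes, for every point, a series in the same order, to which
    monotone convergence applies. [P] marks the indices in use and [i0] fills [g] elsewhere. *)
Lemma esum_nneseries (I : choiceType) (A : set I) (i0 : I) : countable A ->
  exists (g : nat -> I) (P : pred nat), (forall n, P n -> A (g n)) /\
  forall a : I -> \bar R, (forall i, A i -> (0 <= a i)%E) ->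
    (\esum_(i in A) a i = \sum_(0 <= n <oo) (if P n then a (g n) else 0))%E.
Proof.
move=> /countable_injP[f fI].
have fb : set_bij A (f @` A) f by split; [move=> i Ai; exists i|exact: fI|move=> _ [i Ai <-]; exists i].
have /choice[g hg] : forall n, exists i, (f @` A) n -> A i /\ f i = n.
  move=> n; have [[i Ai <-]|nA] := pselect ((f @` A) n); first by exists i.
  by exists i0 => /nA.
exists g, (fun n => n \in f @` A); split=> [n|a a0]; first by rewrite inE => /hg[].
rewrite -(@eq_esum _ _ A (a \o g \o f)); last first.
  move=> i Ai /=; congr a; have [Ag fg] := hg (f i) (ex_intro2 _ _ i Ai erefl).
  by apply: fI; rewrite ?inE.
rewrite -(@reindex_esum _ _ _ A (f @` A) f (a \o g))//.
have -> : f @` A = [set n | n \in f @` A] by apply/seteqP; split=> n /=; rewrite inE.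
rewrite -nneseries_esum; last by move=> n; rewrite inE => /hg[/a0].
rewrite eseries_mkcond; congr (limn _); apply/funext => n; apply: eq_bigr => m _ /=.
by rewrite set_mem_set.
Qed.

Context {d : measure_display} {T : measurableType d}.
Variable mu : {measure set T -> \bar R}.
Variables (I : choiceType) (A : set I) (i0 : I).
Hypothesis cA : countable A.
Variable a : I -> T -> \bar R.
Hypotheses (a0 : forall i x, A i -> (0 <= a i x)%E)
  (ma : forall i, A i -> measurable_fun setT (a i)).

Lemma measurable_esum : measurable_fun setT (fun x => (\esum_(i in A) a i x)%E).
Proof.
have [g [P [Pg hg]]] := esum_nneseries i0 cA.
under eq_fun do rewrite hg => [|i /a0//].
apply: (@ge0_emeasurable_sum _ _ _ setT (fun n x => if P n then a (g n) x else 0%E) xpredT).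
  by move=> n x _ _; case Pn: (P n) => //; apply/a0/Pg.
by move=> n _; case Pn: (P n) => //; apply/ma/Pg.
Qed.

Lemma integral_esum :
  (\int[mu]_x (\esum_(i in A) a i x) = \esum_(i in A) \int[mu]_x (a i x))%E.
Proof.
have [g [P [Pg hg]]] := esum_nneseries i0 cA.
rewrite hg; last by move=> i Ai; apply: integral_ge0 => x _; exact: a0.
under eq_integral do rewrite hg => [|i /a0//].
rewrite integral_nneseries//.
- apply: eq_eseriesr => n _; case: ifPn => // _; by rewrite integral0.
- by move=> n; case Pn: (P n) => //; apply/ma/Pg.
- by move=> n x _; case Pn: (P n) => //; apply/a0/Pg.
Qed.

End CountableSums.

(** * Product Haar functions and Bessel's inequality *)

Section ProductHaar.
Context {R : realType} {d1 d2 : measure_display}.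
Context {X1 : measurableType d1} {X2 : measurableType d2}.
Variables (rho1 : X1 -> X1 -> R) (rho2 : X2 -> X2 -> R).
Variables (mu1 : {sigma_finite_measure set X1 -> \bar R}).
Variables (mu2 : {sigma_finite_measure set X2 -> \bar R}).
Hypotheses (hX1 : homogeneous_type rho1 mu1) (hX2 : homogeneous_type rho2 mu2).
Variables (delta1 c1 C1 delta2 c2 C2 : R).
Variables (D1 : int -> set (set X1)) (ctr1 : int -> set X1 -> X1).
Variables (D2 : int -> set (set X2)) (ctr2 : int -> set X2 -> X2).
Hypotheses (hD1 : dyadic_system rho1 delta1 c1 C1 D1 ctr1)
  (hD2 : dyadic_system rho2 delta2 c2 C2 D2 ctr2).
Variables (ord1 : int -> set X1 -> seq (set X1)) (ord2 : int -> set X2 -> seq (set X2)).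
Hypotheses (hord1 : haar_order mu1 D1 ord1) (hord2 : haar_order mu2 D2 ord2).

Local Notation mu := (mu1 \x mu2)%E.
Local Notation rect := ((int * set X1) * (int * set X2))%type.
Local Notation hidx := (rect * (nat * nat))%type.
Implicit Types (i j : hidx) (r : rect) (f g : X1 * X2 -> R).

Definition haar_range r : set (nat * nat) :=
  `I_((size (ord1 r.1.1 r.1.2)).-1) `*` `I_((size (ord2 r.2.1 r.2.2)).-1).

(** Flattens the sums over rectangles and over the two Haar indices into one countable index set. *)
Definition haar_index : set hidx := rects D1 D2 `*`` haar_range.

Definition haar_prod i (x : X1 * X2) : R :=
  haar mu1 (ord1 i.1.1.1 i.1.1.2) i.2.1 x.1 * haar mu2 (ord2 i.1.2.1 i.1.2.2) i.2.2 x.2.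

Definition hcoef f i : R := \int[mu]_x (f x * haar_prod i x).

Lemma haar_prod_measurable i : haar_index i -> measurable_fun setT (haar_prod i).
Proof.
move=> [[h1 h2] [v1 v2]]; apply: measurable_funM.
  by apply: (measurableT_comp (haar_measurable hD1 hord1 h1 v1)); exact: measurable_fst.
by apply: (measurableT_comp (haar_measurable hD2 hord2 h2 v2)); exact: measurable_snd.
Qed.

Lemma haar_prod_bounded i : exists M : R, forall x, `|haar_prod i x| <= M.
Proof.
have [M1 h1] := haar_bounded mu1 ord1 i.1.1.1 i.1.1.2 i.2.1.
have [M2 h2] := haar_bounded mu2 ord2 i.1.2.1 i.1.2.2 i.2.2.
by exists (M1 * M2) => x; rewrite normrM ler_pM.
Qed.

Lemma haar_prod_out i x : haar_index i -> ~ rect_set i.1 x -> haar_prod i x = 0.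
Proof.
move=> [[h1 h2] [v1 v2]] nx; rewrite /haar_prod.
have [Q1x|nQ1x] := pselect (i.1.1.2 x.1).
  by rewrite [X in _ * X](haar_out hord2 h2 v2) ?mulr0// => Q2x; apply: nx.
by rewrite (haar_out hord1 h1 v1 nQ1x) mul0r.
Qed.

Lemma mul_haar_prod_integrable f i : haar_index i -> mu.-integrable setT (EFin \o f) ->
  mu.-integrable setT (EFin \o (fun x => f x * haar_prod i x)).
Proof.
move=> hi fi; have [M hM] := haar_prod_bounded i.
exact: (integrable_mul_bounded fi (haar_prod_measurable hi) hM).
Qed.

Lemma haar_prod_integrable i : haar_index i -> mu.-integrable setT (EFin \o haar_prod i).
Proof.
move=> [[h1 h2] [v1 v2]].
have [+ _] := product_integral (haar_integrable hX1 hD1 hord1 h1 v1) (haar_integrable hX2 hD2 hord2 h2 v2).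
by [].
Qed.

Lemma haar_prod_mul_integrable i j : haar_index i -> haar_index j ->
  mu.-integrable setT (EFin \o (fun x => haar_prod i x * haar_prod j x)).
Proof. by move=> hi hj; apply: mul_haar_prod_integrable => //; exact: haar_prod_integrable. Qed.

(** The integral factors over the two variables; if the indices differ, they differ in one of the
    variables, and [haar_ortho] makes that factor zero. *)
Lemma haar_prod_ortho i j : haar_index i -> haar_index j ->
  \int[mu]_x (haar_prod i x * haar_prod j x) = (i == j)%:R.
Proof.
move=> [[h1 h2] [v1 v2]] [[h1' h2'] [v1' v2']].
pose g1 x := haar mu1 (ord1 i.1.1.1 i.1.1.2) i.2.1 x * haar mu1 (ord1 j.1.1.1 j.1.1.2) j.2.1 x.
pose g2 x := haar mu2 (ord2 i.1.2.1 i.1.2.2) i.2.2 x * haar mu2 (ord2 j.1.2.1 j.1.2.2) j.2.2 x.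
have g1i : mu1.-integrable setT (EFin \o g1).
  have [M hM] := haar_bounded mu1 ord1 j.1.1.1 j.1.1.2 j.2.1.
  exact: (integrable_mul_bounded (haar_integrable hX1 hD1 hord1 h1 v1) (haar_measurable hD1 hord1 h1' v1') hM).
have g2i : mu2.-integrable setT (EFin \o g2).
  have [M hM] := haar_bounded mu2 ord2 j.1.2.1 j.1.2.2 j.2.2.
  exact: (integrable_mul_bounded (haar_integrable hX2 hD2 hord2 h2 v2) (haar_measurable hD2 hord2 h2' v2') hM).
rewrite /Rintegral (eq_integral (fun x => (g1 x.1 * g2 x.2)%:E)); last first.
  by move=> x _; congr EFin; rewrite /haar_prod /g1 /g2; ring.
have [_ ->] := product_integral g1i g2i.
have [e|/eqP ne] := eqVneq i j.
  by subst j; rewrite /g1 /g2 (haar_sqr_integral hX1 hD1 hord1 h1 v1) (haar_sqr_integral hX2 hD2 hord2 h2 v2) mule1.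
have [e1|n1] := pselect ((i.1.1.1, i.1.1.2, i.2.1) = (j.1.1.1, j.1.1.2, j.2.1)); last first.
  by rewrite /g1 (haar_ortho hX1 hD1 hord1 h1 h1' v1 v1' n1) mul0e.
have [e2|n2] := pselect ((i.1.2.1, i.1.2.2, i.2.2) = (j.1.2.1, j.1.2.2, j.2.2)); last first.
  by rewrite /g2 (haar_ortho hX2 hD2 hord2 h2 h2' v2 v2' n2) mule0.
case: ne; move: e1 e2; case: (i) => -[[a b] [c d]] [u v]; case: (j) => -[[a' b'] [c' d']] [u' v'] /=.
by move=> [-> -> ->] [-> -> ->].
Qed.

Lemma haar_prod_Lfun2 i : haar_index i -> haar_prod i \in Lfun mu 2%:E.
Proof.
move=> hi; apply: Lfun2P; first exact: haar_prod_measurable.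
have /integrableP[_] := haar_prod_mul_integrable hi hi; apply: le_lt_trans.
rewrite le_eqVlt; apply/orP; left; apply/eqP; apply: eq_integral => x _.
by rewrite /= -expr2 ger0_norm ?sqr_ge0.
Qed.

Lemma coefZ f (a : R) i : haar_index i -> mu.-integrable setT (EFin \o f) ->
  hcoef (fun x => a * f x) i = a * hcoef f i.
Proof.
move=> hi fi; rewrite /hcoef -RintegralZl//; last exact: mul_haar_prod_integrable.
by apply: eq_Rintegral => x _; rewrite mulrA.
Qed.

Lemma coefB f g i : haar_index i -> mu.-integrable setT (EFin \o f) ->
  mu.-integrable setT (EFin \o g) ->
  hcoef (fun x => f x - g x) i = hcoef f i - hcoef g i.
Proof.
move=> hi fi gi; rewrite /hcoef -RintegralB//; [|exact: mul_haar_prod_integrable..].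
by apply: eq_Rintegral => x _; rewrite mulrBl.
Qed.

Lemma coef_sum (I : Type) (s : seq I) (P : pred I) (F : I -> X1 * X2 -> R) i : haar_index i ->
  (forall k, P k -> mu.-integrable setT (EFin \o F k)) ->
  hcoef (fun x => \sum_(k <- s | P k) F k x) i = \sum_(k <- s | P k) hcoef (F k) i.
Proof.
move=> hi Fi; rewrite /hcoef; under eq_Rintegral do rewrite mulr_suml.
by have [_ ->] := Rintegral_sum s (fun k Pk => mul_haar_prod_integrable hi (Fi k Pk)).
Qed.

(** A Haar function is bounded, so its coefficient is continuous in L^1; this carries coefficients
    through series that converge in L^1. *)
Lemma coef_le f i (M : R) : haar_index i -> mu.-integrable setT (EFin \o f) ->
  (forall x, `|haar_prod i x| <= M) ->
  (`|(hcoef f i)%:E| <= M%:E * \int[mu]_x `|(f x)%:E|)%E.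
Proof.
move=> hi fi hM; have M0 : 0 <= M by apply: le_trans (hM point).
have fhi := mul_haar_prod_integrable hi fi.
rewrite /hcoef fineK; last exact: integrable_fin_num.
apply: (le_trans (le_abse_integral _ _ _)) => //; first exact: measurable_int fhi.
rewrite -ge0_integralZl//; last by have := measurable_int _ fi; exact: measurableT_comp.
apply: ge0_le_integral => //.
- by apply: measurableT_comp => //; exact: (measurable_int _ fhi).
- apply: measurable_funeM; apply: measurableT_comp => //; exact: (measurable_int _ fi).
by move=> x _ /=; rewrite lee_fin normrM mulrC ler_wpM2r.
Qed.

Definition haar_comb (s : seq hidx) (c : hidx -> R) x := \sum_(i <- s) c i * haar_prod i x.

Lemma Rintegral_mul_haar_comb F (s : seq hidx) c :
  {in s, forall i, mu.-integrable setT (EFin \o (fun x => F x * haar_prod i x))} ->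
  mu.-integrable setT (EFin \o (fun x => F x * haar_comb s c x)) /\
  \int[mu]_x (F x * haar_comb s c x) = \sum_(i <- s) c i * hcoef F i.
Proof.
move=> Fs.
have e : (fun x => F x * haar_comb s c x) =
    (fun x => \sum_(i <- s | i \in s) c i * (F x * haar_prod i x)).
  apply/funext => x; rewrite /haar_comb mulr_sumr big_seq.
  by apply: eq_bigr => i _; ring.
have cF i : i \in s -> mu.-integrable setT (EFin \o (fun x => c i * (F x * haar_prod i x))).
  move=> si; rewrite (_ : EFin \o _ = fun x => ((c i)%:E * (EFin \o (fun x => (F x * haar_prod i x)%R)) x)%E)//.
  by apply: integrableZl => //; exact: Fs.
have [h1 h2] := Rintegral_sum s cF.
rewrite e; split => //; rewrite h2 [RHS]big_seq; apply: eq_bigr => i si.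
by rewrite RintegralZl//; exact: Fs.
Qed.

Lemma haar_comb_integrable (s : seq hidx) c : {in s, forall i, haar_index i} ->
  mu.-integrable setT (EFin \o haar_comb s c).
Proof.
move=> sI.
have [] := @Rintegral_sum _ _ _ mu _ s (mem s) (fun i x => c i * haar_prod i x).
  move=> i /sI hi; rewrite (_ : EFin \o _ = fun x => ((c i)%:E * (EFin \o haar_prod i) x)%E)//.
  by apply: integrableZl => //; exact: haar_prod_integrable.
move=> h _; rewrite (_ : EFin \o _ = EFin \o (fun x => \sum_(i <- s | mem s i) c i * haar_prod i x))//.
by apply/funext => x /=; rewrite /haar_comb big_seq.
Qed.

Lemma haar_comb_mul_integrable (s : seq hidx) c j : {in s, forall i, haar_index i} -> haar_index j ->
  mu.-integrable setT (EFin \o (fun x => haar_comb s c x * haar_prod j x)).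
Proof. by move=> sI hj; apply: mul_haar_prod_integrable => //; exact: haar_comb_integrable. Qed.

Lemma coef_haar_comb (s : seq hidx) c j : uniq s -> {in s, forall i, haar_index i} -> haar_index j ->
  hcoef (haar_comb s c) j = if j \in s then c j else 0.
Proof.
move=> us sI hj; rewrite /hcoef; under eq_Rintegral do rewrite mulrC.
have [_ ->] := @Rintegral_mul_haar_comb (haar_prod j) s c (fun i si => haar_prod_mul_integrable hj (sI i si)).
have e i : i \in s -> c i * hcoef (haar_prod j) i = if i == j then c j else 0.
  move=> si; rewrite /hcoef haar_prod_ortho//; last exact: sI.
  by rewrite eq_sym; case: eqVneq => [->|]; rewrite ?mulr1 ?mulr0.
rewrite big_seq (eq_bigr _ e) -big_seq.
case: ifPn => js; last first.
  by rewrite big1_seq// => i /= si; case: eqVneq => // ij; rewrite -ij si in js.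
by rewrite (bigD1_seq j)//= eqxx big1 ?addr0// => i /negbTE ->.
Qed.

Lemma haar_comb_sqr (s : seq hidx) c : uniq s -> {in s, forall i, haar_index i} ->
  mu.-integrable setT (EFin \o (fun x => haar_comb s c x * haar_comb s c x)) /\
  \int[mu]_x (haar_comb s c x * haar_comb s c x) = \sum_(i <- s) c i ^+ 2.
Proof.
move=> us sI; have [h1 h2] := @Rintegral_mul_haar_comb (haar_comb s c) s c
  (fun i si => haar_comb_mul_integrable c sI (sI i si)).
split => //; rewrite h2 big_seq [RHS]big_seq; apply: eq_bigr => i si.
by rewrite coef_haar_comb// ?si ?expr2//; exact: sI.
Qed.

Lemma haar_comb_measurable (s : seq hidx) c : {in s, forall i, haar_index i} ->
  measurable_fun setT (haar_comb s c).
Proof. by move=> /(haar_comb_integrable c) /(measurable_int _) /measurable_EFinP. Qed.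

Lemma haar_comb_sqr_integral (s : seq hidx) c : uniq s -> {in s, forall i, haar_index i} ->
  (\int[mu]_x (haar_comb s c x ^+ 2)%:E = (\sum_(i <- s) c i ^+ 2)%:E)%E.
Proof.
move=> us sI; have [h1 <-] := haar_comb_sqr c us sI; rewrite /Rintegral fineK.
  by apply: eq_integral => x _; rewrite expr2.
exact: integrable_fin_num.
Qed.

(** The difference of the two sides is the integral of the square of [f] minus its finite Haar
    projection. *)
Lemma bessel f (s : seq hidx) : uniq s -> {in s, forall i, haar_index i} ->
  f \in Lfun mu 2%:E ->
  ((\sum_(i <- s) hcoef f i ^+ 2)%:E <= \int[mu]_x (f x ^+ 2)%:E)%E.
Proof.
move=> us sI f2; pose g := haar_comb s (hcoef f).
have ffi := Lfun2_mul_integrable f2 f2.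
have [fgi fg] := @Rintegral_mul_haar_comb f s (hcoef f)
  (fun i si => Lfun2_mul_integrable f2 (haar_prod_Lfun2 (sI i si))).
have [ggi gg] := haar_comb_sqr (hcoef f) us sI.
rewrite -/g in fgi fg ggi gg.
have <- : ((\int[mu]_x (f x * f x))%:E = \int[mu]_x (f x ^+ 2)%:E)%E.
  rewrite /Rintegral fineK; last exact: integrable_fin_num.
  by apply: eq_integral => x _; rewrite expr2.
rewrite lee_fin.
have e : \int[mu]_x (f x * f x - 2 * (f x * g x) + g x * g x) =
    \int[mu]_x (f x * f x) - \sum_(i <- s) hcoef f i ^+ 2.
  have fg2i : mu.-integrable setT (EFin \o (fun x => 2 * (f x * g x))).
    rewrite (_ : EFin \o _ = fun x => (2%:E * (EFin \o (fun x => (f x * g x)%R)) x)%E)//.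
    exact: integrableZl.
  have fBi : mu.-integrable setT (EFin \o (fun x => f x * f x - 2 * (f x * g x))).
    rewrite (_ : EFin \o _ = (EFin \o (fun x => (f x * f x)%R)) \- (EFin \o (fun x => (2 * (f x * g x))%R)))%E//.
    exact: integrableB.
  rewrite RintegralD// RintegralB// RintegralZl// fg gg.
  have -> : \sum_(i <- s) hcoef f i * hcoef f i = \sum_(i <- s) hcoef f i ^+ 2.
    by apply: eq_bigr => i _; rewrite expr2.
  by ring.
rewrite -subr_ge0 -e; apply: Rintegral_ge0 => x _.
by rewrite (_ : _ + _ = (f x - g x) ^+ 2) ?sqr_ge0//; ring.
Qed.

End ProductHaar.

Lemma esum_le_seq (R : realType) (I : choiceType) (A : set I) (a : I -> \bar R) (B : \bar R) :
  (forall s : seq I, uniq s -> {in s, forall i, A i} -> (\sum_(i <- s) a i <= B)%E) ->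
  (\esum_(i in A) a i <= B)%E.
Proof.
move=> h; apply: ge_ereal_sup => _ [F [fF FA] <-]; rewrite fsbig_finite//=.
by apply: h => // i; rewrite in_fset_set// in_setE => /FA.
Qed.

Lemma seq_le_esum (R : realType) (I : choiceType) (A : set I) (a : I -> \bar R) (s : seq I) :
  (forall i, A i -> (0 <= a i)%E) -> uniq s -> {in s, forall i, A i} ->
  (\sum_(i <- s) a i <= \esum_(i in A) a i)%E.
Proof.
move=> a0 us sA; apply: esum_ge; exists [set` s]; first by split => // i /sA.
by rewrite fsbig_seq.
Qed.

Lemma sqre_poweR (R : realType) (x : \bar R) : (0 <= x -> (x `^ 2^-1) ^+ 2 = x)%E.
Proof.
move=> x0; rewrite -poweR2 ?poweR_ge0// -poweRrM mulVf// poweRe1//.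
Qed.

(** The square of [t * u - 1], divided by [2 * t]. With [t] the measure of a set that carries [u],
    and the integral of [u ^+ 2] at most [1 / t], each of the two terms integrates over that set to
    at most one half. *)
Lemma amgm_inv (R : realType) (t : R) (u : \bar R) : 0 < t -> (0 <= u)%E ->
  (u <= (t / 2)%:E * u ^+ 2 + (2 * t)^-1%:E)%E.
Proof.
move=> t0; case: u => [u u0|_|//]; last first.
  by rewrite expe2 mulyy gt0_muley ?lte_fin ?divr_gt0// addye.
rewrite -EFin_expe -EFinM -EFinD lee_fin -subr_ge0.
rewrite (_ : _ - _ = (t * u - 1) ^+ 2 / (2 * t)); last by field; rewrite gt_eqF.
by rewrite divr_ge0 ?sqr_ge0// mulr_ge0// ltW.
Qed.

Lemma integral_le1 (R : realType) d (T : measurableType d) (mu : {measure set T -> \bar R})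
    (A : set T) (G : T -> \bar R) : measurable A -> (mu A < +oo)%E ->
  measurable_fun setT G -> (forall x, (0 <= G x)%E) ->
  {ae mu, forall x, ~ A x -> G x = 0%E} ->
  (\int[mu]_x (G x ^+ 2) <= (mu A)^-1)%E -> (\int[mu]_x G x <= 1)%E.
Proof.
move=> mA Aoo mG G0 GA G2.
(* For a null [A] the bound on [G ^+ 2] is empty, the inverse of 0 being infinite; but then [G]
   vanishes almost everywhere. *)
have [A0|A0] := eqVneq (mu A) 0%E.
  suff -> : (\int[mu]_x G x = 0)%E by rewrite lee_fin.
  rewrite (ae_eq_integral (cst 0%E))//; first by rewrite integral0.
  have nA : {ae mu, forall x, ~ A x} by exists A; split => // x /= /contrapT.
  by apply: filterS2 GA nA => x h1 h2 _; exact: h1.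
pose t := fine (mu A).
have At : mu A = t%:E by rewrite /t fineK// ge0_fin_numE.
have t0 : 0 < t by rewrite -lte_fin -At lt0e A0 measure_ge0.
apply: (@le_trans _ _ (\int[mu]_x ((t / 2)%:E * G x ^+ 2 + (2 * t)^-1%:E * (\1_A x)%:E))%E).
  apply: ae_ge0_le_integral => //.
  - by move=> x _; rewrite adde_ge0// mule_ge0// ?expe_ge0// lee_fin ?divr_ge0 ?invr_ge0 ?mulr_ge0// ltW.
  - apply: emeasurable_funD; apply: measurable_funeM.
      by under eq_fun do rewrite expe2; exact: emeasurable_funM.
    by apply/measurable_EFinP; exact: measurable_indic.
  apply: filterS GA => x GA _.
  have [Ax|nAx] := pselect (A x); first by rewrite indicE mem_set// mule1; exact: amgm_inv.
  by rewrite GA// indicE memNset// expe2 !mule0 adde0.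
have mG2 : measurable_fun setT (fun x => G x ^+ 2)%E.
  by under eq_fun do rewrite expe2; exact: emeasurable_funM.
have mA1 : measurable_fun setT (fun x => (\1_A x : R)%:E).
  by apply/measurable_EFinP; exact: measurable_indic.
have c1 : (0 <= (t / 2)%:E)%E by rewrite lee_fin divr_ge0// ltW.
have c2 : (0 <= ((2 * t)^-1)%:E)%E by rewrite lee_fin invr_ge0 mulr_ge0// ltW.
have G20 x : (0 <= G x ^+ 2)%E by rewrite expe2 mule_ge0.
rewrite ge0_integralD//; last 4 first.
- by move=> x _; exact: mule_ge0.
- exact: measurable_funeM.
- by move=> x _; exact: mule_ge0.
- exact: measurable_funeM.
rewrite !ge0_integralZl// integral_indic// setIT.
apply: (@le_trans _ _ ((t / 2)%:E * (t^-1)%:E + (2 * t)^-1%:E * t%:E)%E).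
  rewrite At leeD2r//; apply: lee_wpmul2l => //; apply: le_trans G2 _.
  by rewrite At inver gt_eqF.
rewrite -!EFinM -EFinD lee_fin (_ : _ + _ = 1)//.
by field; rewrite gt_eqF.
Qed.

(** * The square function of an atom *)

Section SquareFunction.
Context {R : realType} {d1 d2 : measure_display}.
Context {X1 : measurableType d1} {X2 : measurableType d2}.
Variables (rho1 : X1 -> X1 -> R) (rho2 : X2 -> X2 -> R).
Variables (mu1 : {sigma_finite_measure set X1 -> \bar R}).
Variables (mu2 : {sigma_finite_measure set X2 -> \bar R}).
Hypotheses (hX1 : homogeneous_type rho1 mu1) (hX2 : homogeneous_type rho2 mu2).
Variables (delta1 c1 C1 delta2 c2 C2 : R).
Variables (D1 : int -> set (set X1)) (ctr1 : int -> set X1 -> X1).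
Variables (D2 : int -> set (set X2)) (ctr2 : int -> set X2 -> X2).
Hypotheses (hD1 : dyadic_system rho1 delta1 c1 C1 D1 ctr1)
  (hD2 : dyadic_system rho2 delta2 c2 C2 D2 ctr2).
Variables (ord1 : int -> set X1 -> seq (set X1)) (ord2 : int -> set X2 -> seq (set X2)).
Hypotheses (hord1 : haar_order mu1 D1 ord1) (hord2 : haar_order mu2 D2 ord2).

Local Notation mu := (mu1 \x mu2)%E.
Local Notation rect := ((int * set X1) * (int * set X2))%type.
Local Notation hidx := (rect * (nat * nat))%type.
Implicit Types (i j : hidx) (r : rect) (f g : X1 * X2 -> R).

Local Notation haar_idx := (haar_index D1 D2 ord1 ord2).
Local Notation hprod := (haar_prod mu1 mu2 ord1 ord2).
Local Notation coef := (hcoef mu1 mu2 ord1 ord2).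
Local Notation square_fun := (square_fun mu1 mu2 D1 D2 ord1 ord2).

Definition rect_mass r : R := fine (mu1 r.1.2) * fine (mu2 r.2.2).

(** The square of the product of the two [normalized_indic]. *)
Definition rect_weight r (x : X1 * X2) : R := \1_(rect_set r) x / rect_mass r.

Definition square_sum f x : \bar R := \esum_(i in haar_idx) (coef f i ^+ 2 * rect_weight i.1 x)%:E.

Lemma rect_mass_gt0 r : rects D1 D2 r -> 0 < rect_mass r.
Proof.
by move=> [h1 h2]; rewrite mulr_gt0 ?(cube_fine_gt0 hX1 hD1 h1) ?(cube_fine_gt0 hX2 hD2 h2).
Qed.

Lemma measure_rect r : rects D1 D2 r -> mu (rect_set r) = (rect_mass r)%:E.
Proof.
move=> [h1 h2]; rewrite product_measure1E; last 2 first.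
- exact: (cube_measurable hD1 h1).
- exact: (cube_measurable hD2 h2).
by rewrite EFinM !fineK ?(cube_fin_num hX1 hD1 h1) ?(cube_fin_num hX2 hD2 h2).
Qed.

Lemma haar_index_countable : countable haar_idx.
Proof. by apply: countableXR => [|r _]; [exact: (rects_countable hD1 hD2)|exact: countableP]. Qed.

Lemma haar_index_rects i : haar_idx i -> rects D1 D2 i.1. Proof. by case. Qed.

Lemma rect_weight_ge0 r x : rects D1 D2 r -> 0 <= rect_weight r x.
Proof. by move=> hr; rewrite divr_ge0// ltW// rect_mass_gt0. Qed.

Lemma rect_weight_measurable r : rects D1 D2 r -> measurable_fun setT (rect_weight r).
Proof.
move=> hr; apply: measurable_funM => //; apply: measurable_indic.
exact: (rect_set_measurable hD1 hD2 hr).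
Qed.

Lemma square_sum_ge0 f x : (0 <= square_sum f x)%E.
Proof. by apply: esum_ge0 => i [hi _]; rewrite lee_fin mulr_ge0 ?sqr_ge0 ?rect_weight_ge0. Qed.

Lemma square_sum_measurable f : measurable_fun setT (square_sum f).
Proof.
(* The tuple only inhabits the index type for [esum_nneseries]; it need not be a Haar index. *)
apply: (measurable_esum (((0, set0), (0, set0)), (0%N, 0%N)) haar_index_countable).
  by move=> i x [hi _]; rewrite lee_fin mulr_ge0 ?sqr_ge0 ?rect_weight_ge0.
by move=> i [hi _]; apply/measurable_EFinP; apply: measurable_funM => //; exact: rect_weight_measurable.
Qed.

Lemma rect_weight_integral r : rects D1 D2 r -> (\int[mu]_x (rect_weight r x)%:E = 1)%E.
Proof.
move=> hr; rewrite /rect_weight; under eq_integral do rewrite mulrC EFinM.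
rewrite ge0_integralZl//; last 2 first.
- by apply/measurable_EFinP/measurable_indic; exact: (rect_set_measurable hD1 hD2 hr).
- by rewrite lee_fin invr_ge0 ltW// rect_mass_gt0.
rewrite integral_indic//; last exact: (rect_set_measurable hD1 hD2 hr).
by rewrite setIT [X in (_ * X)%E](measure_rect hr) -EFinM mulVf// gt_eqF// rect_mass_gt0.
Qed.

(** Each weight integrates to 1, so the L^2 norm of the square function is the l^2 norm of the
    coefficients. *)
Lemma square_sum_integral f : (\int[mu]_x square_sum f x = \esum_(i in haar_idx) (coef f i ^+ 2)%:E)%E.
Proof.
rewrite (integral_esum mu (((0, set0), (0, set0)), (0%N, 0%N)) haar_index_countable).
- apply: eq_esum => i [hi _]; under eq_integral do rewrite EFinM.
  rewrite ge0_integralZl//.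
  + by rewrite rect_weight_integral// mule1.
  + by apply/measurable_EFinP; exact: rect_weight_measurable.
  + by move=> x _; rewrite lee_fin rect_weight_ge0.
  + by rewrite lee_fin sqr_ge0.
- by move=> i x [hi _]; rewrite lee_fin mulr_ge0 ?sqr_ge0 ?rect_weight_ge0.
- by move=> i [hi _]; apply/measurable_EFinP; apply: measurable_funM => //; exact: rect_weight_measurable.
Qed.

Lemma square_sum_bessel f : f \in Lfun mu 2%:E ->
  (\int[mu]_x square_sum f x <= \int[mu]_x (f x ^+ 2)%:E)%E.
Proof.
move=> f2; rewrite square_sum_integral; apply: esum_le_seq => s us sI.
by rewrite sumEFin; exact: (bessel hX1 hX2 hD1 hD2 hord1 hord2 us sI f2).
Qed.

Lemma square_funE f x : square_fun f x = ((square_sum f x) `^ 2^-1)%E.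
Proof.
rewrite /Defs.square_fun; congr (_ `^ _)%E.
transitivity (\esum_(k in rects D1 D2 `*`` haar_range ord1 ord2)
    (coef f (k.1, k.2) ^+ 2 * rect_weight k.1 x)%:E); last by [].
rewrite -(@esum_esum _ _ _ _ _ (fun r p => (coef f (r, p) ^+ 2 * rect_weight r x)%:E)); last first.
  by move=> r p hr _; rewrite lee_fin mulr_ge0 ?sqr_ge0 ?rect_weight_ge0.
apply: eq_esum => r hr.
have cE v1 v2 : `|haar_coef mu1 mu2 ord1 ord2 f r v1 v2 * normalized_indic mu1 r.1.2 x.1
    * normalized_indic mu2 r.2.2 x.2| ^+ 2 = coef f (r, (v1, v2)) ^+ 2 * rect_weight r x.
  rewrite real_normK ?num_real// /normalized_indic /rect_weight /rect_mass /rect_set !indicE.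
  rewrite -[haar_coef _ _ _ _ _ _ _ _]/(coef f (r, (v1, v2))).
  rewrite !exprMn !exprVn /sqrt_meas !sqr_sqrtr ?fine_ge0//.
  rewrite in_setX invfM.
  move: (coef _ _) => c; case: (_ \in _) => /=; case: (_ \in _) => /=; rewrite ?expr1n ?expr0n /=; ring.
rewrite /haar_range -(@esum_esum _ _ _ _ (fun=> _) (fun a b => (coef f (r, (a, b)) ^+ 2 * rect_weight r x)%:E)); last first.
  by move=> a b _ _; rewrite lee_fin mulr_ge0 ?sqr_ge0 ?rect_weight_ge0.
rewrite esum_fset//; last first.
  by move=> a _; apply: esum_ge0 => b _; rewrite lee_fin mulr_ge0 ?sqr_ge0 ?rect_weight_ge0.
rewrite -fsbig_ord; apply: eq_bigr => a _.
rewrite esum_fset//; last first.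
  by move=> b _; rewrite lee_fin mulr_ge0 ?sqr_ge0 ?rect_weight_ge0.
by rewrite -fsbig_ord; apply: eq_bigr => b _; rewrite cE.
Qed.

Lemma square_fun_ge0 f x : (0 <= square_fun f x)%E.
Proof. exact: poweR_ge0. Qed.

Lemma square_fun_measurable f : measurable_fun setT (square_fun f).
Proof.
rewrite (_ : square_fun f = fun x => ((square_sum f x) `^ 2^-1)%E); last first.
  by apply/funext => x; exact: square_funE.
by apply: (measurableT_comp (measurable_poweR _)); exact: square_sum_measurable.
Qed.

Lemma square_fun_sqr f x : (square_fun f x ^+ 2 = square_sum f x)%E.
Proof. by rewrite square_funE sqre_poweR// square_sum_ge0. Qed.

Lemma hardy_normE f : hardy_norm mu1 mu2 D1 D2 ord1 ord2 f = (\int[mu]_x square_fun f x)%E.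
Proof.
by rewrite /hardy_norm Lnorm1; apply: eq_integral => x _; rewrite gee0_abs// square_fun_ge0.
Qed.

Lemma rect_atom_integrable r b : rects D1 D2 r -> rect_atom mu1 mu2 r b ->
  mu.-integrable setT (EFin \o b).
Proof.
move=> hr ba; apply: (Lfun2_supp_integrable (ra_L2 ba) (rect_set_measurable hD1 hD2 hr)) (ra_supp ba).
by rewrite [X in (X < _)%E](measure_rect hr) ltry.
Qed.

(** If the Haar rectangle sticks out of [r], it does so in one side, and by [haar_cst_or] the Haar
    factor of that variable is constant on the side of [r]. Integrating first in that variable gives
    0 by the cancellation of [b]. *)
Lemma rect_atom_coef r b i : rects D1 D2 r -> rect_atom mu1 mu2 r b -> haar_idx i ->
  coef b i <> 0 -> rect_set i.1 `<=` rect_set r.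
Proof.
move=> hr ba hi; have bi := rect_atom_integrable hr ba.
have mb : measurable_fun setT b by apply/measurable_EFinP; exact: measurable_int bi.
have [[h1 h2] [v1 v2]] := hi; have [r1 r2] := hr.
apply: contra_notP => nsub.
have [n1|n2] : ~ i.1.1.2 `<=` r.1.2 \/ ~ i.1.2.2 `<=` r.2.2.
  apply: contrapT => /not_orP[/contrapT s1 /contrapT s2]; apply: nsub => x [x1 x2].
  by split; [exact: s1|exact: s2].
- have [c hc] := haar_cst_or hD1 hord1 h1 r1 v1 n1.
  pose h x := haar mu2 (ord2 i.1.2.1 i.1.2.2) i.2.2 x.
  have mh : measurable_fun setT h := haar_measurable hD2 hord2 h2 v2.
  have [M hM] := haar_bounded mu2 ord2 i.1.2.1 i.1.2.2 i.2.2.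
  have bhi : mu.-integrable setT (EFin \o (fun x => b x * (c * h x.2))).
    apply: (@integrable_mul_bounded _ _ _ _ _ _ (`|c| * M) bi).
      by apply: measurable_funM => //; apply: (measurableT_comp mh); exact: measurable_snd.
    by move=> x; rewrite normrM ler_wpM2l.
  (* Putting the constant [c] also outside [r] changes nothing: [b] vanishes there almost
     everywhere. *)
  rewrite /hcoef /Rintegral (ae_eq_integral (EFin \o (fun x => b x * (c * h x.2))))//; last 3 first.
  + by apply/measurable_EFinP/measurable_funM => //; exact: (haar_prod_measurable hD1 hD2 hord1 hord2 hi).
  + exact: (measurable_int _ bhi).
  + apply: filterS (ra_supp ba) => x hx _ /=.
    have [rx|nrx] := pselect (rect_set r x); last by rewrite hx// !mul0r.
    by rewrite /haar_prod hc//; case: rx.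
  rewrite -integral21_prod_meas1// (ae_eq_integral (cst 0%E)) ?integral0//.
    exact: (measurable_fubini_G bhi).
  apply: filterS2 (ra_cancel1 ba) (ae_integrable2 bi) => y hy iy _.
  rewrite /fubini_G /=; under eq_integral do rewrite EFinM.
  by rewrite integralZr//= hy mul0e.
- have [c hc] := haar_cst_or hD2 hord2 h2 r2 v2 n2.
  pose h x := haar mu1 (ord1 i.1.1.1 i.1.1.2) i.2.1 x.
  have mh : measurable_fun setT h := haar_measurable hD1 hord1 h1 v1.
  have [M hM] := haar_bounded mu1 ord1 i.1.1.1 i.1.1.2 i.2.1.
  have bhi : mu.-integrable setT (EFin \o (fun x => b x * (c * h x.1))).
    apply: (@integrable_mul_bounded _ _ _ _ _ _ (`|c| * M) bi).
      by apply: measurable_funM => //; apply: (measurableT_comp mh); exact: measurable_fst.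
    by move=> x; rewrite normrM ler_wpM2l.
  rewrite /hcoef /Rintegral (ae_eq_integral (EFin \o (fun x => b x * (c * h x.1))))//; last 3 first.
  + by apply/measurable_EFinP/measurable_funM => //; exact: (haar_prod_measurable hD1 hD2 hord1 hord2 hi).
  + exact: (measurable_int _ bhi).
  + apply: filterS (ra_supp ba) => x hx _ /=.
    have [rx|nrx] := pselect (rect_set r x); last by rewrite hx// !mul0r.
    by rewrite /haar_prod hc; [rewrite [c * _]mulrC|case: rx].
  rewrite -integral12_prod_meas1// (ae_eq_integral (cst 0%E)) ?integral0//.
    exact: (measurable_fubini_F bhi).
  apply: filterS2 (ra_cancel2 ba) (ae_integrable1 bi) => y hy iy _.
  rewrite /fubini_F /=; under eq_integral do rewrite EFinM.
  by rewrite integralZr//= hy mul0e.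
Qed.

Local Notation atom := (dyadic_atom rho1 rho2 mu1 mu2 D1 D2).

Lemma atom_integrable a : atom a -> mu.-integrable setT (EFin \o a).
Proof.
by move=> [Om [[_ mO Ooo] sa [a2 _] _]]; exact: (Lfun2_supp_integrable a2 mO Ooo sa).
Qed.

(* Cauchy-Schwarz against [haar_prod i], which has norm 1, in AM-GM form. *)
Lemma coef_le_L2 f i (e : R) : haar_idx i -> f \in Lfun mu 2%:E -> 0 < e ->
  ('N[mu]_2%:E[EFin \o f] <= e%:E)%E -> `|coef f i| <= e.
Proof.
move=> hi f2 e0 Nf; have := @bessel _ _ _ _ _ _ _ _ _ hX1 hX2 _ _ _ _ _ _ _ _ _ _ hD1 hD2 _ _ hord1 hord2 f [:: i].
rewrite big_seq1 => /(_ isT); have sI : {in [:: i], forall i, haar_idx i}.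
  by move=> j; rewrite inE => /eqP ->.
move=> /(_ sI f2) h; rewrite -ler_sqr ?nnegrE// ?(ltW e0)// real_normK ?num_real//.
rewrite -lee_fin; apply: le_trans h _; rewrite -Lnorm2_sqr EFin_expe !expe2.
by apply: lee_pmul => //; exact: Lnorm_ge0.
Qed.

(** By [rect_atom_coef] the pieces [b r] have coefficient 0 at a rectangle not inside [Om], and so
    have their finite sums; these approximate [a] in L^2, where coefficients are continuous. *)
Lemma atom_coef a Om b i : mu.-integrable setT (EFin \o a) -> a \in Lfun mu 2%:E ->
  (forall r, max_rects D1 D2 Om r -> rect_atom mu1 mu2 r (b r)) ->
  L2_sum mu1 mu2 (max_rects D1 D2 Om) b a ->
  haar_idx i -> coef a i <> 0 -> rect_set i.1 `<=` Om.
Proof.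
move=> ai a2 hb hs hi; apply: contra_notP => nsub.
have b0 r : max_rects D1 D2 Om r -> coef (b r) i = 0.
  move=> hr; apply: contrapT => c0; apply: nsub.
  have [hr1 hr2 _] := hr.
  exact: (subset_trans (rect_atom_coef hr1 (hb r hr) hi c0)).
apply/eqP; rewrite -normr_eq0; apply/eqP/le_anti; rewrite normr_ge0 andbT.
apply/ler_addgt0Pl => e e0; rewrite addr0.
have [F0 [fF F0I hF]] := hs e e0.
have := hF F0 fF (@subset_refl _ _) F0I.
set g := fun x => _.
have Fi k : k \in fset_set F0 -> max_rects D1 D2 Om k.
  by rewrite in_fset_set// in_setE => /F0I.
have gE x : g x = (a x - \sum_(r <- fset_set F0 | r \in fset_set F0) b r x)%:E.
  by rewrite /g fsbig_finite//= big_seq.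
have g2 : (fun x => a x - \sum_(r <- fset_set F0 | r \in fset_set F0) b r x) \in Lfun mu 2%:E.
  by apply: Lfun2B_sum => // r /Fi hr; exact: (ra_L2 (hb r hr)).
rewrite (eq_Lnorm _ _ gE) => Ng.
have := coef_le_L2 hi g2 e0 Ng; rewrite (coefB hD1 hD2 hord1 hord2)//; last first.
  have [] := @Rintegral_sum _ _ _ mu _ (fset_set F0) (fun r => r \in fset_set F0) b => // r /Fi hr.
  by have [hr1 _ _] := hr; exact: (rect_atom_integrable hr1 (hb r hr)).
rewrite (coef_sum hD1 hD2 hord1 hord2)//; last first.
  move=> r /Fi hr; have [hr1 _ _] := hr; exact: (rect_atom_integrable hr1 (hb r hr)).
by rewrite big1 ?subr0// => r /Fi /b0.
Qed.

Lemma atom_L2 a Om : measurable Om -> (mu Om < +oo)%E ->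
  ('N[mu]_2%:E[EFin \o a] <= (mu Om `^ 2^-1)^-1)%E ->
  (\int[mu]_x (a x ^+ 2)%:E <= (mu Om)^-1)%E.
Proof.
move=> mO Ooo Na; rewrite -Lnorm2_sqr.
have [Om0|Om0] := eqVneq (mu Om) 0%E; first by rewrite Om0 inve0 leey.
have Ofin : mu Om \is a fin_num by rewrite ge0_fin_numE.
have t0 : 0 < fine (mu Om) by rewrite fine_gt0// lt0e Om0 measure_ge0.
move: Na; rewrite -(fineK Ofin) poweR_EFin !inver !gt_eqF// ?powR_gt0// => Na.
rewrite expe2; apply: (le_trans (lee_pmul _ _ Na Na)); [exact: Lnorm_ge0..|].
by rewrite powR12_sqrt ?(ltW t0)// -EFinM lee_fin -invfM -expr2 sqr_sqrtr// ltW.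
Qed.

Lemma atom_integral_le1 a : atom a -> (\int[mu]_x `|(a x)%:E| <= 1)%E.
Proof.
move=> aa; have ai := atom_integrable aa.
have [Om [[_ mO Ooo] sa [a2 Na] _]] := aa.
apply: (integral_le1 mO Ooo).
- by apply: measurableT_comp => //; exact: (measurable_int _ ai).
- by [].
- by apply: filterS sa => x sx /sx ->; rewrite abse0.
- under eq_integral do rewrite abse_EFin -EFin_expe real_normK ?num_real//.
  exact: atom_L2.
Qed.

Lemma atom_square_fun a : atom a -> (\int[mu]_x square_fun a x <= 1)%E.
Proof.
move=> aa; have ai := atom_integrable aa.
have [Om [[_ mO Ooo] sa [a2 Na] [b [hb hs _]]]] := aa.
apply: (integral_le1 mO Ooo).
- exact: square_fun_measurable.
- exact: square_fun_ge0.
- apply/aeW => x nOx; rewrite square_funE (_ : square_sum a x = 0%E) ?poweR0r// ?invr_eq0//.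
  apply: esum1 => i hi; have [->|/eqP c0] := eqVneq (coef a i) 0.
    by rewrite expr0n mul0r.
  rewrite /rect_weight indicE memNset ?mul0r ?mulr0// => ix; apply: nOx.
  exact: (atom_coef ai a2 hb hs hi c0).
- under eq_integral do rewrite square_fun_sqr.
  by apply: le_trans (square_sum_bessel a2) _; exact: atom_L2.
Qed.

End SquareFunction.

(** * Series of atoms *)

Lemma sum_fin_nat (R : realType) (u : nat -> R) n :
  (\sum_(0 <= k < n) (u k)%:E = (\sum_(k < n) u k)%:E)%E.
Proof. by rewrite sumEFin big_mkord. Qed.

(** Completeness of L^1 with an explicit limit: the sum of the positive parts minus the sum of the
    negative parts, with the tails of the series of absolute values as error bound. *)
Lemma L1_series_ex (R : realType) d (T : measurableType d) (mu : {measure set T -> \bar R})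
    (u : nat -> T -> R) :
  (forall k, measurable_fun setT (u k)) ->
  (\sum_(0 <= k <oo) \int[mu]_x `|(u k x)%:E| < +oo)%E ->
  exists f : T -> R, mu.-integrable setT (EFin \o f) /\
    ((fun n => \int[mu]_x `|(f x - \sum_(k < n) u k x)%:E|) @ \oo --> 0)%E.
Proof.
move=> mu_ ufin.
pose p k x : R := Num.max (u k x) 0; pose m k x : R := Num.max (- u k x) 0.
have p0 k x : 0 <= p k x by rewrite le_max lexx orbT.
have m0 k x : 0 <= m k x by rewrite le_max lexx orbT.
have pm k x : u k x = p k x - m k x by rewrite /p /m; case: leP => h; case: leP => h'; lra.
have apm k x : `|u k x| = p k x + m k x.
  rewrite /p /m; have [h|h] := leP (u k x) 0; have [h'|h'] := leP (- u k x) 0;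
    rewrite ?(ler0_norm h) ?(gtr0_norm h); lra.
pose P x := (\sum_(0 <= k <oo) (p k x)%:E)%E.
pose N x := (\sum_(0 <= k <oo) (m k x)%:E)%E.
pose tl n x := (\sum_(n <= k <oo) `|(u k x)%:E|)%E.
have mp k : measurable_fun setT (p k) by apply: measurable_maxr.
have mm k : measurable_fun setT (m k).
  by apply: measurable_maxr => //; exact: measurableT_comp.
have mP : measurable_fun setT P.
  apply: (@ge0_emeasurable_sum _ _ _ setT (fun k x => (p k x)%:E) xpredT).
    by move=> k x _ _; rewrite lee_fin.
  by move=> k _; exact/measurable_EFinP.
have mN : measurable_fun setT N.
  apply: (@ge0_emeasurable_sum _ _ _ setT (fun k x => (m k x)%:E) xpredT).
    by move=> k x _ _; rewrite lee_fin.
  by move=> k _; exact/measurable_EFinP.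
have mau k : measurable_fun setT (fun x => `|(u k x)%:E|%E).
  by apply: measurableT_comp => //; exact/measurable_EFinP.
have mtl n : measurable_fun setT (tl n).
  rewrite (_ : tl n = fun x => (\sum_(0 <= k <oo) `|(u (k + n) x)%:E|)%E); last first.
    by apply/funext => x; rewrite /tl -(nneseries_addn n (f := fun k => `|(u k x)%:E|%E)).
  apply: (@ge0_emeasurable_sum _ _ _ setT (fun k x => `|(u (k + n)%N x)%:E|%E) xpredT) => //.
have itl n : (\int[mu]_x tl n x = \sum_(n <= k <oo) \int[mu]_x `|(u k x)%:E|)%E.
  rewrite -(nneseries_addn n (f := fun k => \int[mu]_x `|(u k x)%:E|)%E); last first.
    by move=> k; exact: integral_ge0.
  rewrite -integral_nneseries//; apply: eq_integral => x _.
  by rewrite /tl -(nneseries_addn n (f := fun k => `|(u k x)%:E|%E)).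
have tl0 : (\int[mu]_x tl 0%N x < +oo)%E by rewrite itl.
have tlae : {ae mu, forall x, tl 0%N x \is a fin_num}.
  have : mu.-integrable setT (tl 0%N).
    apply/integrableP; split; first exact: mtl.
    by under eq_integral do rewrite gee0_abs ?nneseries_ge0//.
  by move=> /integrable_ae => /(_ measurableT); apply: filterS => x /(_ I).
(* [fine] turns an infinite sum into 0, so [f] is real everywhere; this matters only on the null set
   where [tl 0] is infinite. *)
pose f x := fine (P x) - fine (N x).
have mf : measurable_fun setT f.
  by apply: measurable_funB; apply: measurableT_comp => //; exact: measurable_fine.
have key : {ae mu, forall x, forall n, (`|(f x - \sum_(k < n) u k x)%:E| <= tl n x)%E}.
  apply: filterS tlae => x tfin n.
  have split_tl : tl n x = (\sum_(n <= k <oo) (p k x)%:E + \sum_(n <= k <oo) (m k x)%:E)%E.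
    rewrite -nneseriesD; [|by move=> *; rewrite lee_fin..].
    by apply: eq_eseriesr => k _; rewrite /= apm EFinD.
  have Psplit : P x = ((\sum_(k < n) p k x)%:E + \sum_(n <= k <oo) (p k x)%:E)%E.
    by rewrite /P (@nneseries_split _ _ 0%N n) ?add0n ?sum_fin_nat// => k _; rewrite lee_fin.
  have Nsplit : N x = ((\sum_(k < n) m k x)%:E + \sum_(n <= k <oo) (m k x)%:E)%E.
    by rewrite /N (@nneseries_split _ _ 0%N n) ?add0n ?sum_fin_nat// => k _; rewrite lee_fin.
  have tP0 : (0 <= \sum_(n <= k <oo) (p k x)%:E)%E by apply: nneseries_ge0 => k _ _; rewrite lee_fin.
  have tN0 : (0 <= \sum_(n <= k <oo) (m k x)%:E)%E by apply: nneseries_ge0 => k _ _; rewrite lee_fin.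
  have tn : (tl n x < +oo)%E.
    apply: (@le_lt_trans _ _ (tl 0%N x)); last by rewrite ltey_eq tfin.
    by rewrite /tl [leRHS](@nneseries_split _ _ 0%N n)// add0n leeDr// sume_ge0.
  have fP : (\sum_(n <= k <oo) (p k x)%:E)%E \is a fin_num.
    by rewrite ge0_fin_numE//; apply: le_lt_trans tn; rewrite split_tl leeDl.
  have fN : (\sum_(n <= k <oo) (m k x)%:E)%E \is a fin_num.
    by rewrite ge0_fin_numE//; apply: le_lt_trans tn; rewrite split_tl leeDr.
  rewrite split_tl /f Psplit Nsplit !fineD//= -(fineK fP) -(fineK fN) -EFinD lee_fin /=.
  have -> : \sum_(k < n) u k x = \sum_(k < n) p k x - \sum_(k < n) m k x.
    by rewrite -sumrB; apply: eq_bigr => k _; exact: pm.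
  move: (\sum_(k < n) p k x) (\sum_(k < n) m k x) => a b.
  have := fine_ge0 tP0; have := fine_ge0 tN0; move: (fine _) (fine _) => c e c0 e0.
  rewrite (_ : _ - _ = c - e); last by ring.
  by rewrite ler_norml; apply/andP; split; lra.
have le n : (\int[mu]_x `|(f x - \sum_(k < n) u k x)%:E| <= \int[mu]_x tl n x)%E.
  apply: ae_ge0_le_integral => //.
  - apply: measurableT_comp => //; apply/measurable_EFinP/measurable_funB => //.
    exact: measurable_sum.
  - by move=> x _; exact: nneseries_ge0.
  - by apply: filterS key => x /(_ n).
exists f; split.
  apply/integrableP; split; first exact/measurable_EFinP.
  apply: le_lt_trans tl0; apply: le_trans (le 0%N).
  by under [leRHS]eq_integral do rewrite big_ord0 subr0.
have cv : ((fun n => \int[mu]_x tl n x) @ \oo --> 0)%E.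
  rewrite (_ : (fun n => _) = fun n => \sum_(n <= k <oo) \int[mu]_x `|(u k x)%:E|)%E; last first.
    by apply/funext => n; exact: itl.
  by apply: nneseries_tail_cvg => // k _; exact: integral_ge0.
apply: (squeeze_cvge _ (cvg_cst 0%E) cv); apply: nearW => n.
by rewrite le integral_ge0.
Qed.

(** Cauchy-Schwarz from a nonnegative quadratic form, evaluated at [t = sqrt B], [u = - sqrt A],
    where it equals [2 sqrt A sqrt B (sqrt A sqrt B - C)]. *)
Lemma quadratic_ge0_le (R : realType) (A B C : R) : 0 <= A -> 0 <= B ->
  (forall t u, 0 <= A * t ^+ 2 + 2 * C * (t * u) + B * u ^+ 2) ->
  C <= Num.sqrt A * Num.sqrt B.
Proof.
move=> A0 B0 h; have [C0|C0] := leP C 0.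
  by apply: le_trans C0 _; rewrite mulr_ge0 ?sqrtr_ge0.
have Ap : 0 < A.
  rewrite lt0r A0 andbT; apply/eqP => Ae.
  (* With [A = 0] the form is affine in [t], and this point makes it -1. *)
  have := h (- (B + 1) / (2 * C)) 1; rewrite Ae mul0r expr1n !mulr1 add0r.
  rewrite (_ : _ + _ = -1); last by field; rewrite gt_eqF.
  lra.
have Bp : 0 < B.
  rewrite lt0r B0 andbT; apply/eqP => Be.
  have := h 1 (- (A + 1) / (2 * C)); rewrite Be mul0r expr1n !mulr1 addr0 mul1r.
  rewrite (_ : _ + _ = -1); last by field; rewrite gt_eqF.
  lra.
have p0 : 0 < Num.sqrt A by rewrite sqrtr_gt0.
have q0 : 0 < Num.sqrt B by rewrite sqrtr_gt0.
have := h (Num.sqrt B) (- Num.sqrt A).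
move: (sqr_sqrtr A0) (sqr_sqrtr B0) p0 q0; move: (Num.sqrt A) (Num.sqrt B) => p q pA qB p0 q0.
rewrite -pA -qB (_ : _ + _ = 2 * (p * q) * (p * q - C)); last by ring.
by rewrite pmulr_rge0 ?mulr_gt0// subr_ge0.
Qed.

Lemma minkowski2 (R : realType) (I : Type) (s : seq I) (w x y : I -> R) :
  (forall i, 0 <= w i) ->
  Num.sqrt (\sum_(i <- s) (x i + y i) ^+ 2 * w i) <=
  Num.sqrt (\sum_(i <- s) x i ^+ 2 * w i) + Num.sqrt (\sum_(i <- s) y i ^+ 2 * w i).
Proof.
move=> w0.
have S0 (z : I -> R) : 0 <= \sum_(i <- s) z i ^+ 2 * w i.
  by apply: sumr_ge0 => i _; rewrite mulr_ge0 ?sqr_ge0.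
have ex (t u : R) : \sum_(i <- s) (t * x i + u * y i) ^+ 2 * w i =
  (\sum_(i <- s) x i ^+ 2 * w i) * t ^+ 2 + 2 * (\sum_(i <- s) x i * y i * w i) * (t * u)
  + (\sum_(i <- s) y i ^+ 2 * w i) * u ^+ 2.
  rewrite mulr_suml mulr_sumr mulr_suml mulr_suml -!big_split /=.
  by apply: eq_bigr => i _; ring.
have CS := quadratic_ge0_le (S0 x) (S0 y) (fun t u => eq_ind _ (fun z => 0 <= z) (S0 (fun i => t * x i + u * y i)) _ (ex t u)).
rewrite -ler_sqr ?nnegrE ?addr_ge0 ?sqrtr_ge0// sqr_sqrtr// sqrrD !sqr_sqrtr//.
have := ex 1 1; under eq_bigr do rewrite !mul1r; move=> ->.
by rewrite !expr1n !mulr1 lerD2r lerD2l mulr_natl lerMn2r.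
Qed.

Lemma minkowski_sum (R : realType) (I : Type) (s : seq I) (w : I -> R) (l : nat -> R) (c : nat -> I -> R) n :
  (forall i, 0 <= w i) ->
  Num.sqrt (\sum_(i <- s) (\sum_(k < n) l k * c k i) ^+ 2 * w i) <=
  \sum_(k < n) `|l k| * Num.sqrt (\sum_(i <- s) c k i ^+ 2 * w i).
Proof.
move=> w0; elim: n => [|n IH].
  rewrite big_ord0 big1 ?sqrtr0// => i _; by rewrite big_ord0 expr0n mul0r.
rewrite big_ord_recr /=; under eq_bigr do rewrite big_ord_recr /=.
apply: le_trans (minkowski2 _ _ _ w0) _; apply: lerD => //.
rewrite (eq_bigr (fun i => l n ^+ 2 * (c n i ^+ 2 * w i))); last by move=> i _; ring.
by rewrite -mulr_sumr sqrtrM ?sqr_ge0// sqrtr_sqr.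
Qed.

Lemma cvg_sqr_sum (R : realType) (I : eqType) (s : seq I) (w y : I -> R) (c : nat -> I -> R) :
  {in s, forall i, (fun n => c n i) @ \oo --> y i} ->
  (fun n => \sum_(i <- s) c n i ^+ 2 * w i) @ \oo --> \sum_(i <- s) y i ^+ 2 * w i.
Proof.
elim: s => [|i s IH] h.
  rewrite big_nil (_ : (fun n => _) = cst 0); first exact: cvg_cst.
  by apply/funext => n; rewrite big_nil.
rewrite big_cons (_ : (fun n => _) = (fun n => c n i ^+ 2 * w i + \sum_(i <- s) c n i ^+ 2 * w i)); last first.
  by apply/funext => n; rewrite big_cons.
apply: cvgD; last by apply: IH => j js; apply: h; rewrite inE js orbT.
apply: cvgM; last exact: cvg_cst.
have ci : (fun n => c n i) @ \oo --> y i by apply: h; rewrite mem_head.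
rewrite expr2 (_ : (fun n => _) = (fun n => c n i * c n i)); first exact: cvgM.
by apply/funext => n; rewrite expr2.
Qed.

Section Synthesis.
Context {R : realType} {d1 d2 : measure_display}.
Context {X1 : measurableType d1} {X2 : measurableType d2}.
Variables (rho1 : X1 -> X1 -> R) (rho2 : X2 -> X2 -> R).
Variables (mu1 : {sigma_finite_measure set X1 -> \bar R}).
Variables (mu2 : {sigma_finite_measure set X2 -> \bar R}).
Hypotheses (hX1 : homogeneous_type rho1 mu1) (hX2 : homogeneous_type rho2 mu2).
Variables (delta1 c1 C1 delta2 c2 C2 : R).
Variables (D1 : int -> set (set X1)) (ctr1 : int -> set X1 -> X1).
Variables (D2 : int -> set (set X2)) (ctr2 : int -> set X2 -> X2).
Hypotheses (hD1 : dyadic_system rho1 delta1 c1 C1 D1 ctr1)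
  (hD2 : dyadic_system rho2 delta2 c2 C2 D2 ctr2).
Variables (ord1 : int -> set X1 -> seq (set X1)) (ord2 : int -> set X2 -> seq (set X2)).
Hypotheses (hord1 : haar_order mu1 D1 ord1) (hord2 : haar_order mu2 D2 ord2).

Local Notation mu := (mu1 \x mu2)%E.
Local Notation rect := ((int * set X1) * (int * set X2))%type.
Local Notation hidx := (rect * (nat * nat))%type.
Implicit Types (i j : hidx) (r : rect) (f g : X1 * X2 -> R).

Local Notation haar_idx := (haar_index D1 D2 ord1 ord2).
Local Notation coef := (hcoef mu1 mu2 ord1 ord2).
Local Notation square_fun := (square_fun mu1 mu2 D1 D2 ord1 ord2).

Local Notation sqf := (square_sum mu1 mu2 D1 D2 ord1 ord2).
Local Notation atom := (dyadic_atom rho1 rho2 mu1 mu2 D1 D2).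

Lemma L1_seriesE lambda a f : L1_series mu1 mu2 lambda a f <->
  mu.-integrable setT (EFin \o f) /\
  ((fun n => \int[mu]_x `|(f x - \sum_(k < n) lambda k * a k x)%:E|) @ \oo --> 0)%E.
Proof.
rewrite /L1_series; split=> -[h1 h2]; (split; first exact/Lfun1_integrable).
  by move: h2; rewrite (_ : (fun n => 'N[mu]_1[_])%E =
    (fun n => \int[mu]_x `|(f x - \sum_(k < n) lambda k * a k x)%:E|)%E)//; apply/funext => n; rewrite Lnorm1.
by rewrite (_ : (fun n => 'N[mu]_1[_])%E =
    (fun n => \int[mu]_x `|(f x - \sum_(k < n) lambda k * a k x)%:E|)%E)//; apply/funext => n; rewrite Lnorm1.
Qed.

Lemma integrable_scale (c : R) f : mu.-integrable setT (EFin \o f) ->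
  mu.-integrable setT (EFin \o (fun x => c * f x)).
Proof.
move=> fi; rewrite (_ : EFin \o _ = fun x => (c%:E * (EFin \o f) x)%E)//.
exact: integrableZl.
Qed.

Lemma atom_series_ex (lambda : nat -> R) a : (forall k, atom (a k)) ->
  (\sum_(0 <= k <oo) `|lambda k|%:E < +oo)%E -> exists f, L1_series mu1 mu2 lambda a f.
Proof.
move=> aa lfin.
have ai k := atom_integrable (aa k).
have ma k : measurable_fun setT (a k).
  by apply/measurable_EFinP; exact: (measurable_int _ (ai k)).
have [f [fi cf]] : exists f : X1 * X2 -> R, mu.-integrable setT (EFin \o f) /\
    ((fun n => \int[mu]_x `|(f x - \sum_(k < n) lambda k * a k x)%:E|) @ \oo --> 0)%E.
  apply: (@L1_series_ex _ _ _ mu (fun k x => lambda k * a k x)).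
    by move=> k; exact: measurable_funM.
  apply: le_lt_trans lfin; apply: lee_nneseries => [k _ _|k _]; first exact: integral_ge0.
  under eq_integral do rewrite abse_EFin normrM EFinM.
  rewrite ge0_integralZl//; last by apply/measurable_EFinP; exact: measurableT_comp.
  rewrite -[leRHS]mule1; apply: lee_wpmul2l => //.
  by have := atom_integral_le1 (aa k).
by exists f; apply/L1_seriesE.
Qed.

Lemma L1_series_coef (lambda : nat -> R) a f i : (forall k, atom (a k)) ->
  L1_series mu1 mu2 lambda a f -> haar_idx i ->
  (fun n => \sum_(k < n) lambda k * coef (a k) i) @ \oo --> coef f i.
Proof.
move=> aa /L1_seriesE[fi cf] hi.
have ai k := atom_integrable (aa k).
have li k : mu.-integrable setT (EFin \o (fun x => lambda k * a k x)) := integrable_scale (lambda k) (ai k).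
have si n : mu.-integrable setT (EFin \o (fun x => \sum_(k < n) lambda k * a k x)).
  by have [] := @Rintegral_sum _ _ _ mu _ (index_enum 'I_n) xpredT (fun k x => lambda k * a k x) (fun k _ => li k).
have [M hM] := haar_prod_bounded mu1 mu2 ord1 ord2 i.
have le n : (`|(coef f i - \sum_(k < n) lambda k * coef (a k) i)%:E| <=
    M%:E * \int[mu]_x `|(f x - \sum_(k < n) lambda k * a k x)%:E|)%E.
  have -> : coef f i - \sum_(k < n) lambda k * coef (a k) i =
      coef (fun x => f x - \sum_(k < n) lambda k * a k x) i.
    rewrite (coefB hD1 hD2 hord1 hord2)// (coef_sum hD1 hD2 hord1 hord2)//.
    by congr (_ - _); apply: eq_bigr => k _; rewrite (coefZ hD1 hD2 hord1 hord2).
  apply: (coef_le hD1 hD2 hord1 hord2) => //.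
  rewrite (_ : EFin \o _ = (EFin \o f) \- (EFin \o (fun x => \sum_(k < n) lambda k * a k x)%R))%E//.
  exact: integrableB.
have cv : ((fun n => M%:E * \int[mu]_x `|(f x - \sum_(k < n) lambda k * a k x)%:E|) @ \oo --> 0)%E.
  rewrite -[X in _ --> X](mule0 M%:E); apply: cvgeZl => //.
have cv2 : ((fun n => `|(coef f i - \sum_(k < n) lambda k * coef (a k) i)%:E|) @ \oo --> 0)%E.
  by apply: (squeeze_cvge _ (cvg_cst 0%E) cv); apply: nearW => n; rewrite le andbT.
have /fine_cvg := cv2; rewrite (_ : fine \o _ = fun n => `|coef f i - \sum_(k < n) lambda k * coef (a k) i|)//.
move=> cv3; apply/cvgrPdist_lt => e e0; move/cvgrPdist_lt: cv3 => /(_ e e0).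
by apply: filterS => n; rewrite sub0r normrN normr_id.
Qed.

Lemma sqrt_le_square_fun f x (q : R) : (q%:E <= sqf f x)%E ->
  ((Num.sqrt q)%:E <= square_fun f x)%E.
Proof.
rewrite (square_funE hX1 hX2 hD1 hD2); have := square_sum_ge0 hX1 hX2 hD1 hD2 ord1 ord2 f x.
case: (sqf f x) => [r r0 qr|_ _|//]; last by rewrite poweRyr ?leey.
by rewrite poweR_EFin powR12_sqrt// lee_fin ler_wsqrtr.
Qed.

Lemma square_fun_le f x (b : R) : 0 <= b -> (sqf f x <= (b ^+ 2)%:E)%E ->
  (square_fun f x <= b%:E)%E.
Proof.
move=> b0; rewrite (square_funE hX1 hX2 hD1 hD2); have := square_sum_ge0 hX1 hX2 hD1 hD2 ord1 ord2 f x.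
case: (sqf f x) => [r r0 rb|//|//].
by rewrite poweR_EFin powR12_sqrt// lee_fin -(ger0_norm b0) -sqrtr_sqr ler_wsqrtr.
Qed.

(** The bound holds at every point, coefficients being plain numbers: on a finite set of Haar
    indices Minkowski's inequality bounds the partial sums of the series, convergence of the
    coefficients gives the limit, and the finite set is arbitrary. *)
Lemma series_square_fun (lambda : nat -> R) a f x : (forall k, atom (a k)) ->
  L1_series mu1 mu2 lambda a f ->
  (square_fun f x <= \sum_(0 <= k <oo) `|lambda k|%:E * square_fun (a k) x)%E.
Proof.
move=> aa hf; set B := (\sum_(0 <= k <oo) _)%E.
have S0 k : (0 <= square_fun (a k) x)%E by exact: poweR_ge0.
have t0 k : (0 <= `|lambda k|%:E * square_fun (a k) x)%E by rewrite mule_ge0.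
have B0 : (0 <= B)%E by apply: nneseries_ge0.
have [By|By] := eqVneq B +oo%E; first by rewrite By leey.
have Bfin : B \is a fin_num by rewrite ge0_fin_numE// ltey.
pose b := fine B; have b0 : 0 <= b by rewrite fine_ge0.
rewrite -(fineK Bfin); apply: square_fun_le => //.
apply: esum_le_seq => s us sI; rewrite sumEFin lee_fin.
pose w i := rect_weight mu1 mu2 i.1 x.
have w0 i : 0 <= w i by rewrite /w /rect_weight divr_ge0// mulr_ge0// fine_ge0.
have cv := @cvg_sqr_sum _ _ s w (coef f) (fun n i => \sum_(k < n) lambda k * coef (a k) i)
  (fun i si => L1_series_coef aa hf (sI i si)).
apply: (cvgr_to_le cv); apply: nearW => n.
rewrite -ler_sqrt ?exprn_ge0// sqrtr_sqr (ger0_norm b0).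
apply: le_trans (@minkowski_sum _ _ s w lambda (fun k i => coef (a k) i) n w0) _.
rewrite -lee_fin fineK// -sumEFin.
apply: (@le_trans _ _ (\sum_(0 <= k < n) `|lambda k|%:E * square_fun (a k) x)%E); last first.
  by apply: nneseries_lim_ge.
rewrite big_mkord; apply: lee_sum => k _; rewrite EFinM; apply: lee_wpmul2l => //.
apply: sqrt_le_square_fun; rewrite -sumEFin; apply: seq_le_esum => //.
by move=> i _; rewrite lee_fin mulr_ge0// sqr_ge0.
Qed.

Lemma series_hardy (lambda : nat -> R) a f : (forall k, atom (a k)) ->
  (\sum_(0 <= k <oo) `|lambda k|%:E < +oo)%E -> L1_series mu1 mu2 lambda a f ->
  hardy mu1 mu2 D1 D2 ord1 ord2 f /\
  (hardy_norm mu1 mu2 D1 D2 ord1 ord2 f <= \sum_(0 <= k <oo) `|lambda k|%:E)%E.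
Proof.
move=> aa lfin hf.
have mS g : measurable_fun setT (square_fun g) := square_fun_measurable hX1 hX2 hD1 hD2 ord1 ord2 g.
have S0 g x : (0 <= square_fun g x)%E by exact: poweR_ge0.
have le : (\int[mu]_x square_fun f x <= \sum_(0 <= k <oo) `|lambda k|%:E)%E.
  apply: (@le_trans _ _ (\int[mu]_x (\sum_(0 <= k <oo) `|lambda k|%:E * square_fun (a k) x))%E).
    apply: ge0_le_integral => //.
    - apply: (@ge0_emeasurable_sum _ _ _ setT (fun k x => (`|lambda k|%:E * square_fun (a k) x)%E) xpredT).
        by move=> k x _ _; rewrite mule_ge0.
      by move=> k _; exact: measurable_funeM.
    - by move=> x _; exact: series_square_fun.
  rewrite integral_nneseries//; last 2 first.
  - by move=> k; exact: measurable_funeM.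
  - by move=> k x _; rewrite mule_ge0.
  apply: lee_nneseries => [k _ _|k _].
    by apply: integral_ge0 => x _; rewrite mule_ge0.
  rewrite ge0_integralZl// -[leRHS]mule1; apply: lee_wpmul2l => //.
  exact: (atom_square_fun hX1 hX2 hD1 hD2 hord1 hord2 (aa k)).
split; last by rewrite hardy_normE.
split; first by have [] := hf.
apply/integrableP; split => //; apply: le_lt_trans lfin; apply: le_trans le.
by under eq_integral do rewrite gee0_abs//.
Qed.

End Synthesis.

(** * Open enlargements of families of rectangles *)

Section Enlargement.
Context {R : realType} {d1 d2 : measure_display}.
Context {X1 : measurableType d1} {X2 : measurableType d2}.
Variables (rho1 : X1 -> X1 -> R) (rho2 : X2 -> X2 -> R).
Variables (mu1 : {sigma_finite_measure set X1 -> \bar R}).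
Variables (mu2 : {sigma_finite_measure set X2 -> \bar R}).
Hypotheses (hX1 : homogeneous_type rho1 mu1) (hX2 : homogeneous_type rho2 mu2).
Variables (delta1 c1 C1 delta2 c2 C2 : R).
Variables (D1 : int -> set (set X1)) (ctr1 : int -> set X1 -> X1).
Variables (D2 : int -> set (set X2)) (ctr2 : int -> set X2 -> X2).
Hypotheses (hD1 : dyadic_system rho1 delta1 c1 C1 D1 ctr1)
  (hD2 : dyadic_system rho2 delta2 c2 C2 D2 ctr2).

Local Notation mu := (mu1 \x mu2)%E.
Local Notation rect := ((int * set X1) * (int * set X2))%type.
Implicit Types (r : rect).

Lemma measure_ysection (A : set (X1 * X2)) : measurable A ->
  (mu A = \int[mu2]_y mu1 (ysection A y))%E.
Proof.
move=> mA; rewrite (product_measure_unique (m' := (mu1 \x^ mu2)%E))// => B C mB mC.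
by rewrite /= product_measure2E.
Qed.

(** Outside [V] a slice of [Om] fills less than a quarter of the first side. Such slices contribute
    at most a quarter of the mass of [r], so the slices over [V] account for another quarter, and
    [V] fills at least a quarter of the second side. *)
Lemma rect_half (r : rect) (Om : set (X1 * X2)) : rects D1 D2 r -> measurable Om ->
  ((rect_mass mu1 mu2 r)%:E <= 2%:E * mu (Om `&` rect_set r))%E ->
  ((4^-1)%:E * mu2 r.2.2 <= mu2 ([set y | (4^-1)%:E * mu1 r.1.2 <= mu1 (ysection Om y `&` r.1.2)]%E `&` r.2.2))%E.
Proof.
move=> hr mO; have [h1 h2] := hr; set V := [set y | _].
have mR := rect_set_measurable hD1 hD2 hr.
have m1 := cube_measurable hD1 h1; have m2 := cube_measurable hD2 h2.
have p1 := cube_fine_gt0 hX1 hD1 h1; have p2 := cube_fine_gt0 hX2 hD2 h2.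
have f1 := cube_fin_num hX1 hD1 h1; have f2 := cube_fin_num hX2 hD2 h2.
have mphi : measurable_fun setT (fun y => mu1 (ysection Om y `&` r.1.2)).
  rewrite (_ : (fun y => _) = mu1 \o ysection (Om `&` (r.1.2 `*` setT))); last first.
    by apply/funext => y /=; congr (mu1 _); apply/seteqP; split=> x;
      rewrite ysectionI => -[h h']; split => //; [apply/ysectionP|move/ysectionP: h' => []].
  by apply: measurable_fun_ysection; apply: measurableI => //; exact: measurableX.
have mV : measurable V.
  rewrite -[V]setTI; apply: emeasurable_fun_le => //.
have mVr : measurable (V `&` r.2.2) by exact: measurableI.
have -> : mu (Om `&` rect_set r) = (\int[mu2]_y mu1 (ysection (Om `&` rect_set r) y))%E.
  by apply: measure_ysection; exact: measurableI.
move=> h.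
have bd : (\int[mu2]_y mu1 (ysection (Om `&` rect_set r) y) <=
   mu1 r.1.2 * mu2 (V `&` r.2.2) + ((4^-1)%:E * mu1 r.1.2) * mu2 r.2.2)%E.
  apply: (@le_trans _ _ (\int[mu2]_y (mu1 r.1.2 * (\1_(V `&` r.2.2) y)%:E + ((4^-1)%:E * mu1 r.1.2) * (\1_(r.2.2) y)%:E))%E).
    apply: ge0_le_integral => //.
    - by apply: measurable_fun_ysection; exact: measurableI.
    - apply: emeasurable_funD; rewrite -(fineK f1) -?EFinM; apply: measurable_funeM; apply/measurable_EFinP; exact: measurable_indic.
    move=> y _; rewrite ysectionI.
    have [r2y|nr2y] := pselect (r.2.2 y); last first.
      rewrite (_ : _ `&` _ = set0) ?measure0 ?adde_ge0 ?mule_ge0 ?lee_fin//.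
      by rewrite -subset0 => x [_ /ysectionP[_ /=]].
    have -> : ysection (rect_set r) y = r.1.2.
      by apply/seteqP; split=> x; [move/ysectionP => -[]|move=> ?; apply/ysectionP].
    rewrite !indicE (mem_set r2y) mule1.
    have mOy : measurable (ysection Om y) by exact: measurable_ysection.
    have [Vy|nVy] := pselect (V y).
      rewrite mem_set// mule1; apply: (@le_trans _ _ (mu1 r.1.2)); last by rewrite leeDl// mule_ge0// lee_fin.
      by apply: le_measure; rewrite ?inE//; exact: measurableI.
    rewrite memNset; last by case.
    by rewrite mule0 add0e ltW// ltNge; apply/negP.
  rewrite ge0_integralD//; last 4 first.
  - by move=> y _; rewrite mule_ge0// lee_fin.
  - by rewrite -(fineK f1); apply: measurable_funeM; apply/measurable_EFinP; exact: measurable_indic.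
  - by move=> y _; rewrite !mule_ge0// lee_fin.
  - by rewrite -(fineK f1) -EFinM; apply: measurable_funeM; apply/measurable_EFinP; exact: measurable_indic.
  have mi (A : set X2) : measurable A -> measurable_fun setT (fun y => (\1_A y : R)%:E).
    by move=> mA; apply/measurable_EFinP; exact: measurable_indic.
  have a1 : (0 <= (fine (mu1 r.1.2))%:E)%E by rewrite lee_fin ltW.
  have a2 : (0 <= (4^-1 * fine (mu1 r.1.2))%:E)%E by rewrite lee_fin mulr_ge0// ltW.
  rewrite -(fineK f1) -EFinM !ge0_integralZl//; do ?[exact: mi|by move=> y _; rewrite lee_fin].
  by rewrite !integral_indic// !setIT.
have fV : mu2 (V `&` r.2.2) \is a fin_num.
  rewrite ge0_fin_numE//; apply: le_lt_trans (cube_lty hX2 hD2 h2).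
  by apply: le_measure; rewrite ?inE//; exact: subIsetr.
have : ((rect_mass mu1 mu2 r)%:E <= 2%:E * (mu1 r.1.2 * mu2 (V `&` r.2.2) + ((4^-1)%:E * mu1 r.1.2) * mu2 r.2.2))%E.
  by apply: le_trans h _; apply: lee_wpmul2l.
suff key (x y z : \bar R) : x \is a fin_num -> y \is a fin_num -> z \is a fin_num ->
    0 < fine x -> ((fine x * fine y)%:E <= 2%:E * (x * z + (4^-1)%:E * x * y))%E ->
    ((4^-1)%:E * y <= z)%E.
  exact: key.
move: x y z => [a| |] [b| |] [c| |] //= _ _ _ a0 hh.
have {}hh : a * b <= 2 * (a * c + 4^-1 * a * b) := hh.
rewrite -EFinM lee_fin -(ler_pM2l a0); lra.
Qed.

Variables (H1 : int -> set X1 -> set X1) (H2 : int -> set X2 -> set X2) (K1 K2 : R).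
Hypotheses (K10 : 0 < K1) (K20 : 0 < K2).
Hypotheses (H1o : forall k Q, D1 k Q -> qopen rho1 (H1 k Q))
  (H2o : forall k Q, D2 k Q -> qopen rho2 (H2 k Q)).
Hypotheses (H1s : forall k Q, D1 k Q -> Q `<=` H1 k Q)
  (H2s : forall k Q, D2 k Q -> Q `<=` H2 k Q).
Hypotheses (H1mono : forall k l P Q, k <= l -> D1 k Q -> D1 l P -> P `<=` Q -> H1 l P `<=` H1 k Q)
  (H2mono : forall k l P Q, k <= l -> D2 k Q -> D2 l P -> P `<=` Q -> H2 l P `<=` H2 k Q).
Hypotheses (H1C : forall k Q, D1 k Q -> (mu1 (H1 k Q) <= K1%:E * mu1 Q)%E)
  (H2C : forall k Q, D2 k Q -> (mu2 (H2 k Q) <= K2%:E * mu2 Q)%E).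

Let H1m k Q : D1 k Q -> measurable (H1 k Q).
Proof. by move=> /H1o; exact: (qopen_measurable hX1). Qed.
Let H2m k Q : D2 k Q -> measurable (H2 k Q).
Proof. by move=> /H2o; exact: (qopen_measurable hX2). Qed.

Definition rect_hull r : set (X1 * X2) := H1 r.1.1 r.1.2 `*` H2 r.2.1 r.2.2.

Definition enlarge (B : set rect) := \bigcup_(r in B) rect_hull r.

Lemma sub_enlarge B r : B `<=` rects D1 D2 -> B r -> rect_set r `<=` enlarge B.
Proof.
move=> BD Br; have [h1 h2] := BD _ Br.
by move=> x [x1 x2]; exists r => //; split; [exact: (H1s h1)|exact: (H2s h2)].
Qed.

Lemma enlarge_measurable B : B `<=` rects D1 D2 -> measurable (enlarge B).
Proof.
move=> BD; apply: countable_bigcup_measurable.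
  by apply: sub_countable (rects_countable hD1 hD2); exact: subset_card_le.
by move=> r /BD[h1 h2]; apply: measurableX; [exact: H1m|exact: H2m].
Qed.

Lemma enlarge_open B : B `<=` rects D1 D2 -> qopen (prod_qm rho1 rho2) (enlarge B).
Proof.
move=> BD x [r Br [x1 x2]]; have [h1 h2] := BD _ Br.
have [e1 e10 s1] := H1o h1 x1; have [e2 e20 s2] := H2o h2 x2.
exists (Num.min e1 e2); first by rewrite lt_min e10.
move=> y; rewrite /qball/= /prod_qm gt_max !lt_min => /andP[/andP[y1 _] /andP[_ y2]].
by exists r => //; split; [exact: s1|exact: s2].
Qed.

(** The constant is [(4 * K1) * (4 * K2)]: [rect_half] turns the density one half of a rectangle
    into a density of one quarter in each variable, and [covering] with [c = 4^-1] is applied once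
    per variable. *)
Lemma enlarge_measure (Om : set (X1 * X2)) (B : set rect) : measurable Om ->
  B `<=` rects D1 D2 ->
  (forall r, B r -> ((rect_mass mu1 mu2 r)%:E <= 2%:E * mu (Om `&` rect_set r))%E) ->
  (mu (enlarge B) <= (16 * K1 * K2)%:E * mu Om)%E.
Proof.
move=> mO BD hB.
pose V (q : int * set X1) : set X2 := [set y | (4^-1)%:E * mu1 q.2 <= mu1 (ysection Om y `&` q.2)]%E.
have mV q : cubes D1 q -> measurable (V q).
  move=> Dq; have mq := cube_measurable hD1 Dq.
  rewrite -[V q]setTI; apply: emeasurable_fun_le => //.
  rewrite (_ : (fun y => _) = mu1 \o ysection (Om `&` (q.2 `*` setT))); last first.
    by apply/funext => y /=; congr (mu1 _); apply/seteqP; split=> x;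
      rewrite ysectionI => -[h h']; split => //; [apply/ysectionP|move/ysectionP: h' => []].
  by apply: measurable_fun_ysection; apply: measurableI => //; exact: measurableX.
(* [Om] enlarged in the first variable alone: the slice at [y] is the union of the hulls of the
   cubes that the slice of [Om] fills to a quarter. *)
pose Om' := \bigcup_(q in cubes D1) (H1 q.1 q.2 `*` V q).
have mO' : measurable Om'.
  apply: countable_bigcup_measurable; first exact: (cubes_countable hD1).
  by move=> q Dq; apply: measurableX; [exact: H1m|exact: mV].
have Om'1 : (mu Om' <= (4 * K1)%:E * mu Om)%E.
  rewrite !measure_ysection// -ge0_integralZl//; last 2 first.
  - exact: measurable_fun_ysection.
  - by rewrite lee_fin mulr_ge0// ltW.
  apply: ge0_le_integral => //.
  - exact: measurable_fun_ysection.
  - by apply: measurable_funeM; exact: measurable_fun_ysection.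
  move=> y _; pose F := [set q | cubes D1 q /\ V q y].
  have -> : ysection Om' y = \bigcup_(q in F) H1 q.1 q.2.
    apply/seteqP; split=> [x /ysectionP[q Dq [/= Hx Vy]]|x [q [Dq Vy] Hx]]; first by exists q.
    by apply/ysectionP; exists q.
  have := covering hD1 K10 H1m H1mono H1C (F := F) (E := ysection Om y) (c := 4^-1).
  rewrite invrK mulrC; apply => //; first exact: measurable_ysection.
have : (mu (enlarge B) <= (4 * K2)%:E * mu Om')%E.
  rewrite /product_measure1 -ge0_integralZl//; last 2 first.
  - exact: measurable_fun_xsection.
  - by rewrite lee_fin mulr_ge0// ltW.
  apply: ge0_le_integral => //.
  - by apply: measurable_fun_xsection; exact: enlarge_measurable.
  - by apply: measurable_funeM; exact: measurable_fun_xsection.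
  move=> x _; pose F := [set q | cubes D2 q /\ ((4^-1)%:E * mu2 q.2 <= mu2 (xsection Om' x `&` q.2))%E].
  apply: (@le_trans _ _ (mu2 (\bigcup_(q in F) H2 q.1 q.2))).
    apply: le_measure; rewrite ?inE.
    - by apply: measurable_xsection; exact: enlarge_measurable.
    - apply: countable_bigcup_measurable.
        by apply: sub_countable (cubes_countable hD2); apply: subset_card_le => q [].
      by move=> q [Dq _]; exact: H2m.
    (* For [x] in the first side of the hull, [V r.1] lies in the slice of [Om'] at [x]; by
       [rect_half] that slice fills a quarter of the second side of [r], which therefore belongs to
       [F]. *)
    move=> y /xsectionP[r Br [/= Hx Hy]]; exists r.2 => //; have [h1 h2] := BD _ Br.
    split => //; apply: le_trans (rect_half (BD _ Br) mO (hB _ Br)) _.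
    apply: le_measure; rewrite ?inE.
    - by apply: measurableI; [exact: (mV r.1)|exact: (cube_measurable hD2 h2)].
    - by apply: measurableI; [exact: measurable_xsection|exact: (cube_measurable hD2 h2)].
    by apply: setSI => z Vz; apply/xsectionP; exists r.1.
  have := covering hD2 K20 H2m H2mono H2C (F := F) (E := xsection Om' x) (c := 4^-1).
  rewrite invrK mulrC; apply => //; exact: measurable_xsection.
move=> /le_trans; apply.
rewrite (_ : 16 * K1 * K2 = 4 * K2 * (4 * K1)); last by ring.
rewrite [(4 * K2 * (4 * K1))%:E]EFinM -muleA; apply: lee_wpmul2l => //.
by rewrite lee_fin mulr_ge0// ltW.
Qed.

(** The first side is enlarged as far as possible with the second one fixed, then the second with
    the new first side. A larger rectangle in [Om] competes at both stages, at the first one because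
    its second side contains that of [r]. The finite measure of [Om] bounds the masses for
    [cube_maximal]. *)
Lemma max_rect_above (Om : set (X1 * X2)) r : measurable Om -> (mu Om < +oo)%E ->
  rects D1 D2 r -> rect_set r `<=` Om ->
  exists r', max_rects D1 D2 Om r' /\ rect_set r `<=` rect_set r'.
Proof.
move=> mO Ooo hr rO; have [h1 h2] := hr.
have Ofin : mu Om \is a fin_num by rewrite ge0_fin_numE.
have bound k1 Q1 k2 Q2 : D1 k1 Q1 -> D2 k2 Q2 -> Q1 `*` Q2 `<=` Om ->
    fine (mu1 Q1) * fine (mu2 Q2) <= fine (mu Om).
  move=> g1 g2 sO; pose q : rect := ((k1, Q1), (k2, Q2)).
  rewrite -[leLHS]/(rect_mass mu1 mu2 q) -lee_fin fineK// -(measure_rect hX1 hX2 hD1 hD2)//.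
  have hq : rects D1 D2 q by split.
  have mq : measurable (rect_set q) := rect_set_measurable hD1 hD2 hq.
  by apply: le_measure; rewrite ?inE.
have [k1 [Q1 [DQ1 sQ1 pQ1 maxQ1]]] := @cube_maximal _ _ _ _ _ hX1 _ _ _ _ _ hD1
  (fun A => A `*` r.2.2 `<=` Om) (fine (mu Om) / fine (mu2 r.2.2)) r.1.1 r.1.2
  (fun l P DP pP => eq_ind_r (fun b : bool => b) (bound _ _ _ _ DP h2 pP) (ler_pdivlMr _ _ (cube_fine_gt0 hX2 hD2 h2))) h1 rO.
have [k2 [Q2 [DQ2 sQ2 pQ2 maxQ2]]] := @cube_maximal _ _ _ _ _ hX2 _ _ _ _ _ hD2
  (fun A => Q1 `*` A `<=` Om) (fine (mu Om) / fine (mu1 Q1)) r.2.1 r.2.2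
  (fun l P DP pP => eq_ind_r (fun b : bool => b) (eq_ind _ (fun z => z <= _) (bound _ _ _ _ DQ1 DP pP) _ (mulrC _ _)) (ler_pdivlMr _ _ (cube_fine_gt0 hX1 hD1 DQ1))) h2 pQ1.
exists ((k1, Q1), (k2, Q2)); split; last by move=> x [x1 x2]; split; [exact: sQ1|exact: sQ2].
split => //= -[[l1 P1] [l2 P2]] [/= DP1 DP2] PO; rewrite /rect_set /= => QP.
have [x1 Q1x] := cube_nonempty hD1 DQ1; have [x2 Q2x] := cube_nonempty hD2 DQ2.
have Q1P1 : Q1 `<=` P1 by move=> z Qz; have [] : (P1 `*` P2) (z, x2) by exact: QP.
have Q2P2 : Q2 `<=` P2 by move=> z Qz; have [] : (P1 `*` P2) (x1, z) by exact: QP.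
have e1 : P1 = Q1.
  apply: (maxQ1 _ _ DP1) => //; apply: subset_trans PO => z [z1 z2]; split => //.
  exact/Q2P2/sQ2.
have e2 : P2 = Q2.
  by apply: (maxQ2 _ _ DP2) => //; rewrite -e1.
by rewrite e1 e2.
Qed.

End Enlargement.

(** * Finite Haar sums as atoms *)

Lemma fiber_sum (V : nmodType) (I J : eqType) (S : seq J) (s : seq I) (t : I -> J) (z : I -> V) :
  uniq S ->
  \sum_(r <- S) \sum_(i <- s | t i == r) z i = \sum_(i <- s) (if t i \in S then z i else 0).
Proof.
move=> uS; under eq_bigr do rewrite big_mkcond.
rewrite exchange_big; apply: eq_bigr => i _ /=.
case: ifPn => [tS|tS]; last first.
  by rewrite big1_seq// => r /= rS; case: eqP => // e; rewrite e rS in tS.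
rewrite (bigD1_seq (t i))//= eqxx big1 ?addr0// => r; by rewrite eq_sym => /negbTE ->.
Qed.

(** A finite subfamily that nearly attains the supremum defining the sum has bounded indices; what
    lies beyond is at most the deficit. *)
Lemma finite_tail (R : realType) (T : choiceType) (A : set T) (f : T -> nat) (w : T -> R) (e : R) :
  {in A &, injective f} -> (forall i, A i -> 0 <= w i) ->
  (\esum_(i in A) (w i)%:E < +oo)%E -> 0 < e ->
  exists N, (\esum_(i in A `&` [set i | (N < f i)%N]) (w i)%:E <= e%:E)%E.
Proof.
move=> fI w0 wfin e0.
have S0 : (0 <= \esum_(i in A) (w i)%:E)%E by apply: esum_ge0 => i /w0; rewrite lee_fin.
have Sfin : \esum_(i in A) (w i)%:E \is a fin_num by rewrite ge0_fin_numE.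
have [_ [F [fF FA] <-] hF] := ub_ereal_sup_adherent e0 Sfin.
have [N hN] : exists N, forall i, F i -> (f i <= N)%N.
  have [s ->] := (finite_seqP _).1 fF; exists (\max_(i <- s) f i)%N => i /= si.
  exact: leq_bigmax_seq.
exists N; set A' := A `&` _.
have AA' : (\sum_(i \in F) (w i)%:E + \esum_(i in A') (w i)%:E <= \esum_(i in A) (w i)%:E)%E.
  rewrite (esumID [set i | (N < f i)%N] A); last by move=> i /w0; rewrite lee_fin.
  rewrite addeC; apply: leeD => //; rewrite -esum_fset//; last by move=> i; rewrite inE => /FA/w0; rewrite lee_fin.
  rewrite esum_mkcond [leRHS]esum_mkcond; apply: le_esum => i _.
  case: ifPn => [|_]; last by case: ifPn => //; rewrite inE => -[/w0]; rewrite lee_fin.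
  rewrite inE => Fi; rewrite ifT// inE; split; first exact: FA.
  by apply/negP; rewrite -leqNgt; exact: hN.
have Ffin : (\sum_(i \in F) (w i)%:E)%E \is a fin_num.
  rewrite ge0_fin_numE; last by apply: fsume_ge0 => i /FA/w0; rewrite lee_fin.
  by apply: le_lt_trans wfin; apply: ereal_sup_ubound; exists F.
rewrite -(leeD2lE _ _ Ffin); apply: le_trans AA' _.
by rewrite -leeBlDr//; exact: ltW.
Qed.

(* Enumerating [A], the block of [i] records the power of 4 comparable with the
   tail of the sum starting at [i]. *)
Lemma geometric_blocks (R : realType) (T : choiceType) (A : set T) (w : T -> R) (S : R) :
  countable A -> (forall i, A i -> 0 <= w i) -> 0 < S ->
  (\esum_(i in A) (w i)%:E <= S%:E)%E ->
  exists blk : T -> nat, forall j,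
    finite_set (A `&` [set i | (w i != 0)%R /\ blk i = j]) /\
    (\esum_(i in A `&` [set i | (w i != 0)%R /\ blk i = j]) (w i)%:E <= ((4^-1) ^+ j * S)%:E)%E.
Proof.
move=> /countable_injP[f fI] w0 S0 wS.
have wfin : (\esum_(i in A) (w i)%:E < +oo)%E by apply: le_lt_trans wS _; rewrite ltry.
pose t i := \esum_(j in A `&` [set j | (f i <= f j)%N]) (w j)%:E.
have tS i : (t i <= S%:E)%E.
  apply: le_trans wS; rewrite /t esum_mkcondr; apply: le_esum => j /w0 wj.
  by case: ifPn; rewrite lee_fin.
have tw i : A i -> ((w i)%:E <= t i)%E.
  move=> Ai; rewrite -(@esum_set1 _ _ i (fun i => (w i)%:E)) ?lee_fin ?w0//.
  rewrite /t esum_mkcond [leRHS]esum_mkcond; apply: le_esum => j _.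
  case: ifPn => [|_]; last by case: ifPn => //; rewrite inE => -[/w0]; rewrite lee_fin.
  by rewrite inE /= => ->; rewrite ifT// inE; split => /=.
have t0 i : (0 <= t i)%E by apply: esum_ge0 => j [/w0]; rewrite lee_fin.
have /choice[blk hblk] : forall i, exists j : nat, A i -> w i != 0 ->
    (((4^-1) ^+ j.+1 * S)%:E < t i)%E /\ (t i <= ((4^-1) ^+ j * S)%:E)%E.
  move=> i; have [[Ai wi]|nw] := pselect (A i /\ w i != 0); last first.
    by exists 0%N => Ai wi; case: nw.
  have wp : 0 < w i by rewrite lt0r wi w0.
  have ex : exists j, (((4^-1) ^+ j.+1 * S)%:E < t i)%E.
    have : `|(4^-1 : R)| < 1 by rewrite ger0_norm ?invf_lt1 ?invr_ge0//; lra.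
    move=> /cvg_expr /cvgrPdist_lt /(_ _ (divr_gt0 wp S0)) [N _ /(_ N.+1 (leqnSn N))] /=.
    rewrite sub0r normrN ger0_norm ?exprn_ge0 ?invr_ge0// ltr_pdivlMr// => h.
    by exists N; apply: lt_le_trans (tw i Ai); rewrite lte_fin.
  exists (ex_minn ex) => _ _; case: ex_minnP => j hj jmin; split => //.
  (* For [j = 0] the upper bound is [tS]; for a positive [j] it is the failure of the lower bound at
     its predecessor, by minimality. *)
  case: j hj jmin => [|j] hj jmin; first by rewrite expr0 mul1r.
  by rewrite leNgt; apply/negP => /jmin; rewrite ltnn.
exists blk => j; set B := A `&` _; split.
  have e0 : 0 < (4^-1) ^+ j.+1 * S by rewrite mulr_gt0 ?exprn_gt0 ?invr_gt0.
  (* Beyond [N] all tails are at most [(4^-1) ^+ j.+1 * S], so no element of block [j] has an index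
     there. *)
  have [N hN] := finite_tail fI w0 wfin e0.
  apply: (@sub_finite_set _ _ (A `&` [set i | (f i <= N)%N])).
    move=> i [Ai [wi bi]]; split => //=; rewrite leqNgt; apply/negP => Ni.
    have [+ _] := hblk i Ai wi; rewrite bi; apply/negP; rewrite -leNgt.
    apply: le_trans hN; rewrite /t esum_mkcondr [leRHS]esum_mkcondr; apply: le_esum => k /w0 wk.
    case: ifPn => [|_]; last by case: ifPn; rewrite lee_fin.
    rewrite inE /= => ik; rewrite ifT// inE /=; exact: leq_trans ik.
  exact: finite_sublevel_inj.
have [->|/set0P[i1 Bi1]] := eqVneq B set0.
  by rewrite esum_set0 lee_fin mulr_ge0 ?exprn_ge0 ?invr_ge0// ltW.
have ex : exists n, `[< exists2 i, B i & f i = n >] by exists (f i1); apply/asboolP; exists i1.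
(* The first element of the block bounds its energy: the tail starting there contains the whole
   block. *)
case: (ex_minnP ex) => n /asboolP[i0 Bi0 fi0] nmin.
have [Ai0 [wi0 bi0]] := Bi0.
have [_ h] := hblk _ Ai0 wi0; rewrite bi0 in h; apply: le_trans h.
rewrite /t esum_mkcond [leRHS]esum_mkcond; apply: le_esum => i _.
case: ifPn => [|_]; last by case: ifPn => //; rewrite inE => -[/w0]; rewrite lee_fin.
rewrite inE => Bi; rewrite ifT// inE; split; first by case: Bi.
by rewrite /= fi0; apply: nmin; apply/asboolP; exists i.
Qed.

Section FiniteAtoms.
Context {R : realType} {d1 d2 : measure_display}.
Context {X1 : measurableType d1} {X2 : measurableType d2}.
Variables (rho1 : X1 -> X1 -> R) (rho2 : X2 -> X2 -> R).
Variables (mu1 : {sigma_finite_measure set X1 -> \bar R}).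
Variables (mu2 : {sigma_finite_measure set X2 -> \bar R}).
Hypotheses (hX1 : homogeneous_type rho1 mu1) (hX2 : homogeneous_type rho2 mu2).
Variables (delta1 c1 C1 delta2 c2 C2 : R).
Variables (D1 : int -> set (set X1)) (ctr1 : int -> set X1 -> X1).
Variables (D2 : int -> set (set X2)) (ctr2 : int -> set X2 -> X2).
Hypotheses (hD1 : dyadic_system rho1 delta1 c1 C1 D1 ctr1)
  (hD2 : dyadic_system rho2 delta2 c2 C2 D2 ctr2).
Variables (ord1 : int -> set X1 -> seq (set X1)) (ord2 : int -> set X2 -> seq (set X2)).
Hypotheses (hord1 : haar_order mu1 D1 ord1) (hord2 : haar_order mu2 D2 ord2).

Local Notation mu := (mu1 \x mu2)%E.
Local Notation rect := ((int * set X1) * (int * set X2))%type.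
Local Notation hidx := (rect * (nat * nat))%type.
Implicit Types (i j : hidx) (r : rect) (f g : X1 * X2 -> R).

Local Notation haar_idx := (haar_index D1 D2 ord1 ord2).
Local Notation hprod := (haar_prod mu1 mu2 ord1 ord2).

Local Notation hcomb := (haar_comb mu1 mu2 ord1 ord2).

Lemma haar_comb_filter_sum (s : seq hidx) c (t : hidx -> rect) (S : seq rect) x : uniq S ->
  {in s, forall i, t i \in S} ->
  \sum_(r <- S) hcomb [seq i <- s | t i == r] c x = hcomb s c x.
Proof.
move=> uS tS; rewrite /haar_comb; under eq_bigr do rewrite big_filter.
rewrite fiber_sum// big_seq [RHS]big_seq; apply: eq_bigr => i si.
by rewrite tS.
Qed.

Lemma haar_comb_Lfun2 (s : seq hidx) c : uniq s -> {in s, forall i, haar_idx i} ->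
  hcomb s c \in Lfun mu 2%:E.
Proof.
move=> us sI; apply: Lfun2P; first exact: (haar_comb_measurable hX1 hX2 hD1 hD2 hord1 hord2).
by rewrite (haar_comb_sqr_integral hX1 hX2 hD1 hD2 hord1 hord2)// ltry.
Qed.

Lemma haar_comb_out (s : seq hidx) c (A : set (X1 * X2)) x : {in s, forall i, haar_idx i} ->
  {in s, forall i, rect_set i.1 `<=` A} -> ~ A x -> hcomb s c x = 0.
Proof.
move=> sI sA nA; rewrite /haar_comb big1_seq// => i /= si.
by rewrite (haar_prod_out hord1 hord2 (sI i si)) ?mulr0// => /(sA i si).
Qed.

Lemma haar_comb_rect_atom (s : seq hidx) c r : uniq s -> {in s, forall i, haar_idx i} ->
  {in s, forall i, rect_set i.1 `<=` rect_set r} -> rect_atom mu1 mu2 r (hcomb s c).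
Proof.
move=> us sI sr; split.
- exact: haar_comb_Lfun2.
- by apply/aeW => x; exact: haar_comb_out.
- apply/aeW => x2; rewrite /haar_comb.
  have gi i : i \in s -> mu1.-integrable setT (EFin \o (fun x1 => c i * hprod i (x1, x2))).
    move=> /sI[[h1 h2] [v1 v2]].
    rewrite (_ : EFin \o _ = fun x1 => ((c i * haar mu2 (ord2 i.1.2.1 i.1.2.2) i.2.2 x2)%:E * (EFin \o haar mu1 (ord1 i.1.1.1 i.1.1.2) i.2.1) x1)%E).
      by apply: integrableZl => //; exact: (haar_integrable hX1 hD1 hord1 h1 v1).
    by apply/funext => x1 /=; rewrite /haar_prod -EFinM; congr EFin; ring.
  have [h1 h2] := @Rintegral_sum _ _ _ mu1 _ s (mem s) (fun i x1 => c i * hprod i (x1, x2)) gi.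
  transitivity ((\int[mu1]_x1 (\sum_(i <- s | mem s i) c i * hprod i (x1, x2)))%:E).
    rewrite /Rintegral fineK; last exact: integrable_fin_num.
    by apply: eq_integral => x1 _; rewrite big_seq.
  rewrite h2 big1// => i /sI[[g1 g2] [v1 v2]].
  rewrite /Rintegral (eq_integral (fun x1 => ((c i * haar mu2 (ord2 i.1.2.1 i.1.2.2) i.2.2 x2)%:E * (haar mu1 (ord1 i.1.1.1 i.1.1.2) i.2.1 x1)%:E)%E)); last first.
    by move=> x1 _; rewrite /haar_prod -EFinM; congr EFin; ring.
  rewrite integralZl//; last exact: (haar_integrable hX1 hD1 hord1 g1 v1).
  by rewrite (haar_integral hX1 hD1 hord1 g1 v1) mule0.
- apply/aeW => x1; rewrite /haar_comb.
  have gi i : i \in s -> mu2.-integrable setT (EFin \o (fun x2 => c i * hprod i (x1, x2))).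
    move=> /sI[[h1 h2] [v1 v2]].
    rewrite (_ : EFin \o _ = fun x2 => ((c i * haar mu1 (ord1 i.1.1.1 i.1.1.2) i.2.1 x1)%:E * (EFin \o haar mu2 (ord2 i.1.2.1 i.1.2.2) i.2.2) x2)%E).
      by apply: integrableZl => //; exact: (haar_integrable hX2 hD2 hord2 h2 v2).
    by apply/funext => x2 /=; rewrite /haar_prod -EFinM; congr EFin; ring.
  have [h1 h2] := @Rintegral_sum _ _ _ mu2 _ s (mem s) (fun i x2 => c i * hprod i (x1, x2)) gi.
  transitivity ((\int[mu2]_x2 (\sum_(i <- s | mem s i) c i * hprod i (x1, x2)))%:E).
    rewrite /Rintegral fineK; last exact: integrable_fin_num.
    by apply: eq_integral => x2 _; rewrite big_seq.
  rewrite h2 big1// => i /sI[[g1 g2] [v1 v2]].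
  rewrite /Rintegral (eq_integral (fun x2 => ((c i * haar mu1 (ord1 i.1.1.1 i.1.1.2) i.2.1 x1)%:E * (haar mu2 (ord2 i.1.2.1 i.1.2.2) i.2.2 x2)%:E)%E)); last first.
    by move=> x2 _; rewrite /haar_prod -EFinM; congr EFin; ring.
  rewrite integralZl//; last exact: (haar_integrable hX2 hD2 hord2 g2 v2).
  by rewrite (haar_integral hX2 hD2 hord2 g2 v2) mule0.
Qed.

Lemma Lnorm2_le (f : X1 * X2 -> R) (A : \bar R) : (0 <= A)%E -> A \is a fin_num ->
  (\int[mu]_x (f x ^+ 2)%:E <= A^-1)%E -> ('N[mu]_2%:E[EFin \o f] <= (A `^ 2^-1)^-1)%E.
Proof.
case: A => [t t0 _|//|//]; rewrite -Lnorm2_sqr poweR_EFin powR12_sqrt//.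
rewrite !inver sqrtr_eq0; have [|t1] := leP t 0; first by rewrite leey.
rewrite gt_eqF//; have := Lnorm_ge0 mu 2%:E (EFin \o f).
case: ('N[mu]_2%:E[EFin \o f])%E => [n n0|_|//]; last by rewrite expe2 mulyy.
by rewrite -EFin_expe !lee_fin => h; rewrite -sqrtrV// -(ger0_norm n0) -sqrtr_sqr ler_wsqrtr.
Qed.

(** Each Haar term goes to one maximal rectangle [t i] above its own, and [b r] collects the terms
    sent to [r]. Finitely many rectangles occur, so the L^2 sum is exact once they are all included,
    and by orthonormality the squared norms of the pieces add up to at most the sum of
    [c i ^+ 2]. *)
Lemma finite_atom (Om : set (X1 * X2)) (s : seq hidx) c :
  qopen (prod_qm rho1 rho2) Om -> measurable Om -> (mu Om < +oo)%E ->
  uniq s -> {in s, forall i, haar_idx i} -> {in s, forall i, rect_set i.1 `<=` Om} ->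
  ((\sum_(i <- s) c i ^+ 2)%:E <= (mu Om)^-1)%E ->
  dyadic_atom rho1 rho2 mu1 mu2 D1 D2 (hcomb s c).
Proof.
move=> oO mO Ooo us sI sO cO.
have Ofin : mu Om \is a fin_num by rewrite ge0_fin_numE.
have /choice[t ht] : forall i, exists r, i \in s -> max_rects D1 D2 Om r /\ rect_set i.1 `<=` rect_set r.
  move=> i; have [si|nsi] := boolP (i \in s); last by exists i.1.
  have [r hr] := max_rect_above hX1 hX2 hD1 hD2 mO Ooo (haar_index_rects (sI i si)) (sO i si).
  by exists r.
pose b r := hcomb [seq i <- s | t i == r] c.
have uf r : uniq [seq i <- s | t i == r] by exact: filter_uniq.
have fI r : {in [seq i <- s | t i == r], forall i, haar_idx i}.
  by move=> i; rewrite mem_filter => /andP[_ /sI].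
exists Om; split => //.
- by apply/aeW => x; exact: haar_comb_out.
- split; first exact: haar_comb_Lfun2.
  by apply: Lnorm2_le => //; rewrite (haar_comb_sqr_integral hX1 hX2 hD1 hD2 hord1 hord2).
exists b; split.
- move=> r hr; apply: haar_comb_rect_atom => // i; rewrite mem_filter => /andP[/eqP <- si].
  by have [] := ht i si.
- move=> e e0; exists (t @` [set` s]); split.
  + by apply: finite_image; exact: finite_seq.
  + by move=> _ [i /= si <-]; have [] := ht i si.
  + move=> F fF F0F FI.
    rewrite (eq_Lnorm _ _ (g := cst 0%E)) ?Lnorm0 ?lee_fin ?(ltW e0)//.
    move=> x /=; rewrite fsbig_finite//= /b haar_comb_filter_sum ?subrr//.
    - exact: fset_uniq.
    - by move=> i si; rewrite in_fset_set// inE; apply: F0F; exists i.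
- apply: esum_le_seq => S uS SI; apply: le_trans cO.
  rewrite (eq_bigr (fun r => (\sum_(i <- [seq i <- s | t i == r]) c i ^+ 2)%:E)); last first.
    by move=> r _; rewrite Lnorm2_sqr (haar_comb_sqr_integral hX1 hX2 hD1 hD2 hord1 hord2).
  rewrite sumEFin lee_fin; under eq_bigr do rewrite big_filter.
  rewrite fiber_sum//; apply: ler_sum => i _; case: ifP => // _; exact: sqr_ge0.
Qed.

End FiniteAtoms.

(** * Uniqueness on spaces of infinite measure *)

Section Averages.
Context {R : realType} {d dT : measure_display} {X : measurableType d} {T : measurableType dT}.
Variables (rho : X -> X -> R) (mu : {measure set X -> \bar R}).
Hypothesis hX : homogeneous_type rho mu.
Variables (delta c1 C1 : R) (D : int -> set (set X)) (ctr : int -> set X -> X).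
Hypothesis hD : dyadic_system rho delta c1 C1 D ctr.
Variable ord : int -> set X -> seq (set X).
Hypothesis hord : haar_order mu D ord.
Variables (nu : {measure set T -> \bar R}) (w : T -> R) (p : T -> X).
Hypotheses (wi : nu.-integrable setT (EFin \o w)) (mp : measurable_fun setT p).

(** The measure [nu] lives on a space [T] mapped to [X] by [p], so that the argument can be run in
    one variable of the product with the other one carried along in the weight [w]. *)
Local Notation L A := (\int[nu]_x (w x * \1_A (p x))).

Let indic_mp (A : set X) : measurable A -> measurable_fun setT (fun x : T => \1_A (p x) : R).
Proof. by move=> mA; apply: (measurableT_comp (measurable_indic mA)). Qed.

Let L_integrable (A : set X) : measurable A ->
  nu.-integrable setT (EFin \o (fun x => w x * \1_A (p x))).
Proof.
move=> mA; apply: (integrable_mul_bounded wi (indic_mp mA) (M := 1)) => x.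
by rewrite indicE ger0_norm//; case: (_ \in _).
Qed.

Let L_additive (A B : set X) : measurable A -> measurable B -> A `&` B = set0 ->
  L (A `|` B) = L A + L B.
Proof.
move=> mA mB AB; rewrite -RintegralD//; try exact: L_integrable.
apply: eq_Rintegral => x _; rewrite -mulrDr; congr (_ * _).
rewrite !indicE in_setU; case: (boolP (p x \in A)) => pA; case: (boolP (p x \in B)) => pB /=; rewrite ?addr0 ?add0r//.
have h : (A `&` B) (p x) by split; rewrite -in_setE.
by rewrite AB in h.
Qed.

Let L_bounded (A : set X) : measurable A -> `|L A| <= \int[nu]_x `|w x|.
Proof.
move=> mA; apply: le_trans (le_normr_Rintegral _ (L_integrable mA)) _ => //.
apply: le_Rintegral => //.
- by rewrite (_ : EFin \o _ = abse \o (EFin \o (fun x => w x * \1_A (p x))))//; exact: integrable_abse (L_integrable mA).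
- by rewrite (_ : EFin \o _ = abse \o (EFin \o w))//; exact: integrable_abse.
- by move=> x _; rewrite normrM ler_piMr// indicE ger0_norm//; case: (_ \in _).
Qed.

Hypothesis w_haar : forall k Q v, D k Q -> (v < (size (ord k Q)).-1)%N ->
  \int[nu]_x (w x * haar mu (ord k Q) v (p x)) = 0.

Let L_child k Q P : D k Q -> children D k Q P -> L P * fine (mu Q) = L Q * fine (mu P).
Proof.
move=> DQ cP; apply: (haar_annihilator hX hD hord (L := fun A => L A) DQ) => //.
  by move=> A B mA mB AB _; exact: L_additive.
move=> v vn s; rewrite -/s in vn; apply/eqP; rewrite -subr_eq0; apply/eqP.
have vs : (v < size s)%N by apply: leq_trans vn _; exact: leq_pred.
have mP : measurable (nth set0 s v).
  by have [/(cube_measurable hD)] := haar_order_child hord DQ vs.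
have mT : measurable (tail_union s v.+1) by exact: (tail_union_measurable hD hord).
rewrite -!RintegralZl//; try exact: L_integrable.
rewrite -RintegralB//; last 2 first.
- exact: (integrableZl measurableT _ (L_integrable _)).
- exact: (integrableZl measurableT _ (L_integrable _)).
rewrite -(w_haar DQ vn); apply: eq_Rintegral => x _; rewrite /haar -/s; ring.
Qed.

Let L_ancestor n l P Q : D l P -> D (l + n%:Z) Q -> Q `<=` P ->
  L Q * fine (mu P) = L P * fine (mu Q).
Proof.
move=> DP; elim: n Q => [|n IH] Q DQ QP.
  rewrite addr0 in DQ; have [x Qx] := cube_nonempty hD DQ.
  by rewrite (cube_eq hD DQ DP Qx (QP _ Qx)).
have len : l + n%:Z <= l + n.+1%:Z by rewrite lerD2l lez_nat.
have [Q' [[DQ' QQ'] _]] := ds_ancestor hD len DQ.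
have [x Qx] := cube_nonempty hD DQ.
have lel : l <= l + n%:Z by rewrite lerDl.
have Q'P := cube_sub hD lel DP DQ' (QQ' _ Qx) (QP _ Qx).
have cQ : children D (l + n%:Z) Q' Q.
  by split => //; rewrite -addrA -PoszD addn1.
have h1 := L_child DQ' cQ; have h2 := IH _ DQ' Q'P.
have q0 := cube_fine_gt0 hX hD DQ'.
apply: (mulIf (lt0r_neq0 q0)).
by rewrite mulrAC h1 mulrAC h2 mulrAC.
Qed.

(* The averages of [w] over a cube and over all its ancestors agree, and the
   measure of the ancestors is unbounded. *)
Lemma averages_vanish k Q : distinguished_center D ctr -> mu setT = +oo%E -> D k Q -> L Q = 0.
Proof.
move=> dc oo DQ; have [x Qx] := cube_nonempty hD DQ.
have q0 := cube_fine_gt0 hX hD DQ.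
set M := \int[nu]_x `|w x|.
have M0 : 0 <= M by apply: le_trans (L_bounded (cube_measurable hD DQ)).
apply/eqP; rewrite -normr_le0; apply/ler_addgt0Pr => e e0; rewrite add0r.
(* The mass asked of the ancestor makes [L Q = L P * mu Q / mu P] at most [e] in absolute value,
   since [L P] is bounded by [M]. *)
have [l [P [lk DP QP hP]]] := cube_absorb hX hD x DQ dc oo (M * fine (mu Q) / e).
have [n kn] : exists n : nat, k = l + n%:Z by exists `|k - l|%N; rewrite gez0_abs ?subr_ge0// addrCA subrr addr0.
rewrite kn in DQ; have h := L_ancestor DP DQ QP.
have p0 := cube_fine_gt0 hX hD DP.
rewrite -(ler_pM2r p0) -[X in _ * X <= _](gtr0_norm p0) -normrM h normrM (gtr0_norm q0).
apply: le_trans (ler_wpM2r (ltW q0) (L_bounded (cube_measurable hD DP))) _.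
by rewrite [e * _]mulrC -ler_pdivrMr.
Qed.

End Averages.

Section Uniqueness.
Context {R : realType} {d1 d2 : measure_display}.
Context {X1 : measurableType d1} {X2 : measurableType d2}.
Variables (rho1 : X1 -> X1 -> R) (rho2 : X2 -> X2 -> R).
Variables (mu1 : {sigma_finite_measure set X1 -> \bar R}).
Variables (mu2 : {sigma_finite_measure set X2 -> \bar R}).
Hypotheses (hX1 : homogeneous_type rho1 mu1) (hX2 : homogeneous_type rho2 mu2).
Variables (delta1 c1 C1 delta2 c2 C2 : R).
Variables (D1 : int -> set (set X1)) (ctr1 : int -> set X1 -> X1).
Variables (D2 : int -> set (set X2)) (ctr2 : int -> set X2 -> X2).
Hypotheses (hD1 : dyadic_system rho1 delta1 c1 C1 D1 ctr1)
  (hD2 : dyadic_system rho2 delta2 c2 C2 D2 ctr2).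
Variables (ord1 : int -> set X1 -> seq (set X1)) (ord2 : int -> set X2 -> seq (set X2)).
Hypotheses (hord1 : haar_order mu1 D1 ord1) (hord2 : haar_order mu2 D2 ord2).

Local Notation mu := (mu1 \x mu2)%E.
Local Notation rect := ((int * set X1) * (int * set X2))%type.
Local Notation hidx := (rect * (nat * nat))%type.
Implicit Types (i j : hidx) (r : rect) (f g : X1 * X2 -> R).

Local Notation haar_idx := (haar_index D1 D2 ord1 ord2).
Local Notation coef := (hcoef mu1 mu2 ord1 ord2).

(** [averages_vanish] is used once per variable. With [f] times a Haar function of the second
    variable as weight, it gives a vanishing integral against [\1_P]; thus [f * \1_P] is orthogonal
    to the Haar functions of the second variable, and a second use gives a vanishing integral over
    each rectangle. *)
Lemma haar_coef0_ae0 f : distinguished_center D1 ctr1 -> distinguished_center D2 ctr2 ->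
  mu1 setT = +oo%E -> mu2 setT = +oo%E -> mu.-integrable setT (EFin \o f) ->
  (forall i, haar_idx i -> coef f i = 0) -> ae_eq mu setT (EFin \o f) (cst 0%E).
Proof.
move=> dc1 dc2 oo1 oo2 fi f0; apply: (ae0_rects hX1 hX2 hD1 hD2 fi) => -[[k P] [l Q]] [/= DP DQ].
have mP := cube_measurable hD1 DP; have mQ := cube_measurable hD2 DQ.
have mP1 : measurable_fun setT (fun x : X1 * X2 => \1_P x.1 : R).
  by apply: (measurableT_comp (measurable_indic mP)); exact: measurable_fst.
have fP : mu.-integrable setT (EFin \o (fun x => f x * \1_P x.1)).
  apply: (integrable_mul_bounded fi mP1 (M := 1)) => x.
  by rewrite indicE ger0_norm//; case: (_ \in _).
have fPQ : \int[mu]_x (f x * \1_P x.1 * \1_Q x.2) = 0.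
  apply: (averages_vanish hX2 hD2 hord2 fP (@measurable_snd _ _ X1 X2) _ dc2 oo2 DQ).
  move=> k' Q' v DQ' vn; have [M hM] := haar_bounded mu2 ord2 k' Q' v.
  have mh : measurable_fun setT (fun x : X1 * X2 => haar mu2 (ord2 k' Q') v x.2).
    by apply: (measurableT_comp (haar_measurable hD2 hord2 DQ' vn)); exact: measurable_snd.
  have fh := integrable_mul_bounded fi mh (fun x => hM x.2).
  transitivity (\int[mu]_x (f x * haar mu2 (ord2 k' Q') v x.2 * \1_P x.1)).
    by apply: eq_Rintegral => x _; rewrite mulrAC.
  apply: (averages_vanish hX1 hD1 hord1 fh (@measurable_fst _ _ X1 X2) _ dc1 oo1 DP).
  move=> l' P' u DP' un.
  rewrite -[RHS](f0 (((l', P'), (k', Q')), (u, v))); last by split.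
  by apply: eq_Rintegral => x _; rewrite /haar_prod; ring.
have fPQi : mu.-integrable setT (EFin \o (fun x => f x * \1_P x.1 * \1_Q x.2)).
  apply: (integrable_mul_bounded fP _ (M := 1)) => [|x].
    by apply: (measurableT_comp (measurable_indic mQ)); exact: measurable_snd.
  by rewrite indicE ger0_norm//; case: (_ \in _).
rewrite integral_mkcond -[RHS](congr1 EFin fPQ) /Rintegral fineK; last exact: integrable_fin_num.
apply: eq_integral => x _; rewrite patchE /rect_set /= !indicE.
have [h|h] := pselect ((P `*` Q) x).
  by rewrite !mem_set ?mulr1//; case: h.
rewrite [x \in _]memNset//.
have [xP|xP] := boolP (x.1 \in P); last by rewrite mulr0 mul0r.
have [xQ|xQ] := boolP (x.2 \in Q); last by rewrite mulr0.
by case: h; split; rewrite -in_setE.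
Qed.

End Uniqueness.

(** * Sums of powers of 2 *)

Section PowersOfTwo.
Context {R : realType}.

Lemma pow2_gt0 (k : int) : 0 < 2 ^ k :> R.
Proof. by rewrite exprz_gt0. Qed.

Lemma pow2S (k : int) : 2 ^ (k + 1) = 2 * 2 ^ k :> R.
Proof. by rewrite expfzDr// expr1z mulrC. Qed.

Lemma pow2_le (k l : int) : k <= l -> 2 ^ k <= 2 ^ l :> R.
Proof. by move=> kl; rewrite ler_eXz2l// ltr1n. Qed.

Lemma pow2_unbounded (x : R) : exists n : nat, x < 2 ^ n%:Z.
Proof. by exists (Num.bound x); rewrite -exprnP; exact: upper_nthrootP. Qed.

Lemma pow2_small (x : R) : 0 < x -> exists k : int, 2 ^ k < x.
Proof.
move=> x0; have [n hn] := pow2_unbounded x^-1; exists (- n%:Z).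
by rewrite -invr_expz invf_plt// posrE pow2_gt0.
Qed.

(** In decreasing order each power is at most half of its predecessor, so the sum is at most twice
    the largest. *)
Lemma pow2_sum_le (t : seq int) (s : R) : uniq t -> 0 <= s ->
  {in t, forall k, 2 ^ k <= s} -> \sum_(k <- t) 2 ^ k <= 2 * s.
Proof.
move=> ut s0 ts; rewrite -(perm_big _ (permEl (perm_sort >=%O t))) /=.
have : sorted >=%O (sort >=%O t) by apply: sort_sorted => x y; exact: le_total.
move: ut; rewrite -(sort_uniq >=%O).
have : {in sort >=%O t, forall k, 2 ^ k <= s} by move=> k; rewrite mem_sort; exact: ts.
case: (sort _ t) => [_ _ _|k u us]; first by rewrite big_nil mulr_ge0.
move=> uk ku; apply: (@le_trans _ _ (2 * 2 ^ k)); last by rewrite ler_pM2l// us// mem_head.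
elim: u k uk ku {us} => [|l u IH] k; first by rewrite big_seq1 => _ _; rewrite ler_peMl// ?ler1n// ltW// pow2_gt0.
rewrite cons_uniq inE negb_or => /andP[/andP[kl _] ul] /= /andP[lk lu]; rewrite big_cons mulr_natl mulr2n lerD2l.
apply: le_trans (IH l ul lu) _; rewrite -pow2S; apply: pow2_le; by rewrite lezD1 lt_neqAle eq_sym kl.
Qed.

(** A dyadic layer cake formula at one point: integrated, it compares the sum of [2 ^ k] times the
    measure of the [k]-th level set with the integral. *)
Lemma pow2_level_sum (t : seq int) (s : \bar R) : uniq t -> (0 <= s)%E ->
  ((\sum_(k <- t) 2 ^ k * (((2 ^ k)%:E < s)%E)%:R)%:E <= 2%:E * s)%E.
Proof.
move=> ut; case: s => [s s0|_|//]; last by rewrite mulry gtr0_sg// mul1e leey.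
rewrite -EFinM lee_fin (eq_bigr (fun k => if 2 ^ k < s then 2 ^ k else 0)); last first.
  by move=> k _; rewrite lte_fin; case: ifP => _; rewrite ?mulr1 ?mulr0.
rewrite -big_mkcond -big_filter; apply: pow2_sum_le => //; first exact: filter_uniq.
by move=> k; rewrite mem_filter => /andP[/ltW].
Qed.

(** For fixed [k] the exponents [j] that occur are distinct, so their powers [2 ^ (- j)] sum to at
    most 2. *)
Lemma geometric_sum_le (q : seq (int * nat)) (b : int -> R) (K : R) : uniq q ->
  (forall k, 0 <= b k) ->
  (forall t, uniq t -> \sum_(k <- t) b k <= K) ->
  \sum_(kj <- q) 2 ^ (- kj.2%:Z) * b kj.1 <= 2 * K.
Proof.
move=> uq b0 bK; set t := undup [seq kj.1 | kj <- q].
have ut : uniq t by exact: undup_uniq.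
apply: (@le_trans _ _ (\sum_(k <- t) 2 * b k)); last by rewrite -mulr_sumr ler_pM2l//; exact: bK.
rewrite (_ : \sum_(kj <- q) _ = \sum_(k <- t) \sum_(kj <- q | kj.1 == k) 2 ^ (- kj.2%:Z) * b kj.1); last first.
  rewrite fiber_sum// big_seq [RHS]big_seq; apply: eq_bigr => kj kjq.
  by rewrite mem_undup map_f.
apply: ler_sum => k _.
rewrite (eq_bigr (fun kj => 2 ^ (- kj.2%:Z) * b k)); last by move=> kj /eqP ->.
rewrite -mulr_suml ler_wpM2r// -big_filter -(big_map (fun kj => - kj.2%:Z) xpredT (fun l => 2 ^ l)).
rewrite -[X in _ <= X]mulr1; apply: pow2_sum_le => //.
  rewrite map_inj_in_uniq ?filter_uniq// => -[k1 j1] [k2 j2]; rewrite !mem_filter /=.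
  by move=> /andP[/eqP -> _] /andP[/eqP -> _] /oppr_inj[->].
move=> _ /mapP[kj _ ->]; rewrite -[X in _ <= X](expr0z 2); apply: pow2_le.
by rewrite oppr_le0.
Qed.

End PowersOfTwo.

(** * Level sets of the square function *)

Section LevelSets.
Context {R : realType} {d1 d2 : measure_display}.
Context {X1 : measurableType d1} {X2 : measurableType d2}.
Variables (rho1 : X1 -> X1 -> R) (rho2 : X2 -> X2 -> R).
Variables (mu1 : {sigma_finite_measure set X1 -> \bar R}).
Variables (mu2 : {sigma_finite_measure set X2 -> \bar R}).
Hypotheses (hX1 : homogeneous_type rho1 mu1) (hX2 : homogeneous_type rho2 mu2).
Variables (delta1 c1 C1 delta2 c2 C2 : R).
Variables (D1 : int -> set (set X1)) (ctr1 : int -> set X1 -> X1).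
Variables (D2 : int -> set (set X2)) (ctr2 : int -> set X2 -> X2).
Hypotheses (hD1 : dyadic_system rho1 delta1 c1 C1 D1 ctr1)
  (hD2 : dyadic_system rho2 delta2 c2 C2 D2 ctr2).
Variables (ord1 : int -> set X1 -> seq (set X1)) (ord2 : int -> set X2 -> seq (set X2)).
Hypotheses (hord1 : haar_order mu1 D1 ord1) (hord2 : haar_order mu2 D2 ord2).

Local Notation mu := (mu1 \x mu2)%E.
Local Notation rect := ((int * set X1) * (int * set X2))%type.
Local Notation hidx := (rect * (nat * nat))%type.
Implicit Types (i j : hidx) (r : rect) (f g : X1 * X2 -> R).

Local Notation haar_idx := (haar_index D1 D2 ord1 ord2).
Local Notation coef := (hcoef mu1 mu2 ord1 ord2).
Local Notation square_fun := (square_fun mu1 mu2 D1 D2 ord1 ord2).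

(** [K] is chosen before the family, so one value serves all levels of all functions. *)
Lemma enlargement_ex : exists E : set rect -> set (X1 * X2), exists2 K : R, 0 < K &
  forall B, B `<=` rects D1 D2 ->
  [/\ qopen (prod_qm rho1 rho2) (E B), measurable (E B),
      forall r, B r -> rect_set r `<=` E B &
      forall Om, measurable Om ->
        (forall r, B r -> ((rect_mass mu1 mu2 r)%:E <= 2%:E * mu (Om `&` rect_set r))%E) ->
        (mu (E B) <= K%:E * mu Om)%E].
Proof.
have [H1 [K1 K10 [H1o H1s H1m H1C]]] := cube_hull hX1 hD1.
have [H2 [K2 K20 [H2o H2s H2m H2C]]] := cube_hull hX2 hD2.
exists (enlarge H1 H2), (16 * K1 * K2); first by rewrite !mulr_gt0.
move=> B hB; split.
- exact: (enlarge_open H1o H2o hB).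
- exact: (enlarge_measurable hX1 hX2 hD1 hD2 H1o H2o hB).
- by move=> r Br; exact: (sub_enlarge H1s H2s hB Br).
- move=> Om mO hO.
  exact: (enlarge_measure hX1 hX2 hD1 hD2 K10 K20 H1o H2o H1m H2m H1C H2C mO hB hO).
Qed.

Variable f : X1 * X2 -> R.
Hypothesis hf : hardy mu1 mu2 D1 D2 ord1 ord2 f.
Local Notation mass := (rect_mass mu1 mu2).
Local Notation wt := (rect_weight mu1 mu2).
Local Notation sqf := (square_sum mu1 mu2 D1 D2 ord1 ord2).

Definition level_set (k : int) : set (X1 * X2) := [set x | ((2 ^ k)%:E < square_fun f x)%E].

Definition half_level (k : int) : set rect :=
  [set r | (mass r)%:E <= 2%:E * mu (level_set k `&` rect_set r)]%E.

Definition level_rects (k : int) : set rect :=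
  [set r | [/\ rects D1 D2 r, half_level k r & ~ half_level (k + 1) r]].

Let mS : measurable_fun setT (square_fun f) :=
  square_fun_measurable hX1 hX2 hD1 hD2 ord1 ord2 f.

Let S0 x : (0 <= square_fun f x)%E := square_fun_ge0 mu1 mu2 D1 D2 ord1 ord2 f x.

Lemma level_set_measurable k : measurable (level_set k).
Proof.
rewrite -[level_set k]setTI; exact: emeasurable_fun_o_infty.
Qed.

Lemma level_set_sub (k l : int) : k <= l -> level_set l `<=` level_set k.
Proof. by move=> kl x; apply: le_lt_trans; rewrite lee_fin pow2_le. Qed.

Lemma level_set_markov k : ((2 ^ k)%:E * mu (level_set k) <= \int[mu]_x square_fun f x)%E.
Proof.
have mk := level_set_measurable k.
rewrite -(integral_cst mu mk).
apply: (@le_trans _ _ (\int[mu]_(x in level_set k) square_fun f x)%E).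
  apply: ge0_le_integral => //.
  - by move=> x _; rewrite lee_fin ltW// pow2_gt0.
  - exact: measurable_funTS.
  - by move=> x /= /ltW.
exact: ge0_subset_integral.
Qed.

Let intS : (\int[mu]_x square_fun f x < +oo)%E.
Proof.
by have [_ /integrableP[_]] := hf; under eq_integral do rewrite gee0_abs//.
Qed.

Lemma level_set_lty k : (mu (level_set k) < +oo)%E.
Proof.
have := le_lt_trans (level_set_markov k) intS.
by case: (mu _) => [r _|/=|//]; rewrite ?ltry// gt0_muley ?lte_fin ?pow2_gt0.
Qed.

Lemma level_set_sum (t : seq int) : uniq t ->
  (\sum_(k <- t) (2 ^ k)%:E * mu (level_set k) <= 2%:E * \int[mu]_x square_fun f x)%E.
Proof.
move=> ut; rewrite -ge0_integralZl//.
have -> : (\sum_(k <- t) (2 ^ k)%:E * mu (level_set k) =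
    \int[mu]_x \sum_(k <- t) (2 ^ k * (((2 ^ k)%:E < square_fun f x)%E)%:R)%:E)%E.
  rewrite ge0_integral_sum//; last 2 first.
  - move=> k; apply/measurable_EFinP/measurable_funM => //.
    rewrite (_ : (fun x => _) = \1_(level_set k)); first exact: measurable_indic (level_set_measurable k).
    by apply/funext => x; rewrite indicE; congr (nat_of_bool _)%:R; apply/idP/idP; rewrite in_setE.
  - by move=> k x _; rewrite lee_fin mulr_ge0// ltW// pow2_gt0.
  apply: eq_bigr => k _; rewrite -[in LHS](integral_cst mu (level_set_measurable k)) integral_mkcond.
  apply: eq_integral => x _; rewrite patchE; have [h|h] := pselect (level_set k x).
    by rewrite mem_set// /= h mulr1.
  by rewrite memNset// (_ : (_ < _)%E = false) ?mulr0//; exact/negP.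
apply: ge0_le_integral => //.
- by move=> x _; apply: sume_ge0 => k _; rewrite lee_fin mulr_ge0// ltW// pow2_gt0.
- apply: emeasurable_sum => k; apply/measurable_EFinP/measurable_funM => //.
  rewrite (_ : (fun x => _) = \1_(level_set k)); first exact: measurable_indic (level_set_measurable k).
  by apply/funext => x; rewrite indicE; congr (nat_of_bool _)%:R; apply/idP/idP; rewrite in_setE.
- exact: measurable_funeM.
- by move=> x _; rewrite sumEFin; exact: pow2_level_sum.
Qed.

Let half_level_sub (k l : int) r : k <= l -> rects D1 D2 r -> half_level l r -> half_level k r.
Proof.
move=> kl hr h; have mr := rect_set_measurable hD1 hD2 hr.
apply: le_trans h _; rewrite lee_pmul2l//.
apply: le_measure; rewrite ?inE; [exact: measurableI (level_set_measurable l) mr|exact: measurableI (level_set_measurable k) mr|].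
by apply: setSI; exact: level_set_sub.
Qed.

Lemma level_rects_inj k l r : level_rects k r -> level_rects l r -> k = l.
Proof.
wlog kl : k l / k <= l => [h|] hk hl.
  by have [kl|/ltW lk] := leP k l; [exact: h|apply/esym; exact: h].
apply/eqP; rewrite eq_le kl/= leNgt; apply/negP; rewrite -lezD1 => kl1.
have [hr _ nk] := hk; have [_ al _] := hl; apply: nk; exact: half_level_sub al.
Qed.

(** The single term of [i] keeps the square function above some [2 ^ k0] on the whole rectangle, so
    the half condition holds at [k0]; by Markov's inequality it fails for large indices. *)
Lemma level_rects_ex i : haar_idx i -> coef f i != 0 -> exists k, level_rects k i.1.
Proof.
move=> hi ci; have hr := haar_index_rects hi.
have m0 := rect_mass_gt0 hX1 hX2 hD1 hD2 hr; have mr := rect_set_measurable hD1 hD2 hr.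
have q0 : 0 < coef f i ^+ 2 / mass i.1 by rewrite divr_gt0// exprn_even_gt0.
have Sge x : rect_set i.1 x -> ((Num.sqrt (coef f i ^+ 2 / mass i.1))%:E <= square_fun f x)%E.
  move=> Rx; apply: (sqrt_le_square_fun hX1 hX2 hD1 hD2).
  apply: le_trans (seq_le_esum (s := [:: i]) _ _ _) => //.
  - by rewrite big_seq1 /rect_weight indicE mem_set// mul1r.
  - by move=> j [hj _]; rewrite lee_fin mulr_ge0 ?sqr_ge0 ?(rect_weight_ge0 hX1 hX2 hD1 hD2).
  - by move=> j; rewrite inE => /eqP ->.
have [k0 hk0] : exists k : int, 2 ^ k < Num.sqrt (coef f i ^+ 2 / mass i.1).
  by apply: pow2_small; rewrite sqrtr_gt0.
have a0 : half_level k0 i.1.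
  rewrite /half_level /= (_ : level_set k0 `&` rect_set i.1 = rect_set i.1); last first.
    apply/setIidPr => x Rx; apply: lt_le_trans (Sge x Rx); by rewrite lte_fin.
  by rewrite (measure_rect hX1 hX2 hD1 hD2 hr) -EFinM lee_fin ler_peMl ?ler1n// ltW.
have [n hn] : exists n : nat, ~ half_level (k0 + n%:Z) i.1.
  have I0 : (0 <= \int[mu]_x square_fun f x)%E by exact: integral_ge0.
  have Ifin : (\int[mu]_x square_fun f x)%E \is a fin_num by rewrite ge0_fin_numE.
  have [n hn] := pow2_unbounded (2 * fine (\int[mu]_x square_fun f x)%E / mass i.1 / 2 ^ k0).
  exists n => h; have := level_set_markov (k0 + n%:Z).
  have Lfin : mu (level_set (k0 + n%:Z)) \is a fin_num by rewrite ge0_fin_numE// level_set_lty.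
  apply/negP; rewrite -ltNge -(fineK Ifin) -(fineK Lfin) -EFinM lte_fin.
  have : mass i.1 <= 2 * fine (mu (level_set (k0 + n%:Z))).
    rewrite -lee_fin [X in (_ <= X)%E]EFinM fineK//; apply: (le_trans h); rewrite lee_pmul2l//.
    apply: le_measure; rewrite ?inE//; [exact: measurableI (level_set_measurable _) mr|exact: level_set_measurable].
  move: hn; rewrite ltr_pdivrMr ?pow2_gt0// -expfzDr// addrC ltr_pdivrMr// => h1 h2.
  have p0 := pow2_gt0 (R := R) (k0 + n%:Z).
  rewrite -(ltr_pM2l (ltr0n R 2)); apply: (lt_le_trans h1).
  by rewrite [X in _ <= X]mulrCA ler_pM2l.
have ex : exists n : nat, `[< ~ half_level (k0 + n%:Z) i.1 >] by exists n; exact/asboolP.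
(* The least failing offset is some [m.+1], never 0; the level is one below it, at [k0 + m]. *)
case: (ex_minnP ex) => -[/asboolP h _|m /asboolP h hmin]; first by rewrite addr0 in h.
have e : k0 + m.+1%:Z = k0 + m%:Z + 1 by rewrite -addrA -PoszD addn1.
rewrite e in h; exists (k0 + m%:Z); apply: And3; [exact: hr| |exact: h].
by apply: contrapT => /asboolP/hmin; rewrite ltnn.
Qed.

Lemma level_complement k r : level_rects k r ->
  ((2^-1 * mass r)%:E <= mu (rect_set r `&` ~` level_set (k + 1)))%E.
Proof.
move=> [hr _ na]; have mr := rect_set_measurable hD1 hD2 hr.
have m0 := rect_mass_gt0 hX1 hX2 hD1 hD2 hr.
have mL := level_set_measurable (k + 1).
have RL : (mass r)%:E = (mu (level_set (k + 1) `&` rect_set r) + mu (rect_set r `&` ~` level_set (k + 1)))%E.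
  rewrite -(measure_rect hX1 hX2 hD1 hD2 hr) setIC -measureU//.
  - by rewrite -setIUr setUv setIT.
  - exact: measurableI.
  - by apply: measurableI => //; exact: measurableC.
  - by rewrite setIACA setICr setI0.
move: na; rewrite /half_level /= => /negP; rewrite -ltNge RL => h.
move: RL h.
case: (mu (level_set (k + 1) `&` rect_set r)) => [u||]; case: (mu (rect_set r `&` ~` level_set (k + 1))) => [v||] //=.
rewrite -EFinD => -[->]; rewrite -EFinM lte_fin lee_fin; lra.
Qed.

(** At least half of a rectangle of level [k] lies where the square function is at most
    [2 ^ (k + 1)], so each squared coefficient is at most twice the integral of its term of
    [square_sum] over that region. Pointwise these doubled terms sum to at most [2 * 4 ^ (k + 1)],
    rounded up to [4 ^ (k + 2)], and vanish off [E]. *)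
Lemma level_energy k (E : set (X1 * X2)) : measurable E ->
  (forall r, level_rects k r -> rect_set r `<=` E) ->
  (\esum_(i in haar_idx `&` [set i | level_rects k i.1]) (coef f i ^+ 2)%:E
    <= ((2 ^ (k + 2)) ^+ 2)%:E * mu E)%E.
Proof.
move=> mE hE; set I := haar_idx `&` _; set Lc := ~` level_set (k + 1).
have mL : measurable Lc by apply: measurableC; exact: level_set_measurable.
have mLc : measurable_fun setT (\1_Lc : X1 * X2 -> R) by exact: measurable_indic.
pose a i x : \bar R := (coef f i ^+ 2 * (2 * (wt i.1 x * \1_Lc x)))%:E.
have Ic : countable I by apply: sub_countable (haar_index_countable hD1 hD2 ord1 ord2); exact: subset_card_le (@subIsetl _ _ _).
have a0 i x : I i -> (0 <= a i x)%E.
  move=> [[hi _] _]; rewrite lee_fin; apply: mulr_ge0; first exact: sqr_ge0.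
  apply: mulr_ge0 => //; apply: mulr_ge0; first exact: (rect_weight_ge0 hX1 hX2 hD1 hD2).
  by rewrite indicE.
have ma i : I i -> measurable_fun setT (a i).
  move=> [[hi _] _]; apply/measurable_EFinP; apply: (measurable_funM (measurable_cst _)).
  apply: (measurable_funM (measurable_cst _)); apply: (measurable_funM _ mLc).
  exact: (rect_weight_measurable mu1 mu2 hD1 hD2 hi).
have ca i : I i -> ((coef f i ^+ 2)%:E <= \int[mu]_x a i x)%E.
  move=> [hi hk]; have hr := haar_index_rects hi; have m0 := rect_mass_gt0 hX1 hX2 hD1 hD2 hr.
  have mRL : measurable (rect_set i.1 `&` Lc) by apply: measurableI => //; exact: (rect_set_measurable hD1 hD2 hr).
  have c0 : 0 <= coef f i ^+ 2 * (2 / mass i.1) by rewrite mulr_ge0 ?sqr_ge0// divr_ge0// ltW.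
  rewrite (_ : (\int[mu]_x _ = (coef f i ^+ 2 * (2 * (mass i.1)^-1))%:E * mu (rect_set i.1 `&` Lc))%E).
    apply: (@le_trans _ _ ((coef f i ^+ 2 * (2 * (mass i.1)^-1))%:E * (2^-1 * mass i.1)%:E)%E).
      by rewrite -EFinM lee_fin -mulrA ler_peMr ?sqr_ge0// mulrACA divff// mul1r mulVf// gt_eqF.
    apply: lee_pmul => //; last exact: level_complement.
    - by rewrite lee_fin pmulr_rge0 ?invr_gt0// ltW.
  rewrite -[X in (_ * mu X)%E]setIT -(integral_indic _ measurableT)// -ge0_integralZl//; last first.
    by apply/measurable_EFinP; exact: measurable_indic.
  apply: eq_integral => x _; rewrite /a /rect_weight -EFinM; congr EFin.
  rewrite (_ : \1_(rect_set i.1 `&` Lc) x = \1_(rect_set i.1) x * \1_Lc x).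
    by ring.
  by rewrite !indicE in_setI -natrM mulnb.
apply: (@le_trans _ _ (\esum_(i in I) \int[mu]_x a i x)%E); first exact: le_esum.
rewrite -(integral_esum mu (((0, set0), (0, set0)), (0%N, 0%N)) Ic)//.
have P0 : 0 <= (2 ^ (k + 2)) ^+ 2 :> R by exact: sqr_ge0.
rewrite -[X in (_ * mu X)%E]setIT -(integral_indic _ measurableT)// -ge0_integralZl//; last first.
  by apply/measurable_EFinP; exact: measurable_indic.
apply: ge0_le_integral => //.
- by move=> x _; apply: esum_ge0 => i Ii; exact: a0.
- exact: (measurable_esum (((0, set0), (0, set0)), (0%N, 0%N)) Ic).
- by apply: measurable_funeM; apply/measurable_EFinP; exact: measurable_indic.
move=> x _; apply: esum_le_seq => s us sI.
have [Lx|nLx] := pselect (Lc x); last first.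
  rewrite big1 => [|i _]; first by rewrite -EFinM lee_fin mulr_ge0.
  by rewrite /a [\1_Lc x]indicE memNset// !mulr0.
have [Ex|nEx] := pselect (E x); last first.
  rewrite big_seq big1 => [|i /sI[hi hk]]; first by rewrite -EFinM lee_fin mulr_ge0.
  by rewrite /a /rect_weight indicE memNset ?mul0r ?mulr0// => /(hE _ hk).
rewrite [\1_E x]indicE mem_set// mule1.
have Sx : (square_fun f x <= (2 ^ (k + 1))%:E)%E by rewrite leNgt; apply/negP.
have : (sqf f x <= ((2 ^ (k + 1)) ^+ 2)%:E)%E.
  rewrite -(square_fun_sqr hX1 hX2 hD1 hD2); move: Sx (S0 x); case: (square_fun f x) => [u|//|//].
  by rewrite -EFin_expe !lee_fin => uk u0; rewrite ler_sqr// nnegrE ltW// pow2_gt0.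
move=> h; have : (\sum_(i <- s) (coef f i ^+ 2 * wt i.1 x)%:E <= ((2 ^ (k + 1)) ^+ 2)%:E)%E.
  apply: le_trans h; apply: seq_le_esum => //.
  - by move=> j [hj _]; rewrite lee_fin mulr_ge0 ?sqr_ge0 ?(rect_weight_ge0 hX1 hX2 hD1 hD2).
  - by move=> i /sI[].
rewrite !sumEFin !lee_fin => h1.
rewrite (eq_bigr (fun i => 2 * (coef f i ^+ 2 * wt i.1 x))); last first.
  by move=> i _; rewrite [\1_Lc x]indicE mem_set// mulr1 mulrCA.
rewrite -mulr_sumr (_ : k + 2 = k + 1 + 1) ?(pow2S (k + 1)); last by rewrite -addrA.
rewrite exprMn.
have := sqr_ge0 (2 ^ (k + 1) : R); move: h1; set u := \sum_(i <- s) _; set v := (2 ^ (k + 1)) ^+ 2; lra.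
Qed.

End LevelSets.

(** * Assembling the atomic decomposition *)

Section Decomposition.
Context {R : realType} {d1 d2 : measure_display}.
Context {X1 : measurableType d1} {X2 : measurableType d2}.
Variables (rho1 : X1 -> X1 -> R) (rho2 : X2 -> X2 -> R).
Variables (mu1 : {sigma_finite_measure set X1 -> \bar R}).
Variables (mu2 : {sigma_finite_measure set X2 -> \bar R}).
Hypotheses (hX1 : homogeneous_type rho1 mu1) (hX2 : homogeneous_type rho2 mu2).
Variables (delta1 c1 C1 delta2 c2 C2 : R).
Variables (D1 : int -> set (set X1)) (ctr1 : int -> set X1 -> X1).
Variables (D2 : int -> set (set X2)) (ctr2 : int -> set X2 -> X2).
Hypotheses (hD1 : dyadic_system rho1 delta1 c1 C1 D1 ctr1)
  (hD2 : dyadic_system rho2 delta2 c2 C2 D2 ctr2).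
Variables (ord1 : int -> set X1 -> seq (set X1)) (ord2 : int -> set X2 -> seq (set X2)).
Hypotheses (hord1 : haar_order mu1 D1 ord1) (hord2 : haar_order mu2 D2 ord2).

Local Notation mu := (mu1 \x mu2)%E.
Local Notation rect := ((int * set X1) * (int * set X2))%type.
Local Notation hidx := (rect * (nat * nat))%type.
Implicit Types (i j : hidx) (r : rect) (f g : X1 * X2 -> R).

Local Notation haar_idx := (haar_index D1 D2 ord1 ord2).
Local Notation coef := (hcoef mu1 mu2 ord1 ord2).
Local Notation square_fun := (square_fun mu1 mu2 D1 D2 ord1 ord2).

Local Notation hcomb := (haar_comb mu1 mu2 ord1 ord2).
Local Notation atom := (dyadic_atom rho1 rho2 mu1 mu2 D1 D2).
Local Notation level_rects := (level_rects mu1 mu2 D1 D2 ord1 ord2).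

(** The divisor normalizes the block: an energy of at most [4 ^ (- j) * 4 ^ (k + 2) * m], with [m]
    the measure of [E], divided by the square of [2 ^ (- j) * 2 ^ (k + 2) * m], leaves [1 / m], as
    [finite_atom] requires. The clause [0 < fine (mu E)] lets the divisor cancel later. *)
Lemma level_blocks f k (E : set (X1 * X2)) : hardy mu1 mu2 D1 D2 ord1 ord2 f ->
  qopen (prod_qm rho1 rho2) E -> measurable E -> (mu E < +oo)%E ->
  (forall r, level_rects f k r -> rect_set r `<=` E) ->
  exists (s : nat -> seq hidx) (blk : hidx -> nat), forall j : nat,
    [/\ uniq (s j),
        forall i, i \in s j <-> [/\ haar_idx i, level_rects f k i.1, coef f i != 0 & blk i = j],
        forall i, i \in s j -> 0 < fine (mu E) &
        atom (hcomb (s j) (fun i => coef f i / (2 ^ (- j%:Z) * (2 ^ (k + 2) * fine (mu E)))))].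
Proof.
move=> hf oE mE Eoo hE.
have Efin : mu E \is a fin_num by rewrite ge0_fin_numE.
(* A null [E] contains no rectangle of the level, since these have positive mass; all blocks are
   empty and the zero function is the atom. *)
have [m0|mn0] := eqVneq (fine (mu E)) 0.
  have none i : haar_idx i -> ~ level_rects f k i.1.
    move=> hi hk; have hr := haar_index_rects hi.
    have : (mu (rect_set i.1) <= mu E)%E.
      by apply: le_measure; rewrite ?inE//; [exact: (rect_set_measurable hD1 hD2 hr)|exact: hE].
    rewrite (measure_rect hX1 hX2 hD1 hD2 hr) -(fineK Efin) m0 lee_fin leNgt.
    by rewrite (rect_mass_gt0 hX1 hX2 hD1 hD2 hr).
  exists (fun _ => [::]), (fun _ => 0%N) => j; split => //.
    by move=> i; split => // -[hi /none].
  by apply: (finite_atom hX1 hX2 hD1 hD2 hord1 hord2 oE) => //; rewrite big_nil inve_ge0.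
have m0 : 0 < fine (mu E) by rewrite lt0r mn0 fine_ge0.
set m := fine (mu E) in m0 *.
set I := haar_idx `&` [set i | level_rects f k i.1].
have Ic : countable I by apply: sub_countable (haar_index_countable hD1 hD2 ord1 ord2); exact: subset_card_le (@subIsetl _ _ _).
have P0 := pow2_gt0 (R := R) (k + 2).
have S0 : 0 < (2 ^ (k + 2)) ^+ 2 * m by rewrite mulr_gt0// exprn_gt0.
have en := level_energy hX1 hX2 hD1 hD2 mE hE.
rewrite -(fineK Efin) -EFinM in en.
have [blk hblk] := geometric_blocks Ic (fun i _ => sqr_ge0 (coef f i)) S0 en.
pose B (j : nat) := I `&` [set i | coef f i ^+ 2 != 0 /\ blk i = j].
have fB (j : nat) : finite_set (B j) by have [] := hblk j.
have sB (j : nat) i : i \in (fset_set (B j) : seq _) <->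
    [/\ haar_idx i, level_rects f k i.1, coef f i != 0 & blk i = j].
  rewrite in_fset_set// in_setE /B /I /=; split.
    by move=> [[hi hk] [c0 bi]]; split => //; move: c0; rewrite sqrf_eq0.
  by move=> [hi hk c0 bi]; split => //; rewrite sqrf_eq0.
exists (fun j : nat => fset_set (B j)), blk => j; split => //; first exact: fset_uniq.
apply: (finite_atom hX1 hX2 hD1 hD2 hord1 hord2 oE) => //; first exact: fset_uniq.
- by move=> i /sB[].
- by move=> i /sB[_ /hE].
rewrite -(fineK Efin) -/m inver gt_eqF// lee_fin.
have : \sum_(i <- fset_set (B j)) coef f i ^+ 2 <= (4^-1) ^+ j * ((2 ^ (k + 2)) ^+ 2 * m).
  rewrite -lee_fin -sumEFin; have [_ h] := hblk j; apply: le_trans h; apply: seq_le_esum => //.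
  - by move=> i _; rewrite lee_fin sqr_ge0.
  - by move=> i; rewrite in_fset_set// in_setE.
have q0 := pow2_gt0 (R := R) (- j%:Z).
have -> : (4^-1 : R) ^+ j = (2 ^ (- j%:Z)) ^+ 2.
  by rewrite -exprnN -exprVn -exprM mulnC exprM; congr (_ ^+ j); rewrite expr2; lra.
move=> h; under eq_bigr do rewrite exprMn.
rewrite -mulr_suml exprVn ler_pdivrMr; last by rewrite exprn_gt0// !mulr_gt0.
apply: le_trans h _; rewrite le_eqVlt; apply/orP; left; apply/eqP; field.
by rewrite gt_eqF.
Qed.

Lemma square_fun_coef0 f : (forall i, haar_idx i -> coef f i = 0) ->
  hardy_norm mu1 mu2 D1 D2 ord1 ord2 f = 0%E.
Proof.
move=> f0; rewrite hardy_normE integral0_eq// => x _.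
rewrite (square_funE hX1 hX2 hD1 hD2) /square_sum esum1 ?poweR0r ?invr_eq0// => i hi.
by rewrite f0// expr0n mul0r.
Qed.

Lemma L1_series_ae (lambda : nat -> R) a f g : mu.-integrable setT (EFin \o f) ->
  (forall k, atom (a k)) -> L1_series mu1 mu2 lambda a g ->
  ae_eq mu setT (EFin \o (f \- g)) (cst 0%E) -> L1_series mu1 mu2 lambda a f.
Proof.
move=> fi aa /L1_seriesE[gi cg] fg; apply/L1_seriesE; split => //.
have ai k : mu.-integrable setT (EFin \o (fun x => lambda k * a k x)).
  apply: integrable_scale; exact: atom_integrable (aa k).
have si n : mu.-integrable setT (EFin \o (fun x => \sum_(k < n) lambda k * a k x)).
  by have [] := @Rintegral_sum _ _ _ mu _ (index_enum 'I_n) xpredT (fun k x => lambda k * a k x) (fun k _ => ai k).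
have mm n h : mu.-integrable setT (EFin \o h) ->
    measurable_fun setT (fun x => `|(h x - \sum_(k < n) lambda k * a k x)%:E|%E).
  move=> hi; apply: measurableT_comp => //; apply/measurable_EFinP; apply: measurable_funB; apply/measurable_EFinP.
    exact: measurable_int hi.
  exact: measurable_int (si n).
rewrite (_ : (fun n => \int[mu]_x `|_|)%E = fun n => (\int[mu]_x `|(g x - \sum_(k < n) lambda k * a k x)%:E|)%E)//.
apply/funext => n; apply: ae_eq_integral => //; [exact: mm|exact: mm|].
apply: filterS fg => x /(_ I) [] /eqP; rewrite subr_eq0 => /eqP e _.
by rewrite e.
Qed.

(** The comparison of [f] with [g] stops at Haar coefficients; equality almost everywhere and Hardy
    distance zero are both read off from it in the theorem. *)
Lemma hardy_atomic : exists2 C : R, 0 < C &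
  forall f, hardy mu1 mu2 D1 D2 ord1 ord2 f ->
  exists (lambda : nat -> R) (a : nat -> X1 * X2 -> R) (g : X1 * X2 -> R),
    [/\ forall p, atom (a p),
        (\sum_(0 <= p <oo) `|lambda p|%:E <= C%:E * hardy_norm mu1 mu2 D1 D2 ord1 ord2 f)%E,
        L1_series mu1 mu2 lambda a g &
        forall i, haar_idx i -> coef (f \- g) i = 0].
Proof.
have [E [K K0 hE]] := enlargement_ex hX1 hX2 hD1 hD2.
(* The factor 16 is 4 from [2 ^ (k + 2)] against [2 ^ k], 2 from [level_set_sum] and 2 from the sum
   over [j]; [K] is the enlargement constant. *)
exists (16 * K); first by rewrite mulr_gt0.
move=> f hf; set S := (\int[mu]_x square_fun f x)%E.
have S0 : (0 <= S)%E by apply: integral_ge0 => x _; exact: square_fun_ge0.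
have Sfin : S \is a fin_num.
  rewrite ge0_fin_numE//; have [_ /integrableP[_]] := hf.
  by under eq_integral do rewrite gee0_abs ?square_fun_ge0//.
pose Ek k := E (level_rects f k).
have Bk k : level_rects f k `<=` rects D1 D2 by move=> r [].
have muE k : (mu (Ek k) <= K%:E * mu (level_set mu1 mu2 D1 D2 ord1 ord2 f k))%E.
  have [_ _ _ h] := hE _ (Bk k); apply: h; first exact: (level_set_measurable hX1 hX2 hD1 hD2).
  by move=> r [].
have Loo k := level_set_lty hX1 hX2 hD1 hD2 hf k.
have Eoo k : (mu (Ek k) < +oo)%E.
  by apply: le_lt_trans (muE k) _; rewrite lte_mul_pinfty// ?lee_fin ?ltW// ltry.
pose m (k : int) := fine (mu (Ek k)).
have m0 k : 0 <= m k by exact: fine_ge0.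
have /choice[s0 /choice[blk hs]] : forall k, exists (s : nat -> seq hidx) (blk : hidx -> nat), forall j : nat,
    [/\ uniq (s j),
        forall i, i \in s j <-> [/\ haar_idx i, level_rects f k i.1, coef f i != 0 & blk i = j],
        forall i, i \in s j -> 0 < m k &
        atom (hcomb (s j) (fun i => coef f i / (2 ^ (- j%:Z) * (2 ^ (k + 2) * m k))))].
  move=> k; have [oE mE sE _] := hE _ (Bk k).
  exact: (level_blocks hf oE mE (Eoo k) sE).
pose b (k : int) := 2 ^ (k + 2) * m k.
pose lam (kj : int * nat) := 2 ^ (- kj.2%:Z) * b kj.1.
pose at_ (kj : int * nat) := hcomb (s0 kj.1 kj.2) (fun i => coef f i / lam kj).
have b0 k : 0 <= b k by rewrite mulr_ge0// ltW// pow2_gt0.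
have lam0 kj : 0 <= lam kj by rewrite mulr_ge0// ltW// pow2_gt0.
have bsum (t : seq int) : uniq t -> \sum_(k <- t) b k <= 8 * K * fine S.
  move=> ut; have := level_set_sum hX1 hX2 hD1 hD2 ord1 ord2 f ut; rewrite -/S -(fineK Sfin) => h.
  have {}h : \sum_(k <- t) 2 ^ k * fine (mu (level_set mu1 mu2 D1 D2 ord1 ord2 f k)) <= 2 * fine S.
    rewrite -lee_fin -sumEFin EFinM; apply: le_trans h; apply: lee_sum => k _.
    by rewrite EFinM fineK// ge0_fin_numE.
  apply: (@le_trans _ _ (\sum_(k <- t) 4 * K * (2 ^ k * fine (mu (level_set mu1 mu2 D1 D2 ord1 ord2 f k))))); last first.
    by rewrite -mulr_sumr; apply: le_trans (ler_wpM2l _ h) _; [rewrite mulr_ge0// ltW|lra].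
  apply: ler_sum => k _; rewrite /b (_ : k + 2 = k + 1 + 1) ?(pow2S (k + 1)) ?(pow2S k); last by rewrite -addrA.
  have : m k <= K * fine (mu (level_set mu1 mu2 D1 D2 ord1 ord2 f k)).
    rewrite -lee_fin EFinM !fineK//; last by rewrite ge0_fin_numE.
    by rewrite ge0_fin_numE.
  rewrite (_ : 4 * K * _ = 2 * (2 * 2 ^ k) * (K * fine (mu (level_set mu1 mu2 D1 D2 ord1 ord2 f k)))); last by ring.
  by move=> h1; rewrite ler_wpM2l// !mulr_ge0// ltW// pow2_gt0.
(* Pairs [(k, j)] are listed by their codes; a number that codes no pair gets the coefficient 0 and
   an arbitrary atom. *)
pose lambda (p : nat) := oapp lam 0 (pickle_inv p).
pose a (p : nat) := oapp at_ (at_ (0, 0%N)) (pickle_inv p).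
have aa p : atom (a p).
  have h kj : atom (at_ kj) by have [] := hs kj.1 kj.2.
  by rewrite /a; case: (pickle_inv p) => [kj|] /=; exact: h.
have lsum : (\sum_(0 <= p <oo) `|lambda p|%:E <= (16 * K)%:E * S)%E.
  apply: lime_le; first by apply: is_cvg_nneseries => p _ _; rewrite lee_fin.
  apply: nearW => n; rewrite sumEFin -(fineK Sfin) -EFinM lee_fin.
  rewrite (eq_bigr (fun p => oapp lam 0 (pickle_inv p))); last first.
    by move=> p _; rewrite ger0_norm// /lambda; case: pickle_inv.
  rewrite -big_pmap (_ : 16 * K * fine S = 2 * (8 * K * fine S)); last by ring.
  apply: geometric_sum_le => //; apply: pmap_uniq (@pickle_invK _) _ _.
  exact: iota_uniq.
have [g hg] : exists g, L1_series mu1 mu2 lambda a g.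
  apply: (atom_series_ex aa).
  by apply: le_lt_trans lsum _; rewrite -(fineK Sfin) -EFinM ltry.
exists lambda, a, g; split => //; first by rewrite hardy_normE.
move=> i hi; have fi : mu.-integrable setT (EFin \o f) by apply/Lfun1_integrable; have [] := hf.
have gi : mu.-integrable setT (EFin \o g) by have /L1_seriesE[] := hg.
rewrite (coefB hD1 hD2 hord1 hord2 hi fi gi); apply/eqP; rewrite subr_eq0; apply/eqP.
have cg := L1_series_coef hD1 hD2 hord1 hord2 aa hg hi.
have ca kj : lam kj * coef (at_ kj) i = if i \in s0 kj.1 kj.2 then coef f i else 0.
  have [us sI sm _] := hs kj.1 kj.2.
  rewrite (coef_haar_comb hX1 hX2 hD1 hD2 hord1 hord2)//; last by move=> i' /sI[].
  case: ifPn => [is_|_]; last by rewrite mulr0.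
  rewrite mulrCA divff ?mulr1// gt_eqF// !mulr_gt0 ?pow2_gt0//; exact: sm is_.
(* A Haar index with nonzero coefficient lies in exactly one block, given by its level and its [blk]
   value, so the series of coefficients has a single nonzero term. *)
have [p0 hp0] : exists p0, forall p, lambda p * coef (a p) i = if p == p0 then coef f i else 0.
  have [c0|c0] := eqVneq (coef f i) 0.
    exists 0%N => p; rewrite c0 if_same /lambda /a; case: (pickle_inv p) => [kj|] /=; last by rewrite mul0r.
    by rewrite ca c0 if_same.
  have [k hk] := level_rects_ex hX1 hX2 hD1 hD2 hf hi c0.
  exists (choice.pickle (k, blk k i)) => p; case: eqP => [->|pn].
    rewrite /lambda /a pickleK_inv /= ca ifT//=.
    by have [_ sI _ _] := hs k (blk k i); apply/sI.
  have := @pickle_invK (int * nat)%type p; rewrite /lambda /a.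
  case: (pickle_inv p) => [[k' j']|] /= h; last by rewrite mul0r.
  rewrite ca /=; case: ifPn => // is_; have [_ sI _ _] := hs k' j'.
  have [_ hk' _ bj] := (sI i).1 is_; case: pn; rewrite -h -bj.
  by rewrite (level_rects_inj hX1 hX2 hD1 hD2 hk hk').
have : (fun n => \sum_(k < n) lambda k * coef (a k) i) @ \oo --> coef f i.
  apply: cvg_near_cst; exists p0.+1 => // n /= pn.
  rewrite (eq_bigr (fun k : 'I_n => if (k : nat) == p0 then coef f i else 0)) => [|k _]; last exact: hp0.
  rewrite -big_mkcond (big_pred1 (Ordinal pn))//.
by move=> /(cvg_unique (@Rhausdorff R) cg) ->.
Qed.

End Decomposition.

Theorem theorem6p5 (R : realType) (d1 d2 : measure_display)
    (X1 : measurableType d1) (X2 : measurableType d2)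
    (rho1 : X1 -> X1 -> R) (rho2 : X2 -> X2 -> R)
    (mu1 : {sigma_finite_measure set X1 -> \bar R})
    (mu2 : {sigma_finite_measure set X2 -> \bar R})
    (hX1 : homogeneous_type rho1 mu1) (hX2 : homogeneous_type rho2 mu2)
    (delta1 c1 C1 delta2 c2 C2 : R)
    (D1 : int -> set (set X1)) (ctr1 : int -> set X1 -> X1)
    (D2 : int -> set (set X2)) (ctr2 : int -> set X2 -> X2)
    (hD1 : dyadic_system rho1 delta1 c1 C1 D1 ctr1)
    (hD2 : dyadic_system rho2 delta2 c2 C2 D2 ctr2)
    (hctr1 : distinguished_center D1 ctr1)
    (hctr2 : distinguished_center D2 ctr2)
    (ord1 : int -> set X1 -> seq (set X1))
    (ord2 : int -> set X2 -> seq (set X2))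
    (hord1 : haar_order mu1 D1 ord1) (hord2 : haar_order mu2 D2 ord2) :
  (exists2 C : R, 0 < C &
    forall f : X1 * X2 -> R,
      hardy mu1 mu2 D1 D2 ord1 ord2 f -> f \in Lfun (mu1 \x mu2)%E 2%:E ->
      exists (lambda : nat -> R) (a : nat -> X1 * X2 -> R),
        [/\ forall k, dyadic_atom rho1 rho2 mu1 mu2 D1 D2 (a k),
            (\sum_(0 <= k <oo) `|lambda k|%:E
              <= C%:E * hardy_norm mu1 mu2 D1 D2 ord1 ord2 f)%E,
            mu1 setT = +oo%E -> mu2 setT = +oo%E ->
              L1_series mu1 mu2 lambda a f &
            exists2 g : X1 * X2 -> R, L1_series mu1 mu2 lambda a g &
              hardy_norm mu1 mu2 D1 D2 ord1 ord2 (f \- g) = 0%E])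
  /\
  (exists2 C : R, 0 < C &
    forall (lambda : nat -> R) (a : nat -> X1 * X2 -> R),
      (forall k, dyadic_atom rho1 rho2 mu1 mu2 D1 D2 (a k)) ->
      (\sum_(0 <= k <oo) `|lambda k|%:E < +oo)%E ->
      (exists f : X1 * X2 -> R, L1_series mu1 mu2 lambda a f) /\
      forall f : X1 * X2 -> R, L1_series mu1 mu2 lambda a f ->
        hardy mu1 mu2 D1 D2 ord1 ord2 f /\
        (hardy_norm mu1 mu2 D1 D2 ord1 ord2 f
          <= C%:E * \sum_(0 <= k <oo) `|lambda k|%:E)%E).
Proof.
split; last first.
  (* The constant is 1, each atom having Hardy norm at most 1. *)
  exists 1 => // lambda a aa lsum; split; first exact: (atom_series_ex aa lsum).
  move=> f hf; rewrite mul1e.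
  exact: (series_hardy hX1 hX2 hD1 hD2 hord1 hord2 aa lsum hf).
have [C C0 hC] := hardy_atomic hX1 hX2 hD1 hD2 hord1 hord2.
exists C => // f hf _; have [lambda [a [g [aa lsum hg fg]]]] := hC f hf.
exists lambda, a; split => //; last first.
  by exists g => //; exact: (square_fun_coef0 hX1 hX2 hD1 hD2 fg).
move=> oo1 oo2; have fi : (mu1 \x mu2)%E.-integrable setT (EFin \o f).
  by apply/Lfun1_integrable; have [] := hf.
have gi : (mu1 \x mu2)%E.-integrable setT (EFin \o g) by have /L1_seriesE[] := hg.
apply: (L1_series_ae fi aa hg).
apply: (haar_coef0_ae0 hX1 hX2 hD1 hD2 hord1 hord2 hctr1 hctr2 oo1 oo2 _ fg).
rewrite (_ : EFin \o _ = (EFin \o f) \- (EFin \o g))%E//.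
exact: integrableB.
Qed.
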